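(* Let $M$ be an orientable smooth manifold of dimension $2n+1$ and put $W=M\times\mathbb{R}$. The following assertions are equivalent: (1) the gauge equation of self-dual connections on $M$ admits a skew-symmetric solution $\theta$ with $\operatorname{rank}\theta=2n$; (2) $M$ admits an almost contact metric structure; (3) $W$ has an almost Hermitian structure; (4) the gauge equation of self-dual connections on $W$ admits a skew-symmetric solution $\theta$ with $\operatorname{rank}\theta=2n+2$.
   Context: Given a Riemannian metric $g$ and an affine connection $\nabla$ (torsion allowed) on a manifold $N$, the dual connection $\nabla^*$ is defined by $Z(g(X,Y))=g(\nabla_Z X,Y)+g(X,\nabla^*_Z Y)$; $\nabla$ is self-dual if $\nabla=\nabla^*$, in which case the gauge equation $\nabla^*_X(\theta Y)=\theta(\nabla_XY)$ reads $\nabla\theta=0$. ''The gauge equation of self-dual connections on $N$ admits a skew-symmetric solution $\theta$ with $\operatorname{rank}\theta=r$'' means: there exist a Riemannian metric $g$ on $N$, an affine connection $\nabla$ self-dual with respect to $g$, and a $(1,1)$-tensor field $\theta$ of rank $r$ at every point with $g(\theta X,Y)=-g(X,\theta Y)$ and $\nabla\theta=0$. An almost contact metric structure is a quadruple $(\theta,\xi,\eta,g)$ ($(1,1)$-tensor field, vector field, 1-form, Riemannian metric) with $\eta(\xi)=1$, $\theta^2=-\mathrm{Id}+\eta\otimes\xi$ and $g(\theta X,\theta Y)=g(X,Y)-\eta(X)\eta(Y)$. An almost Hermitian structure is a pair $(J,h)$ of an almost complex structure $J$ and a Riemannian metric $h$ with $h(JX,JY)=h(X,Y)$. *)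

(* Defs.v *)
From HB Require Import structures.
From mathcomp Require Import all_boot all_order all_algebra.
From mathcomp Require Import all_classical all_reals all_analysis.

Set Implicit Arguments.
Unset Strict Implicit.
Unset Printing Implicit Defensive.
Import Order.TTheory GRing.Theory Num.Theory.
Import numFieldNormedType.Exports.

Local Open Scope classical_set_scope.
Local Open Scope ring_scope.

(* Elements of R^m are row vectors, and a linear map R^m -> R^k is a matrix
   acting on the right, as in the library's 'J f x. *)

Section Smooth.
Variables (R : realType) (m : nat) (V : normedModType R).

Fixpoint Ck_on (k : nat) (U : set 'rV[R]_m) (f : 'rV[R]_m -> V) : Prop :=
  if k is k'.+1 then
    (forall x, U x -> differentiable f x) /\
    (forall v, Ck_on k' U (fun x => 'D_v f x))
  else forall x, U x -> {for x, continuous f}.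

Definition smooth_on (U : set 'rV[R]_m) (f : 'rV[R]_m -> V) : Prop :=
  forall k, Ck_on k U f.

End Smooth.

(* The maps of a chart are total functions; they are homeomorphisms inverse to
   each other between chart_dom and chart_cod, and arbitrary elsewhere. *)
Record chart (R : realType) (T : topologicalType) (m : nat) := Chart {
  chart_dom : set T;
  chart_cod : set 'rV[R]_m;
  chart_fun :> T -> 'rV[R]_m;
  chart_inv : 'rV[R]_m -> T;
  chart_dom_open : open chart_dom;
  chart_cod_open : open chart_cod;
  chart_funP : forall p, chart_dom p -> chart_cod (chart_fun p);
  chart_invP : forall x, chart_cod x -> chart_dom (chart_inv x);
  chart_funK : forall p, chart_dom p -> chart_inv (chart_fun p) = p;
  chart_invK : forall x, chart_cod x -> chart_fun (chart_inv x) = x;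
  chart_fun_cont : forall p, chart_dom p -> {for p, continuous chart_fun};
  chart_inv_cont : forall x, chart_cod x -> {for x, continuous chart_inv} }.

Definition overlap (R : realType) (T : topologicalType) (m : nat)
    (c c' : chart R T m) : set 'rV[R]_m :=
  chart_cod c `&` chart_inv c @^-1` chart_dom c'.

Definition compatible (R : realType) (T : topologicalType) (m : nat)
    (c c' : chart R T m) : Prop :=
  smooth_on (overlap c c') (c' \o chart_inv c) /\
  smooth_on (overlap c' c) (c \o chart_inv c').

(* The atlas need not be maximal.  chart_at selects a chart around each point;
   it only serves to coordinatize tangent spaces (see below). *)
Record manifold (R : realType) (m : nat) := Manifold {
  carrier :> topologicalType;
  carrier_hausdorff : hausdorff_space carrier;
  carrier_second_countable : @second_countable carrier;
  atlas : set (chart R carrier m);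
  chart_at : carrier -> chart R carrier m;
  chart_at_atlas : forall p, atlas (chart_at p);
  chart_at_dom : forall p, chart_dom (chart_at p) p;
  atlas_compatible : forall c c', atlas c -> atlas c' -> compatible c c' }.

Arguments atlas {R m} _.

Definition orientable (R : realType) (m : nat) (M : manifold R m) : Prop :=
  exists A : set (chart R M m),
    [/\ forall c c', A c -> atlas M c' -> compatible c c',
        forall p : M, exists2 c, A c & chart_dom c p
      & forall c c' x, A c -> A c' -> overlap c c' x ->
          0 < \det ('J (c' \o chart_inv c) x)].

(* The tangent space at p is R^m, a tangent vector being given by its components
   in the chart chart_at p.  Consequently
     - a vector field is a function X : M -> 'rV_m,
     - a 1-form is a function eta : M -> 'cV_m, with eta(v) = v *m eta p,
     - a (1,1)-tensor field is a function theta : M -> 'M_m, acting on the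
       tangent vector v at p as v *m theta p,
     - a (0,2)-tensor field is a function g : M -> 'M_m, with
       g(u, v) = u *m g p *m v^T,
   and such a field is smooth when its components in each chart of the atlas
   are smooth. *)
Section Fields.
Variables (R : realType) (m : nat) (M : manifold R m).

Definition vfield := M -> 'rV[R]_m.
Definition form1 := M -> 'cV[R]_m.
Definition tensor11 := M -> 'M[R]_m.
Definition tensor02 := M -> 'M[R]_m.

(* change of basis from the tangent space at p to the components in c, and
   its inverse *)
Definition to_chart (c : chart R M m) (p : M) : 'M[R]_m :=
  'J (c \o chart_inv (chart_at p)) (chart_at p p).
Definition of_chart (c : chart R M m) (p : M) : 'M[R]_m :=
  'J (chart_at p \o chart_inv c) (c p).

Definition smooth_in_charts (V : normedModType R)
    (F : chart R M m -> M -> V) : Prop :=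
  forall c, atlas M c -> smooth_on (chart_cod c) (F c \o chart_inv c).

Definition smooth_fun (f : M -> R) : Prop :=
  smooth_in_charts (fun _ p => f p).
Definition smooth_vfield (X : vfield) : Prop :=
  smooth_in_charts (fun c p => X p *m to_chart c p).
Definition smooth_form1 (eta : form1) : Prop :=
  smooth_in_charts (fun c p => of_chart c p *m eta p).
Definition smooth_tensor11 (theta : tensor11) : Prop :=
  smooth_in_charts (fun c p => of_chart c p *m theta p *m to_chart c p).
Definition smooth_tensor02 (g : tensor02) : Prop :=
  smooth_in_charts (fun c p => of_chart c p *m g p *m (of_chart c p)^T).

Definition ev1 (eta : form1) (p : M) (v : 'rV[R]_m) : R :=
  (v *m eta p) 0 0.
Definition ev11 (theta : tensor11) (p : M) (v : 'rV[R]_m) : 'rV[R]_m :=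
  v *m theta p.
Definition ev02 (g : tensor02) (p : M) (u v : 'rV[R]_m) : R :=
  (u *m g p *m v^T) 0 0.

(* the function X(f) *)
Definition dirder (X : vfield) (f : M -> R) (p : M) : R :=
  'd (f \o chart_inv (chart_at p)) (chart_at p p) (X p).

Definition apply11 (theta : tensor11) (X : vfield) : vfield :=
  fun p => ev11 theta p (X p).

Definition riemannian_metric (g : tensor02) : Prop :=
  [/\ smooth_tensor02 g,
      forall p u v, ev02 g p u v = ev02 g p v u
    & forall p u, u != 0 -> 0 < ev02 g p u u].

(* D X Y is the covariant derivative of Y along X; only its values on smooth
   vector fields matter.  There is no condition on the torsion. *)
Definition affine_connection (D : vfield -> vfield -> vfield) : Prop :=
  [/\ forall X Y, smooth_vfield X -> smooth_vfield Y -> smooth_vfield (D X Y),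
      forall f X X' Y, smooth_fun f -> smooth_vfield X -> smooth_vfield X' ->
        smooth_vfield Y -> forall p,
        D (fun q => f q *: X q + X' q) Y p = f p *: D X Y p + D X' Y p,
      forall X Y Y', smooth_vfield X -> smooth_vfield Y -> smooth_vfield Y' ->
        forall p, D X (fun q => Y q + Y' q) p = D X Y p + D X Y' p
    & forall f X Y, smooth_fun f -> smooth_vfield X -> smooth_vfield Y ->
        forall p, D X (fun q => f q *: Y q) p =
                  dirder X f p *: Y p + f p *: D X Y p].

Definition dual_connections (g : tensor02) (D Ds : vfield -> vfield -> vfield)
    : Prop :=
  forall X Y Z, smooth_vfield X -> smooth_vfield Y -> smooth_vfield Z ->
  forall p, dirder Z (fun q => ev02 g q (X q) (Y q)) p =
            ev02 g p (D Z X p) (Y p) + ev02 g p (X p) (Ds Z Y p).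

Definition self_dual (g : tensor02) (D : vfield -> vfield -> vfield) : Prop :=
  dual_connections g D D.

Definition gauge_equation (D Ds : vfield -> vfield -> vfield)
    (theta : tensor11) : Prop :=
  forall X Y, smooth_vfield X -> smooth_vfield Y ->
  forall p, Ds X (apply11 theta Y) p = ev11 theta p (D X Y p).

Definition skew_gauge_solution_of_rank (r : nat) : Prop :=
  exists (g : tensor02) (D : vfield -> vfield -> vfield) (theta : tensor11),
    [/\ riemannian_metric g, affine_connection D & self_dual g D] /\
    [/\ smooth_tensor11 theta,
        forall p, \rank (theta p) = r,
        forall p u v, ev02 g p (ev11 theta p u) v = - ev02 g p u (ev11 theta p v)
      & gauge_equation D D theta].

Definition almost_contact_metric (theta : tensor11) (xi : vfield) (eta : form1)
    (g : tensor02) : Prop :=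
  [/\ smooth_tensor11 theta, smooth_vfield xi, smooth_form1 eta
    & riemannian_metric g] /\
  [/\ forall p, ev1 eta p (xi p) = 1,
      forall p v, ev11 theta p (ev11 theta p v) = - v + ev1 eta p v *: xi p
    & forall p u v, ev02 g p (ev11 theta p u) (ev11 theta p v) =
                    ev02 g p u v - ev1 eta p u * ev1 eta p v].

Definition has_almost_contact_metric : Prop :=
  exists theta xi eta g, almost_contact_metric theta xi eta g.

Definition almost_hermitian (J : tensor11) (h : tensor02) : Prop :=
  [/\ smooth_tensor11 J, riemannian_metric h,
      forall p v, ev11 J p (ev11 J p v) = - v
    & forall p u v, ev02 h p (ev11 J p u) (ev11 J p v) = ev02 h p u v].

Definition has_almost_hermitian : Prop :=
  exists J h, almost_hermitian J h.

End Fields.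

Section SmoothTheory.
Variable R : realType.

Lemma near_differentiable (V W : normedModType R) (f g : V -> W) (x : V) :
  (\near x, f x = g x) -> differentiable f x -> differentiable g x.
Proof.
move=> fg df; have gE : g \o shift x = cst (g x) + 'd f x +o_ 0 id.
  apply/eqaddoP => e e0.
  have /eqaddoP/(_ e e0) := diff_locally df.
  have fg0 : \forall y \near (0 : V), f (y + x) = g (y + x).
    have sx : shift x y @[y --> (0 : V)] --> x.
      by rewrite -[X in _ --> X]add0r; apply: cvgD; [exact: cvg_id|exact: cvg_cst].
    exact: sx fg.
  apply: filterS2 fg0 => y fgy.
  by rewrite !fctE /= fgy (nbhs_singleton fg).
have gc : continuous ('d f x) by exact: diff_continuous.
apply/diff_locallyP; split; last by rewrite (diff_unique gc gE).
by rewrite (diff_unique gc gE).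
Qed.

Lemma Ck_on_eq (m : nat) (V : normedModType R) k (U : set 'rV[R]_m)
    (f g : 'rV[R]_m -> V) :
  open U -> (forall x, U x -> f x = g x) -> Ck_on k U f -> Ck_on k U g.
Proof.
move=> Uo; elim: k f g => [|k IH] f g fg /=.
  move=> cf x Ux; have Unbhs : \near x, f x = g x.
    by apply: filterS (open_nbhs_nbhs (conj Uo Ux)).
  rewrite /prop_for /continuous_at -fg//.
  by apply: cvg_trans (cf x Ux); apply: (@near_eq_cvg _ _ (nbhs x)).
move=> [df Df]; have Unbhs x : U x -> \near x, f x = g x.
  by move=> Ux; apply: filterS (open_nbhs_nbhs (conj Uo Ux)).
split=> [x Ux|v]; first exact: near_differentiable (Unbhs x Ux) (df x Ux).
apply: (IH (fun x => 'D_v f x)) => // x Ux.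
exact/near_eq_derive/Unbhs.
Qed.

Lemma Ck_on_cst (m : nat) (V : normedModType R) k (U : set 'rV[R]_m) (a : V) :
  Ck_on k U (fun=> a).
Proof.
elim: k a => [|k IH] a /=; first by move=> x _; exact: cst_continuous.
split=> [x _|v]; first exact: differentiable_cst.
have -> : (fun x => 'D_v (fun=> a) x) = (fun=> 0 : V).
  by apply/funext => x; rewrite derive_cst.
exact: IH.
Qed.

Lemma Ck_on_add (m : nat) (V : normedModType R) k (U : set 'rV[R]_m)
    (f g : 'rV[R]_m -> V) :
  open U -> Ck_on k U f -> Ck_on k U g -> Ck_on k U (fun x => f x + g x).
Proof.
move=> Uo; elim: k f g => [|k IH] f g /=.
  by move=> cf cg x Ux; apply: continuousD; [exact: cf|exact: cg].
move=> [df Df] [dg Dg]; split=> [x Ux|v].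
  by apply: differentiableD; [exact: df|exact: dg].
apply: (Ck_on_eq Uo) (IH _ _ (Df v) (Dg v)) => x Ux.
by rewrite [RHS]deriveD//; apply: diff_derivable; [exact: df|exact: dg].
Qed.

Lemma Ck_on_compl (m : nat) (V W : normedModType R) k (U : set 'rV[R]_m)
    (f : 'rV[R]_m -> V) (L : {linear V -> W}) :
  open U -> continuous L -> Ck_on k U f -> Ck_on k U (L \o f).
Proof.
move=> Uo Lc; elim: k f => [|k IH] f /=.
  by move=> cf x Ux; apply: continuous_comp; [exact: cf|exact: Lc].
move=> [df Df].
have dLf x : U x -> differentiable (L \o f) x.
  move=> Ux; apply: differentiable_comp; first exact: df.
  exact: linear_differentiable.
split=> // v; apply: (Ck_on_eq Uo) (IH _ (Df v)) => x Ux.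
have dL y : differentiable L y by exact: linear_differentiable.
rewrite [RHS](deriveE _ (dLf x Ux)) (diff_comp (df x Ux) (dL _)) /=.
by rewrite (diff_lin _ Lc) (deriveE _ (df x Ux)).
Qed.

Lemma Ck_on_compr (m n : nat) (V : normedModType R) k (U : set 'rV[R]_n)
    (f : 'rV[R]_n -> V) (L : {linear 'rV[R]_m -> 'rV[R]_n}) :
  open U -> continuous L -> Ck_on k U f -> Ck_on k (L @^-1` U) (f \o L).
Proof.
move=> Uo Lc; have LUo : open (L @^-1` U) by apply: open_comp => // x _.
elim: k f => [|k IH] f /=.
  by move=> cf x Ux; apply: continuous_comp; [exact: Lc|exact: cf].
move=> [df Df].
have dL y : differentiable L y by exact: linear_differentiable.
have dfL x : U (L x) -> differentiable (f \o L) x.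
  by move=> Ux; apply: differentiable_comp; [exact: dL|exact: df].
split=> [x Ux|v]; first exact: dfL.
apply: (Ck_on_eq LUo) (IH _ (Df (L v))) => x Ux.
rewrite [RHS](deriveE _ (dfL x Ux)) (diff_comp (dL x) (df _ Ux)) /=.
by rewrite (diff_lin _ Lc) (deriveE _ (df _ Ux)).
Qed.

Lemma Ck_on_linear (m : nat) (V : normedModType R) k (U : set 'rV[R]_m)
    (L : {linear 'rV[R]_m -> V}) :
  open U -> continuous L -> Ck_on k U L.
Proof.
move=> Uo Lc; case: k => [|k] /=; first by move=> x _; exact: Lc.
split=> [x _|v]; first exact: linear_differentiable.
apply: (Ck_on_eq Uo) (Ck_on_cst k U (L v)) => x _.
by rewrite deriveE ?(diff_lin _ Lc)//; exact: linear_differentiable.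
Qed.

End SmoothTheory.

Section Cylinder.
Variables (R : realType) (m : nat).

Definition inl_mx (a : 'rV[R]_m) : 'rV[R]_(m + 1) := row_mx a 0.
Definition inr_mx (b : 'rV[R]_1) : 'rV[R]_(m + 1) := row_mx 0 b.

Fact inl_mx_linear : linear inl_mx.
Proof. by move=> k a b; rewrite /inl_mx scale_row_mx add_row_mx scaler0 addr0. Qed.
HB.instance Definition _ :=
  GRing.isLinear.Build R 'rV[R]_m 'rV[R]_(m + 1) _ inl_mx inl_mx_linear.

Fact inr_mx_linear : linear inr_mx.
Proof. by move=> k a b; rewrite /inr_mx scale_row_mx add_row_mx scaler0 addr0. Qed.
HB.instance Definition _ :=
  GRing.isLinear.Build R 'rV[R]_1 'rV[R]_(m + 1) _ inr_mx inr_mx_linear.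

Lemma continuous_inl_mx : continuous inl_mx.
Proof.
move=> u A /nbhs_ballP[e /= e0 eA].
apply/nbhs_ballP; exists e => //= v [_ uv]; apply: eA; split => // i j.
rewrite !mxE; case: splitP => k _; last by rewrite !mxE; exact: ballxx.
exact: uv.
Qed.

Lemma continuous_inr_mx : continuous inr_mx.
Proof.
move=> u A /nbhs_ballP[e /= e0 eA].
apply/nbhs_ballP; exists e => //= v [_ uv]; apply: eA; split => // i j.
rewrite !mxE; case: splitP => k _; first by rewrite !mxE; exact: ballxx.
exact: uv.
Qed.

Lemma continuous_scalar_mx1 : continuous (fun t : R => t%:M : 'rV[R]_1).
Proof.
move=> t A /nbhs_ballP[e /= e0 eA].
apply/nbhs_ballP; exists e => //= v tv; apply: eA; split => // i j.
by rewrite !ord1 !mxE.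
Qed.

Lemma row_mx_inE (a : 'rV[R]_m) (b : 'rV[R]_1) :
  row_mx a b = inl_mx a + inr_mx b.
Proof. by rewrite /inl_mx /inr_mx add_row_mx addr0 add0r. Qed.

Lemma prod_hausdorff (T U : topologicalType) :
  hausdorff_space T -> hausdorff_space U -> hausdorff_space (T * U)%type.
Proof.
move=> hT hU [a b] [c d] cl; congr (_, _).
  apply: hT => A B Aa Bc.
  have nA : nbhs (a, b) (fst @^-1` A) by exact: (@cvg_fst _ _ _ (nbhs b)) Aa.
  have nB : nbhs (c, d) (fst @^-1` B) by exact: (@cvg_fst _ _ _ (nbhs d)) Bc.
  by have [[x y] [/= Ax Bx]] := cl _ _ nA nB; exists x.
apply: hU => A B Ab Bd.
have nA : nbhs (a, b) (snd @^-1` A) by exact: (@cvg_snd _ _ (nbhs a)) Ab.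
have nB : nbhs (c, d) (snd @^-1` B) by exact: (@cvg_snd _ _ (nbhs c)) Bd.
by have [[x y] [/= Ay By]] := cl _ _ nA nB; exists y.
Qed.

Lemma prod_second_countable (T U : topologicalType) :
  @second_countable T -> @second_countable U ->
  @second_countable (T * U)%type.
Proof.
move=> [A Ac [Ao Ab]] [B Bc [Bo Bb]].
exists [set P.1 `*` P.2 | P in A `*` B].
  exact/sub_countable/countableX/Bc/Ac/card_image_le.
split=> [_ [[P Q] /= [AP BQ] <-]|[x y] S [[S1 S2] /= [xS1 yS2] S12]].
  rewrite openE => -[x y] [/= Px Qy]; exists (P, Q) => //=.
  by split; apply: open_nbhs_nbhs; split => //; [exact: Ao|exact: Bo].
have [P [AP Px] PS1] := Ab x S1 xS1; have [Q [BQ Qy] QS2] := Bb y S2 yS2.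
exists (P `*` Q); first by split => //; exists (P, Q).
by move=> [x' y'] /= [Px' Qy']; apply: S12; split; [exact: PS1|exact: QS2].
Qed.

Lemma R_second_countable : @second_countable R.
Proof.
exists [set ball (ratr q.1 : R) (ratr q.2) | q in [set: rat * rat]].
  by apply: sub_countable (card_image_le _ _) _; exact: countableP.
split=> [_ [q _ <-]|x A]; first exact: ball_open.
rewrite nbhsE => -[B [Bo /mem_set Bx] BA].
have [c [r [/set_mem xcr rB]]] := open_subball_rat Bo Bx.
exists (ball (ratr c : R) (ratr r)); last exact: subset_trans BA.
by split => //; exists (c, r).
Qed.

Section Chart.
Variables (T : topologicalType) (c : chart R T m).

Let dom : set (T * R) := [set p | chart_dom c p.1].
Let cod : set 'rV[R]_(m + 1) := [set x | chart_cod c (lsubmx x)].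
Let fwd (p : T * R) : 'rV[R]_(m + 1) := row_mx (c p.1) p.2%:M.
Let inv (x : 'rV[R]_(m + 1)) : T * R := (chart_inv c (lsubmx x), rsubmx x 0 0).

Fact cyl_dom_open : open dom.
Proof.
apply: (@open_comp _ _ fst (chart_dom c)); last exact: chart_dom_open.
by move=> p _; exact: cvg_fst.
Qed.

Fact cyl_cod_open : open cod.
Proof.
apply: (@open_comp _ _ (@lsubmx R 1 m 1) (chart_cod c)).
  by move=> x _; exact: continuous_lsubmx.
exact: chart_cod_open.
Qed.

Fact cyl_funP p : dom p -> cod (fwd p).
Proof. by move=> dp; rewrite /cod /fwd /= row_mxKl; exact: chart_funP. Qed.

Fact cyl_invP x : cod x -> dom (inv x).
Proof. exact: chart_invP. Qed.

Fact cyl_funK p : dom p -> inv (fwd p) = p.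
Proof.
by case: p => p t dp; rewrite /inv /fwd /= row_mxKl row_mxKr chart_funK// mxE.
Qed.

Fact cyl_invK x : cod x -> fwd (inv x) = x.
Proof.
move=> cx; rewrite /fwd /inv /= chart_invK// -[RHS]hsubmxK; congr row_mx.
by rewrite [RHS]mx11_scalar.
Qed.

Fact cyl_fun_cont p : dom p -> {for p, continuous fwd}.
Proof.
move=> dp; rewrite (_ : fwd = fun p => inl_mx (c p.1) + inr_mx p.2%:M); last first.
  by apply/funext => q; rewrite -row_mx_inE.
apply: (@continuousD _ 'rV[R]_(m + 1) (T * R)%type).
  apply: (@continuous_comp _ _ _ (fun p : T * R => c p.1) inl_mx).
    apply: (@continuous_comp _ _ _ (@fst T R) c); first exact: cvg_fst.
    exact: chart_fun_cont.
  exact: continuous_inl_mx.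
apply: (@continuous_comp _ _ _ (fun p : T * R => p.2%:M) inr_mx).
  apply: (@continuous_comp _ _ _ (@snd T R) (fun t : R => t%:M : 'rV[R]_1)).
    exact: cvg_snd.
  exact: continuous_scalar_mx1.
exact: continuous_inr_mx.
Qed.

Fact cyl_inv_cont x : cod x -> {for x, continuous inv}.
Proof.
move=> cx.
have c1 : {for x, continuous (fun y => chart_inv c (lsubmx y))}.
  apply: (@continuous_comp _ _ _ (@lsubmx R 1 m 1) (chart_inv c)).
    exact: continuous_lsubmx.
  exact: chart_inv_cont.
have c2 : {for x, continuous (fun y : 'rV[R]_(m + 1) => rsubmx y 0 0)}.
  apply: (@continuous_comp _ _ _ (@rsubmx R 1 m 1) (fun y : 'rV[R]_1 => y 0 0)).
    exact: continuous_rsubmx.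
  exact: coord_continuous.
exact: cvg_pair c1 c2.
Qed.

Definition cyl_chart : chart R (T * R)%type (m + 1) :=
  Chart cyl_dom_open cyl_cod_open cyl_funP cyl_invP cyl_funK cyl_invK
        cyl_fun_cont cyl_inv_cont.

End Chart.

Lemma overlap_open (T : topologicalType) (n : nat) (c c' : chart R T n) :
  open (overlap c c').
Proof.
rewrite openE => x [cx c'x]; apply: filterI.
  by apply: open_nbhs_nbhs; split => //; exact: chart_cod_open.
have : nbhs (chart_inv c x) (chart_dom c').
  by apply: open_nbhs_nbhs; split => //; exact: chart_dom_open.
exact: (chart_inv_cont cx).
Qed.

Lemma cyl_smooth (T : topologicalType) (c c' : chart R T m) :
  smooth_on (overlap c c') (c' \o chart_inv c) ->
  smooth_on (overlap (cyl_chart c) (cyl_chart c'))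
            (cyl_chart c' \o chart_inv (cyl_chart c)).
Proof.
move=> sm k; have -> : cyl_chart c' \o chart_inv (cyl_chart c) =
    (fun x => (inl_mx \o ((c' \o chart_inv c) \o @lsubmx R 1 m 1)) x
              + (inr_mx \o @rsubmx R 1 m 1) x).
  by apply/funext => x /=; rewrite -row_mx_inE -mx11_scalar.
have Uo : open (overlap (cyl_chart c) (cyl_chart c')) by exact: overlap_open.
have Vo : open (overlap c c') by exact: overlap_open.
apply: (Ck_on_add Uo).
  apply: (Ck_on_compl Uo continuous_inl_mx).
  exact: Ck_on_compr Vo (@continuous_lsubmx _ _ _ _) (sm k).
apply: (Ck_on_compl Uo continuous_inr_mx).
exact: Ck_on_linear Uo (@continuous_rsubmx _ _ _ _).
Qed.

Variable M : manifold R m.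

Let cyl_atlas : set (chart R (M * R)%type (m + 1)) :=
  [set cyl_chart c | c in atlas M].
Let cyl_chart_at (p : (M * R)%type) := cyl_chart (chart_at p.1).

Fact cyl_chart_at_atlas p : cyl_atlas (cyl_chart_at p).
Proof. by exists (chart_at p.1) => //; exact: chart_at_atlas. Qed.

Fact cyl_chart_at_dom p : chart_dom (cyl_chart_at p) p.
Proof. exact: chart_at_dom. Qed.

Fact cyl_compatible c c' : cyl_atlas c -> cyl_atlas c' -> compatible c c'.
Proof.
move=> [{}c Ac <-] [{}c' Ac' <-].
by have [cc' c'c] := atlas_compatible Ac Ac'; split; exact: cyl_smooth.
Qed.

(* the product manifold M x R *)
Definition cylinder : manifold R (m + 1) :=
  Manifold (prod_hausdorff (@carrier_hausdorff R m M) (@Rhausdorff R))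
    (prod_second_countable (@carrier_second_countable R m M) R_second_countable)
    cyl_chart_at_atlas cyl_chart_at_dom cyl_compatible.

End Cylinder.

(* Main.v *)
(* Write W for the cylinder over M, of even dimension 2n+2.

   (1) => (2).  A skew solution theta of rank 2n gives the 2-form
   w = g(theta ., .), whose kernel is a line field.  For a unit kernel vector v
   with dual form eta = g(v, .), the form w + eta /\ dt on W is nondegenerate,
   and changing the sign of v reverses the orientation it induces; hence an
   orientation of M selects a smooth unit kernel field v.  The polar
   decomposition of the nondegenerate form w + eta /\ dt with respect to a
   metric is an almost complex structure J on W.
   Along M x {0}, write J = [[a, b], [c, d]] with respect to TM and the vertical
   direction.  Then b and - c / (1 + d^2) are the form and the vector field of an
   almost contact structure on M, with theta = a - d / (1 + d^2) b c; averaging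
   a metric on M makes it an almost contact metric structure.

   (2) => (3).  J = [[theta, eta], [- xi, 0]] is Hermitian for g + dt^2.

   (3) => (4).  Any skew theta with theta^3 = - theta is parallel for the metric
   connection obtained from the Levi-Civita connection D by averaging,
   (P D P - theta D theta) / 2 + Q D Q, where P = - theta^2 and Q = 1 - P.

   (4) => (1).  Polar decomposition turns theta into an almost complex structure
   on W, so that M is almost contact metric as above; its theta satisfies
   theta^3 = - theta and is parallel for an averaged connection. *)
Require Import Defs.
From HB Require Import structures.
From mathcomp Require Import all_boot all_order all_algebra.
From mathcomp Require Import all_classical all_reals all_analysis.
From mathcomp Require Import perm spectral complex.
From mathcomp Require Import ring lra.

Set Implicit Arguments.
Unset Strict Implicit.
Unset Printing Implicit Defensive.
Import Order.TTheory GRing.Theory Num.Theory.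
Import numFieldNormedType.Exports.

Local Open Scope classical_set_scope.
Local Open Scope ring_scope.

(** * Positive definite and skew matrices *)

(** The obstacle throughout is the smoothness of objects given only pointwise. Square roots and
    kernel vectors are picked by choice, and the Levi-Civita derivative at [p] is computed in the
    arbitrarily selected chart at [p]; each is then shown to be smooth from a property that
    determines it. The increments of a square root solve a Sylvester equation whose operator is
    invertible. The polar factor is the only complex structure compatible with both forms, hence
    commutes with changes of coordinates. A unit kernel vector is locally known up to sign. The
    orientation induced by a nondegenerate skew form is read off from the sign of the determinant of
    a congruence with a reference form, in place of a Pfaffian. This sign is well defined and
    locally constant because a congruence between sufficiently close nondegenerate skew forms has
    positive determinant. In (1) => (2), adding the line direction makes the form invertible, so
    that the same polar decomposition serves for (4) => (1). In the latter the metric on W need not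
    be a product, whence the diagonal entry d in the formulas for the contact structure. *)

Lemma mul_row_unit_neq0 (F : fieldType) m (A : 'M[F]_m) (v : 'rV[F]_m) :
  A \in unitmx -> v != 0 -> v *m A != 0.
Proof.
move=> Au; apply: contra_neq => vA.
by rewrite -[v](mulmxK Au) vA mul0mx.
Qed.

Section PosDef.
Variable R : realType.

Definition posdef (m : nat) (A : 'M[R]_m) : Prop :=
  forall v : 'rV[R]_m, v != 0 -> 0 < (v *m A *m v^T) 0 0.

Definition skew (m : nat) (A : 'M[R]_m) : Prop := A^T = - A.

Lemma sqnorm_row_ge0 m (v : 'rV[R]_m) : 0 <= (v *m v^T) 0 0.
Proof. by rewrite mxE sumr_ge0// => i _; rewrite !mxE -expr2 sqr_ge0. Qed.

Lemma posdef1 m : posdef (1%:M : 'M[R]_m).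
Proof.
move=> v v0; rewrite mulmx1 lt_neqAle sqnorm_row_ge0 andbT eq_sym.
apply: contra v0; rewrite mxE psumr_eq0; last first.
  by move=> i _; rewrite !mxE -expr2 sqr_ge0.
move=> /allP v0; apply/eqP/rowP => i; rewrite mxE; apply/eqP.
by have := v0 i; rewrite mem_index_enum !mxE mulf_eq0 orbb => /(_ isT).
Qed.

Lemma posdef_unit m (A : 'M[R]_m) : posdef A -> A \in unitmx.
Proof.
move=> A0; rewrite -row_free_unit -kermx_eq0; apply/negPn/negP => /rowV0Pn[v].
move=> /sub_kermxP vA v0; have := A0 v v0.
by rewrite vA mul0mx mxE ltxx.
Qed.

Lemma posdef_congr m (A B : 'M[R]_m) :
  B \in unitmx -> posdef A -> posdef (B *m A *m B^T).
Proof.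
move=> Bu A0 v v0; have := A0 (v *m B) (mul_row_unit_neq0 Bu v0).
by rewrite trmx_mul !mulmxA.
Qed.

Lemma posdefD m (A B : 'M[R]_m) : posdef A -> posdef B -> posdef (A + B).
Proof.
move=> A0 B0 v v0; rewrite mulmxDr mulmxDl mxE.
by rewrite addr_gt0 ?A0 ?B0.
Qed.

Lemma posdef_tr m (A : 'M[R]_m) : posdef A -> posdef A^T.
Proof.
move=> A0 v v0; have -> : v *m A^T *m v^T = (v *m A *m v^T)^T.
  by rewrite !trmx_mul trmxK mulmxA.
by rewrite mxE A0.
Qed.

(** A monic polynomial is eventually positive, so a negative value at 0 would force a nonnegative
    root by the intermediate value theorem. *)
Lemma monic_horner0_gt0 (p : {poly R}) : p \is monic ->
  (forall x, 0 <= x -> ~~ root p x) -> 0 < p.[0].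
Proof.
move=> pm pr; rewrite lt_neqAle eq_sym -rootE pr//= leNgt; apply/negP => p0.
have lp : 0 < lead_coef p by rewrite (monicP pm).
have [n Hn] := polyrcf.poly_pinfty_gt_lc lp.
pose b := Num.max 0 n.
have b0 : 0 <= b by rewrite /b le_max lexx.
have := @poly_ivt _ p 0 b b0.
rewrite (ltW p0) /= (le_trans (ltW lp)) ?Hn ?/b ?le_max ?lexx ?orbT//.
by move=> /(_ isT)[x /andP[x0 _] /(negP (pr _ x0))].
Qed.

(** The constant coefficient of the characteristic polynomial of [- A] is [\det A], and a
    nonnegative eigenvalue of [- A] would make the quadratic form of [A] nonpositive at an
    eigenvector. The argument is not restricted to symmetric [A], and the matrix to which it is
    applied below is in general not symmetric. *)
Lemma posdef_det_gt0 m (A : 'M[R]_m) : posdef A -> 0 < \det A.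
Proof.
move=> A0; have := @monic_horner0_gt0 (char_poly (- A)) (char_poly_monic _).
rewrite horner_coef0 char_poly_det.
rewrite -[X in \det X]scaleN1r detZ signrMK; apply=> x x0.
rewrite -eigenvalue_root_char; apply/eigenvalueP => -[v vA v0].
have := A0 v v0; rewrite -[A]opprK mulmxN vA mulNmx mxE -scalemxAl mxE.
by rewrite oppr_gt0 ltNge mulr_ge0// sqnorm_row_ge0.
Qed.

End PosDef.

(** * Matrices commuting with the standard complex structure *)

Section Commutant.
Variable R : realType.

Definition stdJ n : 'M[R]_(n + n) := block_mx 0 1%:M (- 1%:M) 0.

Lemma stdJ_sqr n : stdJ n *m stdJ n = - 1%:M.
Proof.
rewrite /stdJ mulmx_block !mul0mx !mulmx0 !mul1mx ?mulNmx ?mulmxN ?mul1mx.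
by rewrite !add0r !addr0 (scalar_mx_block n n 1) opp_block_mx !oppr0.
Qed.

Lemma stdJ_tr n : (stdJ n)^T = - stdJ n.
Proof.
by rewrite /stdJ tr_block_mx opp_block_mx !trmx0 linearN /= trmx1 !oppr0 opprK.
Qed.

(* Over the complex numbers [X] is similar to diag(A + iB, A - iB), so that its
   determinant is a squared modulus. *)
Lemma commute_stdJ_det_ge0 n (X : 'M[R]_(n + n)) :
  X *m stdJ n = stdJ n *m X -> 0 <= \det X.
Proof.
rewrite -[X]submxK /stdJ; set A := ulsubmx X; set B := ursubmx X.
set C := dlsubmx X; set D := drsubmx X.
rewrite !mulmx_block !mul0mx !mulmx0 !mul1mx ?mulNmx ?mulmxN ?mulmx1 ?mul1mx.
rewrite !add0r !addr0 => /eq_block_mx[CB DA _ _].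
rewrite -DA -{}CB {C D DA} -(@ler0c R) -[X in 0 <= X](det_map_mx (real_complex R)).
rewrite map_block_mx map_mxN; set f : 'M[R]_n -> 'M[R[i]%C]_n := map_mx _.
set L := block_mx 1%:M 'i%C%:M 0 1%:M : 'M[R[i]%C]_(n + n).
set U := block_mx 1%:M (- 'i%C%:M) 0 1%:M : 'M[R[i]%C]_(n + n).
have E : L *m block_mx (f A) (f B) (- f B) (f A) *m U
    = block_mx (f A - 'i%C *: f B) 0
               (- f B) (f A + 'i%C *: f B).
  rewrite /L /U !mulmx_block !mul0mx !mul1mx !mulmx1 !mulmx0 !add0r !addr0.
  rewrite !mulmxN !mul_scalar_mx !mul_mx_scalar.
  by congr block_mx; apply/matrixP=> i j; rewrite !mxE; ring: (@sqr_i R).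
have dL : \det L = 1 by rewrite det_ublock !det1 mulr1.
have dU : \det U = 1 by rewrite det_ublock !det1 mulr1.
have := congr1 (fun X => \det X) E; rewrite !det_mulmx dL dU mul1r mulr1 => ->.
rewrite det_lblock mulrC.
have -> : f A - 'i%C *: f B
    = map_mx (@conjc R) (f A + 'i%C *: f B).
  apply/matrixP => i j; rewrite !mxE rmorphD rmorphM /= /real_complex_def.
  by simpc.
by rewrite det_map_mx; exact: mulcJ_ge0.
Qed.

End Commutant.

(** * Symplectic bases *)

Section Darboux.
Variable R : realType.

Lemma skew_row0 m (w : 'M[R]_m) (v : 'rV[R]_m) :
  skew w -> v *m w *m v^T = 0.
Proof.
move=> ws; have : (v *m w *m v^T)^T = - (v *m w *m v^T).
  by rewrite !trmx_mul trmxK ws mulNmx mulmxN mulmxA.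
move=> E; apply/matrixP => i j; rewrite !ord1 [RHS]mxE.
have /matrixP/(_ 0 0) := E; rewrite mxE [RHS]mxE => /eqP.
by rewrite -subr_eq0 opprK -mulr2n mulrn_eq0 => /eqP.
Qed.

Lemma skew_swap m k l (w : 'M[R]_m) (A : 'M[R]_(k, m)) (B : 'M[R]_(l, m)) :
  skew w -> A *m w *m B^T = - (B *m w *m A^T)^T.
Proof. by move=> ws; rewrite !trmx_mul trmxK ws mulNmx mulmxN opprK mulmxA. Qed.

(** Symplectic Gram-Schmidt: one hyperbolic pair [u], [v] is added at a time, in the [w]-orthogonal
    complement of the pairs already found. The rows of [B] list all first vectors and then all
    second vectors, which is why [B] is split in halves before the new pair is inserted. *)
Lemma symplectic_family m (w : 'M[R]_m) k :
  skew w -> w \in unitmx -> (k + k <= m)%N ->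
  exists B : 'M[R]_(k + k, m), B *m w *m B^T = stdJ R k.
Proof.
move=> ws wu; elim: k => [|k IH] km.
  by exists 0; apply/matrixP => -[[]].
have km' : (k + k < m)%N by rewrite (leq_trans _ km)// addSn addnS.
have [B BE] := IH (ltnW km').
(* Orthogonality to the rows of [B] amounts to [k + k] linear conditions on a space of larger
   dimension. *)
have /rowV0Pn[u /sub_kermxP uB u0] : kermx (w *m B^T) != 0.
  rewrite kermx_eq0 /row_free neq_ltn; apply/orP; left.
  exact: leq_ltn_trans (rank_leq_col _) km'.
rewrite mulmxA in uB.
pose z := u *m w; have z0 : z != 0 by exact: mul_row_unit_neq0.
have zz : (z *m z^T) 0 0 != 0.
  by have := @posdef1 R m z z0; rewrite mulmx1 lt0r => /andP[].
(* The pairing of [u] with [z = u *m w] is the squared norm of [z], so this rescaling makes it 1. *)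
pose y := ((z *m z^T) 0 0)^-1 *: z.
have zy : u *m w *m y^T = 1%:M.
  rewrite /y linearZ /= -scalemxAr -/z [X in _ *: X]mx11_scalar.
  by rewrite scale_scalar_mx mulVf.
(* Since [stdJ] squares to -1, [c *m B] pairs with [B] to [- (y *m w *m B^T)] and cancels the
   component of [y] along the earlier pairs. *)
pose c := y *m w *m B^T *m stdJ R k.
pose v := y + c *m B.
have vB : v *m w *m B^T = 0.
  rewrite /v !mulmxDl -[c *m B *m w]mulmxA -(mulmxA c) BE.
  by rewrite /c -(mulmxA _ (stdJ R k)) stdJ_sqr mulmxN mulmx1 subrr.
have uv : u *m w *m v^T = 1%:M.
  by rewrite /v linearD /= trmx_mul mulmxDr zy mulmxA uB mul0mx addr0.
have vu : v *m w *m u^T = - 1%:M by rewrite (skew_swap _ _ ws) uv trmx1.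
have Bu : B *m w *m u^T = 0 by rewrite (skew_swap _ _ ws) uB trmx0 oppr0.
have Bv : B *m w *m v^T = 0 by rewrite (skew_swap _ _ ws) vB trmx0 oppr0.
have uu := skew_row0 u ws; have vv := skew_row0 v ws.
move: BE uB vB Bu Bv; rewrite -[B]vsubmxK; set P := usubmx B; set Q := dsubmx B.
rewrite tr_col_mx mul_col_mx mul_col_row.
move=> /eq_block_mx[PP PQ QP QQ].
rewrite !mul_mx_row -!row_mx0 => /eq_row_mx[uP uQ] /eq_row_mx[vP vQ].
rewrite !mul_col_mx -!col_mx0 => /eq_col_mx[Pu Qu] /eq_col_mx[Pv Qv].
pose P' : 'M[R]_(1 + k, m) := col_mx u P.
pose Q' : 'M[R]_(1 + k, m) := col_mx v Q.
have P'P' : P' *m w *m P'^T = 0.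
  by rewrite /P' tr_col_mx !(mul_col_mx, mul_mx_row) uu uP Pu PP !(row_mx0, col_mx0).
have Q'Q' : Q' *m w *m Q'^T = 0.
  by rewrite /Q' tr_col_mx !(mul_col_mx, mul_mx_row) vv vQ Qv QQ !(row_mx0, col_mx0).
have P'Q' : P' *m w *m Q'^T = 1%:M.
  rewrite /P' /Q' tr_col_mx !(mul_col_mx, mul_mx_row) uv uQ Pv PQ.
  by rewrite [RHS](scalar_mx_block 1 k) block_mxEh.
have Q'P' : Q' *m w *m P'^T = - 1%:M by rewrite (skew_swap _ _ ws) P'Q' trmx1.
exists (col_mx P' Q' : 'M[R]_((1 + k) + (1 + k), m)).
by rewrite tr_col_mx mul_col_mx mul_col_row P'P' P'Q' Q'P' Q'Q'.
Qed.

End Darboux.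

(** * Sign of the determinant of a congruence *)

Section CongruenceSign.
Variable R : realType.

Lemma skew_congr m (w B : 'M[R]_m) : skew w -> skew (B *m w *m B^T).
Proof. by move=> ws; rewrite /skew !trmx_mul trmxK ws mulNmx mulmxN mulmxA. Qed.

(** Both forms have a full symplectic basis, and the congruence is the change of basis. The parity
    of the dimension enters through an equation because the intended size, [m + 1] on the cylinder,
    is not literally of the form [n + n]. *)
Lemma skew_congruent n m (w w' : 'M[R]_m) : m = (n + n)%N ->
  skew w -> w \in unitmx -> skew w' -> w' \in unitmx ->
  exists2 B : 'M[R]_m, B \in unitmx & w' = B *m w *m B^T.
Proof.
move=> mn; subst m => ws wu ws' wu'.
have Ju : stdJ R n \in unitmx.
  suff /mulmx1_unit[] : stdJ R n *m - stdJ R n = 1%:M by [].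
  by rewrite mulmxN stdJ_sqr opprK.
have [B BE] := symplectic_family ws wu (leqnn _).
have [B' BE'] := symplectic_family ws' wu' (leqnn _).
have unitB C z : C *m z *m C^T = stdJ R n -> C \in unitmx.
  by move=> CE; move: Ju; rewrite -CE -mulmxA unitmx_mul => /andP[].
have Bu := unitB _ _ BE; have Bu' := unitB _ _ BE'.
exists (invmx B' *m B); first by rewrite unitmx_mul unitmx_inv Bu' Bu.
rewrite trmx_mul -!mulmxA [B *m _]mulmxA [B *m w *m _]mulmxA BE -BE' trmx_inv.
by rewrite -!mulmxA mulmxV ?unitmx_tr// mulmx1 mulmxA mulVmx// mul1mx.
Qed.

(* Following Rim's proof that symplectic matrices have determinant one:
   [X + J X J^T] commutes with [J] and equals [(X X^T + Y^T) X^-T]. *)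
Lemma stdJ_congr_det_gt0 n (X : 'M[R]_(n + n)) : X \in unitmx ->
  posdef (X *m stdJ R n *m X^T *m (stdJ R n)^T) -> 0 < \det X.
Proof.
set J := stdJ R n; set Y := _ *m J^T => Xu Y0.
have JJ : J *m J = - 1%:M by exact: stdJ_sqr.
have JT : J^T = - J by exact: stdJ_tr.
have E : X + J *m X *m J^T = (X *m X^T + Y^T) *m (invmx X)^T.
  have -> : Y^T = J *m X *m J^T *m X^T by rewrite /Y !trmx_mul !trmxK !mulmxA.
  by rewrite mulmxDl trmx_inv !mulmxK ?unitmx_tr.
have c : (X + J *m X *m J^T) *m J = J *m (X + J *m X *m J^T).
  rewrite JT !mulmxN mulmxBl mulmxBr -mulmxA JJ !mulmxA JJ.
  by rewrite mulmxN mulmx1 !mulNmx mul1mx !opprK addrC.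
have XX : posdef (X *m X^T).
  by have := posdef_congr Xu (@posdef1 R _); rewrite mulmx1.
have d0 := posdef_det_gt0 (posdefD XX (posdef_tr Y0)).
have := commute_stdJ_det_ge0 c; rewrite E det_mulmx det_tr det_inv.
by rewrite pmulr_rge0// invr_ge0 le0r -[_ == 0]negbK -unitfE -unitmxE Xu.
Qed.

(** The bound 2ab <= a^2 + b^2 on each product of coordinates, summed over both indices. Balls of
    matrices are entrywise, so this is what turns closeness of matrices into closeness of quadratic
    forms. *)
Lemma quad_form_bound m (A : 'M[R]_m) (e : R) (v : 'rV[R]_m) :
  (forall i j, `|A i j| <= e) ->
  `|(v *m A *m v^T) 0 0| <= e * m%:R * (v *m v^T) 0 0.
Proof.
move=> Ae; rewrite -mulmxA mxE (le_trans (ler_norm_sum _ _ _))//.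
pose S i := `|v 0 i|.
apply: (@le_trans _ _ (\sum_i \sum_j e * (S i ^+ 2 + S j ^+ 2) / 2)).
  apply: ler_sum => i _; rewrite normrM mxE.
  apply: (@le_trans _ _ (S i * \sum_j (e * S j))).
    rewrite ler_wpM2l ?normr_ge0// (le_trans (ler_norm_sum _ _ _))//.
    by apply: ler_sum => j _; rewrite normrM mxE ler_wpM2r ?normr_ge0.
  rewrite mulr_sumr; apply: ler_sum => j _.
  have e0 : 0 <= e by exact: le_trans (normr_ge0 _) (Ae i j).
  have := mulr_ge0 e0 (sqr_ge0 (S i - S j)).
  move: (S i) (S j) => a b h; rewrite -subr_ge0.
  have -> : e * (a ^+ 2 + b ^+ 2) / 2 - a * (e * b) = e * (a - b) ^+ 2 / 2.
    by field.
  by rewrite divr_ge0.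
have -> : (v *m v^T) 0 0 = \sum_i S i ^+ 2.
  by rewrite mxE; apply: eq_bigr => i _; rewrite mxE /S real_normK ?num_real// expr2.
under eq_bigr => i _ do rewrite -mulr_suml -mulr_sumr big_split /=
  sumr_const card_ord.
rewrite -mulr_suml -mulr_sumr big_split /= sumr_const card_ord.
rewrite sumrMnl -mulr_natr; move: (\sum_i _) => s.
by rewrite le_eqVlt; apply/orP; left; apply/eqP; field.
Qed.

Lemma near_posdef1 m : \forall A \near (1%:M : 'M[R]_m), posdef A.
Proof.
(* With this radius the error is at most m / (m + 1) < 1 times the squared norm; the added 1 covers
   [m = 0]. *)
apply/nbhs_ballP; exists (m%:R + 1)^-1 => /=.
  by rewrite invr_gt0 ltr_wpDl.
move=> A [_ A1] v v0.
have p0 : 0 < (v *m v^T) 0 0 by have := @posdef1 R m v v0; rewrite mulmx1.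
have := @quad_form_bound m (A - 1%:M) (m%:R + 1)^-1 v.
rewrite mulmxBr mulmx1 mulmxBl !mxE => /(_ _)/wrap[].
  by move=> i j; have := A1 i j; rewrite /ball /= distrC !mxE => /ltW.
rewrite ler_norml => /andP[+ _].
have : (m%:R + 1)^-1 * m%:R < 1 :> R.
  by rewrite mulrC ltr_pdivrMr ?mul1r ?ltrDl// ltr_wpDl.
move: p0; rewrite !mxE => p0 h; rewrite -(ltr_pM2r p0) mul1r in h; lra.
Qed.

End CongruenceSign.

(** * Calculus of matrix-valued functions *)

Section MatrixContinuity.
Variable R : realType.

Lemma cvg_mxP (T : Type) (F : set_system T) {FF : Filter F} m n
    (f : T -> 'M[R]_(m, n)) (A : 'M[R]_(m, n)) :
  f x @[x --> F] --> A <-> forall i j, f x i j @[x --> F] --> A i j.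
Proof.
split=> [fA i j|fA].
  exact: (cvg_comp _ (fun B : 'M[R]_(m, n) => B i j) fA (@coord_continuous _ _ _ i j A)).
apply/cvg_ballP => e e0.
have : forall i, \near F, forall j, ball (A i j) e (f F i j).
  by move=> i; apply: filter_forall => j; apply: (cvg_ball (fA i j)).
move=> /filter_forall; apply: filterS => x h.
by split.
Qed.

Lemma cvg_sumr (T : Type) (F : set_system T) {FF : Filter F} (I : finType)
    (f : I -> T -> R) (a : I -> R) :
  (forall i, f i x @[x --> F] --> a i) ->
  \sum_i f i x @[x --> F] --> \sum_i a i.
Proof.
move=> fa; elim: (index_enum I) => [|i s IH].
  rewrite big_nil; under eq_fun do rewrite big_nil; exact: cvg_cst.
by rewrite big_cons; under eq_fun do rewrite big_cons; exact: cvgD.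
Qed.

Lemma cvg_mulmx (T : Type) (F : set_system T) {FF : Filter F} m n p
    (f : T -> 'M[R]_(m, n)) (g : T -> 'M[R]_(n, p))
    (A : 'M[R]_(m, n)) (B : 'M[R]_(n, p)) :
  f x @[x --> F] --> A -> g x @[x --> F] --> B ->
  f x *m g x @[x --> F] --> A *m B.
Proof.
move=> /cvg_mxP fA /cvg_mxP gB; apply/cvg_mxP => i j; rewrite mxE.
under eq_fun do rewrite mxE.
apply: (@cvg_sumr _ _ _ _ (fun k x => f x i k * g x k j)) => k.
by apply: cvgM; [exact: fA|exact: gB].
Qed.

Lemma cvg_trmx (T : Type) (F : set_system T) {FF : Filter F} m n
    (f : T -> 'M[R]_(m, n)) (A : 'M[R]_(m, n)) :
  f x @[x --> F] --> A -> (f x)^T @[x --> F] --> A^T.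
Proof.
move=> /cvg_mxP fA; apply/cvg_mxP => i j; rewrite mxE.
under eq_fun do rewrite mxE.
exact: fA.
Qed.

Lemma cvg_block_mx (T : Type) (F : set_system T) {FF : Filter F} m1 m2 n1 n2
    (a : T -> 'M[R]_(m1, n1)) (b : T -> 'M[R]_(m1, n2))
    (c : T -> 'M[R]_(m2, n1)) (d : T -> 'M[R]_(m2, n2))
    (A : 'M[R]_(m1, n1)) (B : 'M[R]_(m1, n2))
    (C : 'M[R]_(m2, n1)) (D : 'M[R]_(m2, n2)) :
  a x @[x --> F] --> A -> b x @[x --> F] --> B ->
  c x @[x --> F] --> C -> d x @[x --> F] --> D ->
  block_mx (a x) (b x) (c x) (d x) @[x --> F] --> block_mx A B C D.
Proof.
move=> /cvg_mxP aA /cvg_mxP bB /cvg_mxP cC /cvg_mxP dD; apply/cvg_mxP => i j.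
case: (split_ordP i) => i' ->; case: (split_ordP j) => j' ->.
- by rewrite block_mxEul; under eq_fun do [rewrite block_mxEul]; exact: aA.
- by rewrite block_mxEur; under eq_fun do [rewrite block_mxEur]; exact: bB.
- by rewrite block_mxEdl; under eq_fun do [rewrite block_mxEdl]; exact: cC.
- by rewrite block_mxEdr; under eq_fun do [rewrite block_mxEdr]; exact: dD.
Qed.

Lemma cvg_prodr (T : Type) (F : set_system T) {FF : Filter F} (I : finType)
    (f : I -> T -> R) (a : I -> R) :
  (forall i, f i x @[x --> F] --> a i) ->
  \prod_i f i x @[x --> F] --> \prod_i a i.
Proof.
move=> fa; elim: (index_enum I) => [|i s IH].
  rewrite big_nil; under eq_fun do rewrite big_nil; exact: cvg_cst.
by rewrite big_cons; under eq_fun do rewrite big_cons; exact: cvgM.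
Qed.

Lemma cvg_det (T : Type) (F : set_system T) {FF : Filter F} m
    (f : T -> 'M[R]_m) (A : 'M[R]_m) :
  f x @[x --> F] --> A -> \det (f x) @[x --> F] --> \det A.
Proof.
move=> /cvg_mxP fA.
apply: (@cvg_sumr _ _ _ _
  (fun (s : {perm _}) x => (-1) ^+ s * \prod_i f x i (s i))) => s.
apply: cvgM; first exact: cvg_cst.
by apply: (@cvg_prodr _ _ _ _ (fun i x => f x i (s i))).
Qed.

(* On matrix spaces unification unfolds [nbhs] and fails to find its filter
   instance, whence these variants. *)
Section AtPoint.
Variables (T : topologicalType) (x : T).

Lemma continuous_mulmx_at m n p (f : T -> 'M[R]_(m, n)) (g : T -> 'M[R]_(n, p)) :
  {for x, continuous f} -> {for x, continuous g} ->
  {for x, continuous (fun t => f t *m g t)}.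
Proof. exact: cvg_mulmx. Qed.

Lemma continuous_trmx_at m n (f : T -> 'M[R]_(m, n)) :
  {for x, continuous f} -> {for x, continuous (fun t => (f t)^T)}.
Proof. exact: cvg_trmx. Qed.

Lemma continuous_block_at m1 m2 n1 n2
    (a : T -> 'M[R]_(m1, n1)) (b : T -> 'M[R]_(m1, n2))
    (c : T -> 'M[R]_(m2, n1)) (d : T -> 'M[R]_(m2, n2)) :
  {for x, continuous a} -> {for x, continuous b} ->
  {for x, continuous c} -> {for x, continuous d} ->
  {for x, continuous (fun t => block_mx (a t) (b t) (c t) (d t))}.
Proof. exact: cvg_block_mx. Qed.

Lemma continuous_det_at m (f : T -> 'M[R]_m) :
  {for x, continuous f} -> {for x, continuous (fun t => \det (f t))}.
Proof. exact: cvg_det. Qed.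

Lemma continuous_mxtrace_at m (f : T -> 'M[R]_m) :
  {for x, continuous f} -> {for x, continuous (fun t => \tr (f t))}.
Proof. by move=> /cvg_mxP fc; apply: cvg_sumr => i; exact: fc. Qed.

Lemma continuous_mx_at m n (f : T -> 'M[R]_(m, n)) :
  (forall i j, {for x, continuous (fun t => f t i j)}) -> {for x, continuous f}.
Proof. by move=> fc; apply/cvg_mxP => i j; exact: fc. Qed.

Lemma continuous_dist_at (f : T -> R) :
  (forall e, 0 < e -> \forall y \near x, `|f x - f y| < e) ->
  {for x, continuous f}.
Proof. by move=> fc; apply/cvgrPdist_lt. Qed.

Lemma continuous_add_at m n (f g : T -> 'M[R]_(m, n)) :
  {for x, continuous f} -> {for x, continuous g} ->
  {for x, continuous (fun t => f t + g t)}.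
Proof. by move=> fc gc; apply: cvgD; [exact: fc|exact: gc]. Qed.

Lemma continuous_sub_at m n (f g : T -> 'M[R]_(m, n)) :
  {for x, continuous f} -> {for x, continuous g} ->
  {for x, continuous (fun t => f t - g t)}.
Proof. by move=> fc gc; apply: cvgB; [exact: fc|exact: gc]. Qed.

Lemma continuous_cst_at (U : topologicalType) (a : U) :
  {for x, continuous (fun _ : T => a)}.
Proof. exact: cvg_cst. Qed.

End AtPoint.

End MatrixContinuity.

(** * Stability of [Ck_on] under algebraic operations *)

Section CkCalculus.
Variables (R : realType) (m : nat).
Implicit Types U : set 'rV[R]_m.

Lemma Ck_on_subset (V : normedModType R) k U U' (f : 'rV[R]_m -> V) :
  U' `<=` U -> Ck_on k U f -> Ck_on k U' f.
Proof.
move=> UU'; elim: k f => [|k IH] f /=; first by move=> fc x /UU'; exact: fc.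
by move=> [df Df]; split=> [x /UU'|v]; [exact: df|exact: IH].
Qed.

Lemma Ck_onW (V : normedModType R) k U (f : 'rV[R]_m -> V) :
  Ck_on k.+1 U f -> Ck_on k U f.
Proof.
elim: k f => [|k IH] f [df Df].
  by move=> x /df; exact: differentiable_continuous.
by split=> // v; apply: IH; exact: Df.
Qed.

Lemma Ck_on_local (V : normedModType R) k U (f : 'rV[R]_m -> V) :
  (forall x, U x -> exists2 A, A x & Ck_on k A f) -> Ck_on k U f.
Proof.
elim: k f => [|k IH] f H /=; first by move=> x /H[A Ax]; apply.
split=> [x /H[A Ax [df _]]|v]; first exact: df.
by apply: IH => x /H[A Ax [_ Df]]; exists A => //; exact: Df.
Qed.

Lemma Ck_on_sum (V : normedModType R) (I : Type) (r : seq I) k U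
    (f : I -> 'rV[R]_m -> V) :
  open U -> (forall i, Ck_on k U (f i)) ->
  Ck_on k U (fun x => \sum_(i <- r) f i x).
Proof.
move=> Uo Hf; elim: r => [|i r IH].
  apply: (Ck_on_eq Uo) (Ck_on_cst k U 0) => x _; by rewrite big_nil.
by apply: (Ck_on_eq Uo) (Ck_on_add Uo (Hf i) IH) => x _; rewrite big_cons.
Qed.

Lemma Ck_on_scalel (V : normedModType R) k U (f : 'rV[R]_m -> R) (a : V) :
  open U -> Ck_on k U f -> Ck_on k U (fun x => f x *: a).
Proof.
move=> Uo Hf.
have lin : linear (fun c : R => c *: a).
  by move=> c x y; rewrite scalerDl scalerA.
pose L : {linear R -> V} := HB.pack (fun c : R => c *: a)
  (GRing.isLinear.Build _ _ _ _ _ lin).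
exact: (Ck_on_compl (L := L) Uo (@scalel_continuous _ _ a) Hf).
Qed.

Lemma Ck_on_coord n p k U (f : 'rV[R]_m -> 'M[R]_(n, p)) i j :
  open U -> Ck_on k U f -> Ck_on k U (fun x => f x i j).
Proof.
move=> Uo Hf.
have lin : linear (fun A : 'M[R]_(n, p) => A i j) by move=> c A B; rewrite !mxE.
pose L : {linear 'M[R]_(n, p) -> R} := HB.pack (fun A : 'M[R]_(n, p) => A i j)
  (GRing.isLinear.Build _ _ _ _ _ lin).
exact: (Ck_on_compl (L := L) Uo (@coord_continuous _ _ _ i j) Hf).
Qed.

Lemma Ck_on_mx n p k U (f : 'rV[R]_m -> 'M[R]_(n, p)) :
  open U -> (forall i j, Ck_on k U (fun x => f x i j)) -> Ck_on k U f.
Proof.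
move=> Uo Hf.
apply: (Ck_on_eq Uo (f := fun x => \sum_i \sum_j f x i j *: delta_mx i j)).
  by move=> x _; rewrite [RHS]matrix_sum_delta.
by do 2!apply: Ck_on_sum => // ?; exact: Ck_on_scalel.
Qed.

Lemma Ck_onM k U (f g : 'rV[R]_m -> R) :
  open U -> Ck_on k U f -> Ck_on k U g -> Ck_on k U (fun x => f x * g x).
Proof.
move=> Uo; elim: k f g => [|k IH] f g.
  by move=> cf cg x Ux; apply: continuousM; [exact: cf|exact: cg].
move=> Hf Hg; have [df Df] := Hf; have [dg Dg] := Hg; split=> [x Ux|v].
  by apply: differentiableM; [exact: df|exact: dg].
apply: (Ck_on_eq Uo) (Ck_on_add Uo (IH _ _ (Ck_onW Hf) (Dg v))
                                   (IH _ _ (Ck_onW Hg) (Df v))) => x Ux.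
by rewrite [RHS]deriveM//; apply: diff_derivable; [exact: df|exact: dg].
Qed.

Lemma Ck_on_prod (I : Type) (r : seq I) k U (f : I -> 'rV[R]_m -> R) :
  open U -> (forall i, Ck_on k U (f i)) ->
  Ck_on k U (fun x => \prod_(i <- r) f i x).
Proof.
move=> Uo Hf; elim: r => [|i r IH].
  apply: (Ck_on_eq Uo) (Ck_on_cst k U (1 : R)) => x _; by rewrite big_nil.
by apply: (Ck_on_eq Uo) (Ck_onM Uo (Hf i) IH) => x _; rewrite big_cons.
Qed.

Lemma Ck_onN (V : normedModType R) k U (f : 'rV[R]_m -> V) :
  open U -> Ck_on k U f -> Ck_on k U (fun x => - f x).
Proof.
move=> Uo; elim: k f => [|k IH] f.
  by move=> cf x Ux; apply: continuousN; exact: cf.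
move=> [df Df]; split=> [x Ux|v]; first by apply: differentiableN; exact: df.
apply: (Ck_on_eq Uo) (IH _ (Df v)) => x Ux.
by rewrite [RHS]deriveN//; apply: diff_derivable; exact: df.
Qed.

Lemma Ck_onV k U (f : 'rV[R]_m -> R) : open U -> (forall x, U x -> f x != 0) ->
  Ck_on k U f -> Ck_on k U (fun x => (f x)^-1).
Proof.
move=> Uo f0; elim: k => [|k IH].
  by move=> cf x Ux; have := cvgV (f0 x Ux) (cf x Ux); apply.
move=> Hf; have [df Df] := Hf; split=> [x Ux|v].
  by apply: differentiableV; [exact: df|exact: f0].
have Hi := IH (Ck_onW Hf).
apply: (Ck_on_eq Uo (f := fun x => - ((f x)^-1 * (f x)^-1 * 'D_v f x))); last first.
  exact: (Ck_onN Uo (Ck_onM Uo (Ck_onM Uo Hi Hi) (Df v))).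
move=> x Ux.
rewrite [RHS]deriveV ?f0//; last exact/diff_derivable/df.
by rewrite -exprVn expr2 scaleNr.
Qed.

Lemma Ck_on_scale n p k U (f : 'rV[R]_m -> R) (F : 'rV[R]_m -> 'M[R]_(n, p)) :
  open U -> Ck_on k U f -> Ck_on k U F -> Ck_on k U (fun x => f x *: F x).
Proof.
move=> Uo Hf HF; apply: Ck_on_mx => // i j.
apply: (Ck_on_eq Uo) (Ck_onM Uo Hf (Ck_on_coord i j Uo HF)) => x _.
by rewrite mxE.
Qed.

Lemma Ck_on_mulmx n p q k U (F : 'rV[R]_m -> 'M[R]_(n, p))
    (G : 'rV[R]_m -> 'M[R]_(p, q)) :
  open U -> Ck_on k U F -> Ck_on k U G -> Ck_on k U (fun x => F x *m G x).
Proof.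
move=> Uo HF HG; apply: Ck_on_mx => // i j.
apply: (Ck_on_eq Uo (f := fun x => \sum_l F x i l * G x l j)).
  by move=> x _; rewrite mxE.
apply: Ck_on_sum => // l.
by apply: Ck_onM => //; exact: Ck_on_coord.
Qed.

Lemma Ck_on_trmx n p k U (F : 'rV[R]_m -> 'M[R]_(n, p)) :
  open U -> Ck_on k U F -> Ck_on k U (fun x => (F x)^T).
Proof.
move=> Uo HF; apply: Ck_on_mx => // i j.
by apply: (Ck_on_eq Uo) (Ck_on_coord j i Uo HF) => x _; rewrite mxE.
Qed.

Lemma Ck_on_det n k U (F : 'rV[R]_m -> 'M[R]_n) :
  open U -> Ck_on k U F -> Ck_on k U (fun x => \det (F x)).
Proof.
move=> Uo HF; apply: Ck_on_sum => // s.
apply: Ck_onM => //; first exact: Ck_on_cst.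
by apply: Ck_on_prod => // i; exact: Ck_on_coord.
Qed.

(** Cramer's formula reduces inversion to determinants, products and one scalar inverse. *)
Lemma Ck_on_invmx n k U (F : 'rV[R]_m -> 'M[R]_n) :
  open U -> (forall x, U x -> F x \in unitmx) -> Ck_on k U F ->
  Ck_on k U (fun x => invmx (F x)).
Proof.
move=> Uo Fu HF.
apply: (Ck_on_eq Uo (f := fun x => (\det (F x))^-1 *: \adj (F x))).
  by move=> x Ux; rewrite /invmx Fu.
apply: Ck_on_scale => //.
  apply: Ck_onV => //; last exact: Ck_on_det.
  by move=> x /Fu; rewrite unitmxE unitfE.
apply: Ck_on_mx => // i j.
apply: (Ck_on_eq Uo (f := fun x => (-1) ^+ (j + i) * \det (row' j (col' i (F x))))).
  by move=> x _; rewrite mxE.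
apply: Ck_onM => //; first exact: Ck_on_cst.
apply: Ck_on_det => //; apply: Ck_on_mx => // a b.
by apply: (Ck_on_eq Uo) (Ck_on_coord (lift j a) (lift i b) Uo HF) => x _; rewrite !mxE.
Qed.

Lemma Ck_on_block n1 n2 p1 p2 k U
    (A : 'rV[R]_m -> 'M[R]_(n1, p1)) (B : 'rV[R]_m -> 'M[R]_(n1, p2))
    (C : 'rV[R]_m -> 'M[R]_(n2, p1)) (D : 'rV[R]_m -> 'M[R]_(n2, p2)) :
  open U -> Ck_on k U A -> Ck_on k U B -> Ck_on k U C -> Ck_on k U D ->
  Ck_on k U (fun x => block_mx (A x) (B x) (C x) (D x)).
Proof.
move=> Uo HA HB HC HD; apply: Ck_on_mx => // i j.
case: (split_ordP i) => i' ->; case: (split_ordP j) => j' ->.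
- by apply: (Ck_on_eq Uo) (Ck_on_coord i' j' Uo HA) => x _; rewrite block_mxEul.
- by apply: (Ck_on_eq Uo) (Ck_on_coord i' j' Uo HB) => x _; rewrite block_mxEur.
- by apply: (Ck_on_eq Uo) (Ck_on_coord i' j' Uo HC) => x _; rewrite block_mxEdl.
- by apply: (Ck_on_eq Uo) (Ck_on_coord i' j' Uo HD) => x _; rewrite block_mxEdr.
Qed.

(* [Ck_on] only controls derivatives along constant directions. *)
Lemma Ck_on_derive n p k U (v : 'rV[R]_m -> 'rV[R]_m)
    (F : 'rV[R]_m -> 'M[R]_(n, p)) :
  open U -> Ck_on k U v -> Ck_on k.+1 U F -> Ck_on k U (fun x => 'D_(v x) F x).
Proof.
move=> Uo Hv [dF DF].
apply: (Ck_on_eq Uo (f := fun x => \sum_i v x 0 i *: 'D_(delta_mx 0 i) F x)).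
  move=> x Ux; rewrite (deriveE _ (dF x Ux)).
  rewrite [in RHS](row_sum_delta (v x)) linear_sum.
  by apply: eq_bigr => i _; rewrite linearZ (deriveE _ (dF x Ux)).
apply: Ck_on_sum => // i; apply: Ck_on_scale => //; [exact: Ck_on_coord|exact: DF].
Qed.

End CkCalculus.

(** * Orientation class of a nondegenerate skew form *)

Section CongruenceSignNear.
Variable R : realType.

(** A change of basis brings [w] to [stdJ]. For [w' = w] the matrix whose positivity is tested by
    [stdJ_congr_det_gt0] is then the identity; it depends continuously on [w'], so positivity
    persists nearby. The neighbourhood is the same for all [C], since the tested matrix depends on
    [C] through [w'] only. *)
Lemma near_congr_det_gt0 n m (w : 'M[R]_m) : m = (n + n)%N ->
  skew w -> w \in unitmx ->
  \forall w' \near w, forall C, w' = C *m w *m C^T -> 0 < \det C.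
Proof.
move=> mn; subst m => ws wu.
have Js : skew (stdJ R n) by exact: stdJ_tr.
have JJ : stdJ R n *m (stdJ R n)^T = 1%:M.
  by rewrite stdJ_tr mulmxN stdJ_sqr opprK.
have Ju : stdJ R n \in unitmx by have [] := mulmx1_unit JJ.
have [B Bu ->] := skew_congruent erefl Js Ju ws wu.
pose f (z : 'M[R]_(n + n)) := invmx B *m z *m (invmx B)^T *m (stdJ R n)^T.
have fE C : f (C *m (B *m stdJ R n *m B^T) *m C^T) =
    (invmx B *m C *m B) *m stdJ R n *m (invmx B *m C *m B)^T *m (stdJ R n)^T.
  by rewrite /f !trmx_mul !mulmxA.
have fB : f (B *m stdJ R n *m B^T) = 1%:M.
  have := fE 1%:M; rewrite mul1mx trmx1 !mulmx1 => ->.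
  by rewrite mulVmx// mul1mx trmx1 mulmx1.
have fc : {for B *m stdJ R n *m B^T, continuous f}.
  do 2!(apply: continuous_mulmx_at; last exact: continuous_cst_at).
  by apply: continuous_mulmx_at; [exact: continuous_cst_at|exact: cvg_id].
rewrite /prop_for /continuous_at fB in fc.
have H : \forall z \near B *m stdJ R n *m B^T, posdef (f z).
  exact: fc _ (@near_posdef1 R (n + n)).
apply: filterS H => z zp C zE.
move: zp; rewrite zE fE => zp.
have Cu : invmx B *m C *m B \in unitmx.
  by have := posdef_unit zp; rewrite !unitmx_mul => /andP[/andP[/andP[-> _] _] _].
have := stdJ_congr_det_gt0 Cu zp.
by rewrite !det_mulmx det_inv mulrAC mulVr ?mul1r// -unitmxE.
Qed.

(* Nondegenerate skew forms on a given space are congruent, so for them this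
   says that [w] and [Om] induce the same orientation. *)
Definition pos_congr m (Om w : 'M[R]_m) : Prop :=
  exists2 B : 'M[R]_m, 0 < \det B & w = B *m Om *m B^T.

Lemma pos_congr_trans m (Om w C : 'M[R]_m) :
  0 < \det C -> pos_congr Om w -> pos_congr Om (C *m w *m C^T).
Proof.
move=> C0 [B B0 ->]; exists (C *m B); first by rewrite det_mulmx mulr_gt0.
by rewrite trmx_mul !mulmxA.
Qed.

(** If the congruence [B] from [Om] to [w] has negative determinant, then [C *m B] has a positive
    one. *)
Lemma pos_congr_flip n m (Om w C : 'M[R]_m) : m = (n + n)%N ->
  skew Om -> Om \in unitmx -> skew w -> w \in unitmx -> \det C < 0 ->
  pos_congr Om w \/ pos_congr Om (C *m w *m C^T).
Proof.
move=> mn Os Ou ws wu C0.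
have [B Bu ->] := skew_congruent mn Os Ou ws wu.
have : \det B != 0 by rewrite -unitfE -unitmxE.
rewrite neq_lt => /orP[B0|B0]; last by left; exists B.
right; exists (C *m B); first by rewrite det_mulmx nmulr_rgt0.
by rewrite trmx_mul !mulmxA.
Qed.

(** Two positive congruences would combine into [invmx B' *m (C *m B)], which preserves [Om] and has
    negative determinant; [near_congr_det_gt0], taken at [Om] itself, excludes this. *)
Lemma pos_congr_noflip n m (Om w C : 'M[R]_m) : m = (n + n)%N ->
  skew Om -> Om \in unitmx -> \det C < 0 ->
  pos_congr Om w -> ~ pos_congr Om (C *m w *m C^T).
Proof.
move=> mn Os Ou C0 [B B0 ->] [B' B'0 E].
have Bu : B' \in unitmx by rewrite unitmxE unitfE gt_eqF.
have /nbhs_singleton/(_ (invmx B' *m (C *m B))) := near_congr_det_gt0 mn Os Ou.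
rewrite !det_mulmx det_inv => /(_ _)/wrap[].
  have -> : invmx B' *m (C *m B) *m Om *m (invmx B' *m (C *m B))^T =
      invmx B' *m (C *m (B *m Om *m B^T) *m C^T) *m (invmx B')^T.
    by rewrite !trmx_mul !mulmxA.
  by rewrite E trmx_inv -!mulmxA mulKmx// mulmxV ?unitmx_tr// mulmx1.
rewrite pmulr_rgt0 ?invr_gt0// nmulr_rgt0// => /(lt_trans B0).
by rewrite ltxx.
Qed.

(** Every congruence from [w] to a nearby form has positive determinant, and it composes with the
    one from [Om] to [w]. *)
Lemma near_pos_congr n m (Om w : 'M[R]_m) : m = (n + n)%N ->
  skew Om -> Om \in unitmx -> pos_congr Om w ->
  \forall w' \near w, skew w' -> w' \in unitmx -> pos_congr Om w'.
Proof.
move=> mn Os Ou wp; have [B B0 wE] := wp.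
have Bu : B \in unitmx by rewrite unitmxE unitfE gt_eqF.
have ws : skew w by rewrite wE; exact: skew_congr.
have wu : w \in unitmx by rewrite wE !unitmx_mul unitmx_tr Bu Ou.
apply: filterS (near_congr_det_gt0 mn ws wu) => w' w'0 w's w'u.
have [C Cu CE] := skew_congruent mn ws wu w's w'u.
by rewrite CE; apply: pos_congr_trans wp; exact: w'0.
Qed.

Lemma skew_unit_exists n m : m = (n + n)%N ->
  exists2 Om : 'M[R]_m, skew Om & Om \in unitmx.
Proof.
move=> ->; exists (stdJ R n); first exact: stdJ_tr.
have JJ : stdJ R n *m (- stdJ R n) = 1%:M by rewrite mulmxN stdJ_sqr opprK.
by have [] := mulmx1_unit JJ.
Qed.

End CongruenceSignNear.

(** * Square roots of positive definite matrices *)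

Section Sqrt.
Variable R : realType.

(** Newton interpolation: a new node is served by adding a multiple of the product that vanishes at
    the earlier ones. It allows a function of a diagonalisable matrix to be written as a polynomial
    in it, so that symmetry is inherited. *)
Lemma interpolate (F : fieldType) (s : seq F) (f : F -> F) :
  exists q : {poly F}, forall x, x \in s -> q.[x] = f x.
Proof.
elim: s => [|a s [q qE]]; first by exists 0.
have [sa|sa] := boolP (a \in s).
  by exists q => x; rewrite inE => /orP[/eqP ->|]; exact: qE.
pose r := \prod_(b <- s) ('X - b%:P).
have ra : r.[a] != 0 by rewrite -rootE root_prod_XsubC.
exists (q + ((f a - q.[a]) / r.[a]) *: r) => x.
rewrite inE => /orP[/eqP ->|xs]; rewrite hornerD hornerZ.
  by rewrite divfK// addrC subrK.
have -> : r.[x] = 0 by apply/eqP; rewrite -rootE root_prod_XsubC.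
by rewrite mulr0 addr0 qE.
Qed.

Lemma horner_mx_tr n (S : 'M[R]_n.+1) p :
  S^T = S -> (horner_mx S p)^T = horner_mx S p.
Proof.
move=> ST; elim/poly_ind: p => [|p c IH]; first by rewrite rmorph0 trmx0.
rewrite rmorphD rmorphM /= horner_mx_X horner_mx_C linearD /= tr_scalar_mx.
rewrite trmx_mul ST IH; congr (_ + _).
exact: (@comm_mx_horner _ _ S S p (erefl _)).
Qed.

Lemma horner_mx_eq_on_spectrum (F : fieldType) n (A P : 'M[F]_n.+1) d
    (p p' : {poly F}) : A = invmx P *m diag_mx d *m P -> P \in unitmx ->
  (forall i, p.[d 0 i] = p'.[d 0 i]) -> horner_mx A p = horner_mx A p'.
Proof.
move=> -> Pu pp'; rewrite !horner_mx_uconjC// !horner_mx_diag.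
by congr (_ *m diag_mx _ *m _); apply/rowP => i; rewrite !mxE.
Qed.

Lemma eigenvalue_posdef n (S : 'M[R]_n) k : posdef S -> eigenvalue S k -> 0 < k.
Proof.
move=> S0 /eigenvalueP[v vS v0]; have := S0 v v0; rewrite vS -scalemxAl mxE.
by rewrite pmulr_lgt0//; have := @posdef1 R n v v0; rewrite mulmx1.
Qed.

(** The complexified matrix is Hermitian, hence diagonalisable with real eigenvalues, and an
    equality between two polynomials in [S] can be checked after complexification. A finite set of
    positive test points is all that is kept of the spectral theorem. *)
Lemma sym_posdef_spectrum n (S : 'M[R]_n.+1) : S^T = S -> posdef S ->
  exists2 s : seq R, (forall k, k \in s -> 0 < k) &
    forall p p' : {poly R}, (forall k, k \in s -> p.[k] = p'.[k]) ->
      horner_mx S p = horner_mx S p'.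
Proof.
move=> ST S0; pose A := map_mx (real_complex R) S.
have Areal : A \is a mxOver Num.real.
  by apply/mxOverP => i j; rewrite mxE complex_real.
have Ah : A \is hermsymmx.
  apply: realsym_hermsym => //; apply/is_hermitianmxP.
  by apply/matrixP => i j; rewrite expr0 scale1r !mxE -{1}ST mxE.
have /orthomx_spectralP AE := hermitian_normalmx Ah.
have dreal := hermitian_spectral_diag_real Ah.
move: AE dreal (spectral_unit A).
set P := spectralmx A; set d := spectral_diag A => AE dreal Pu.
clearbody P d.
pose k i := complex.Re (d 0 i).
have kE i : d 0 i = (k i)%:C%C by rewrite RRe_real// (mxOverP dreal).
exists [seq k i | i : 'I_n.+1].
  move=> _ /mapP[i _ ->]; apply: (eigenvalue_posdef S0).
  rewrite eigenvalue_root_char.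
  suff : root (char_poly A) (d 0 i).
    by rewrite kE -map_char_poly (fmorph_root (real_complex R)).
  rewrite -eigenvalue_root_char; apply/eigenvalueP; exists (row i P).
    rewrite -row_mul {1}AE !mulmxA mulmxV// mul1mx row_mul.
    by rewrite row_diag_mx -scalemxAl -rowE.
  rewrite rowE mul_row_unit_neq0//; apply/negP => /eqP/rowP/(_ i).
  by rewrite !mxE !eqxx => /eqP; rewrite oner_eq0.
move=> p p' pp'; apply: (@map_mx_inj _ _ (real_complex R)).
rewrite (map_horner_mx _ S p) (map_horner_mx _ S p') -/A.
apply: (horner_mx_eq_on_spectrum AE Pu) => i.
rewrite kE !(horner_map (real_complex R)).
by rewrite pp'//; apply/mapP; exists i; rewrite // mem_enum.
Qed.

(** The polynomial interpolates fourth roots on the spectrum, so that the square root is itself a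
    square [H *m H] with [H] symmetric and invertible; its positivity is then that of a congruence
    of the identity. *)
Lemma sqrt_exists n (S : 'M[R]_n) : S^T = S -> posdef S ->
  exists K : 'M[R]_n, [/\ K^T = K, posdef K & K *m K = S].
Proof.
case: n S => [|n] S ST S0.
  by exists 0; split; rewrite ?flatmx0 ?trmx0// => v; rewrite [v]thinmx0 eqxx.
have [s s0 sE] := sym_posdef_spectrum ST S0.
have [q qE] := interpolate s (fun x => Num.sqrt (Num.sqrt x)).
pose H := horner_mx S q.
have HT : H^T = H by exact: horner_mx_tr.
have HHHH : (H *m H) *m (H *m H) = S.
  have -> : H *m H *m (H *m H) = horner_mx S (q * q * (q * q)).
    by rewrite !rmorphM.
  rewrite -[RHS](horner_mx_X S); apply: sE => k ks.
  rewrite !hornerM hornerX qE// -!expr2 sqr_sqrtr ?sqrtr_ge0//.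
  by rewrite sqr_sqrtr ?ltW ?s0.
have Hu : H \in unitmx.
  have := posdef_unit S0; rewrite -HHHH -mulmxA unitmx_mul.
  by move=> /andP[].
exists (H *m H); split => //; first by rewrite trmx_mul HT.
by have := posdef_congr Hu (@posdef1 R n.+1); rewrite mulmx1 HT.
Qed.

(** Chosen by its properties, since the interpolating polynomial gives no control on the dependence
    on [S]; uniqueness and regularity come afterwards from the Sylvester equation. The default value
    is 0. *)
Definition sqrtmx n (S : 'M[R]_n) : 'M[R]_n :=
  xget 0 [set K | [/\ K^T = K, posdef K & K *m K = S]].

Lemma sqrtmxP n (S : 'M[R]_n) : S^T = S -> posdef S ->
  [/\ (sqrtmx S)^T = sqrtmx S, posdef (sqrtmx S) & sqrtmx S *m sqrtmx S = S].
Proof.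
move=> ST S0; rewrite /sqrtmx; case: xgetP => [//|noK].
by have [K KP] := sqrt_exists ST S0; case: (noK K).
Qed.

Lemma trace_quad m (A X : 'M[R]_m) :
  \tr (X^T *m A *m X) = \sum_i (row i X^T *m A *m (row i X^T)^T) 0 0.
Proof.
rewrite /mxtrace; apply: eq_bigr => i _.
rewrite [LHS]mxE -row_mul [RHS]mxE.
by apply: eq_bigr => j _; rewrite !mxE.
Qed.

Lemma posdef_trace_ge0 m (A X : 'M[R]_m) : posdef A -> 0 <= \tr (X^T *m A *m X).
Proof.
move=> A0; rewrite trace_quad sumr_ge0// => i _.
have [->|/A0/ltW//] := eqVneq (row i X^T) 0.
by rewrite !mul0mx mxE.
Qed.

Lemma trace_sqnorm m (X : 'M[R]_m) :
  \tr (X^T *m X) = \sum_i \sum_j X i j ^+ 2.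
Proof.
rewrite exchange_big; apply: eq_bigr => i _; rewrite mxE.
by apply: eq_bigr => j _; rewrite !mxE expr2.
Qed.

(** [G] is the inverse of [K]. Bounding its quadratic form at [v *m H], where [H] is the root of
    [K], bounds [v *m v^T] by a multiple of [v *m K *m v^T]; the trace is a sum of such terms over
    the rows of [X^T]. *)
Lemma posdef_coercive m (K : 'M[R]_m) : K^T = K -> posdef K ->
  exists2 c, 0 < c &
  forall X : 'M[R]_m, c * \tr (X^T *m X) <= \tr (X^T *m K *m X).
Proof.
move=> KT K0; have [H [HT H0 HH]] := sqrt_exists KT K0.
have Hu := posdef_unit H0.
pose G := invmx H *m (invmx H)^T.
have [e e0 Ge] : exists2 e, 0 < e & forall i j, `|G i j| <= e.
  exists (1 + \sum_i \sum_j `|G i j|).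
    by rewrite ltr_pwDl// sumr_ge0// => i _; exact: sumr_ge0.
  move=> i j; rewrite (bigD1 i)//= (bigD1 j)//=.
  rewrite [leRHS]addrC -!addrA lerDl addr_ge0 ?sumr_ge0// addr_ge0//.
  by rewrite sumr_ge0// => ? _; exact: sumr_ge0.
have b0 : 0 < e * (m%:R + 1) by rewrite mulr_gt0// ltr_wpDl.
exists (e * (m%:R + 1))^-1; first by rewrite invr_gt0.
move=> X; rewrite mulrC ler_pdivrMr// mulrC.
have -> : X^T *m X = X^T *m 1%:M *m X by rewrite mulmx1.
rewrite !trace_quad mulr_sumr; apply: ler_sum => i _.
set v := row i X^T; rewrite mulmx1.
have := @quad_form_bound R m G e (v *m H) Ge.
have -> : v *m H *m G *m (v *m H)^T = v *m v^T.
  rewrite /G trmx_mul !mulmxA mulmxK// -(mulmxA _ _ H^T) -trmx_mul.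
  by rewrite mulmxV// trmx1 mulmx1.
have -> : v *m H *m (v *m H)^T = v *m K *m v^T.
  by rewrite trmx_mul HT -HH !mulmxA.
move=> /(le_trans (ler_norm _)) /le_trans; apply.
rewrite ler_wpM2r ?ler_wpM2l ?(ltW e0)// ?lerDl//.
rewrite /v; have [->|/K0/ltW//] := eqVneq (row i X^T) 0.
by rewrite !mul0mx mxE.
Qed.

(** For the trace inner product, [X *m L] contributes a nonnegative amount to the pairing of [X]
    with [X *m L + K *m X], and [K *m X] at least a multiple of the squared norm. The constant
    depends on [K] only. This uniformity in [L] yields the continuity of the square root, where [L]
    is the root at the moving point, about which no bound is known yet. *)
Lemma sylvester_coercive m (K : 'M[R]_m) : K^T = K -> posdef K ->
  exists2 c, 0 < c &
  forall (L X : 'M[R]_m), posdef L ->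
    \tr (X^T *m X) <= c * \tr ((X *m L + K *m X)^T *m (X *m L + K *m X)).
Proof.
move=> KT K0; have [c c0 cK] := posdef_coercive KT K0.
exists (c ^- 2); first by rewrite invr_gt0 exprn_gt0.
move=> L X L0; set Y := X *m L + K *m X.
have h1 : c * \tr (X^T *m X) <= \tr (X^T *m Y).
  rewrite /Y mulmxDr mxtraceD addrC mulmxA (le_trans (cK X))// lerDl.
  by rewrite mxtrace_mulC; have := posdef_trace_ge0 X^T L0; rewrite trmxK.
(* Young's inequality, weighted so that half of the lower bound [h1] absorbs the term in [X]. *)
have h2 : \tr (X^T *m Y) <=
    c / 2 * \tr (X^T *m X) + (2 * c)^-1 * \tr (Y^T *m Y).
  have -> : \tr (X^T *m Y) = \sum_i \sum_j X i j * Y i j.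
    rewrite exchange_big; apply: eq_bigr => i _; rewrite mxE.
    by apply: eq_bigr => j _; rewrite !mxE.
  rewrite !trace_sqnorm !mulr_sumr -big_split; apply: ler_sum => i _ /=.
  rewrite !mulr_sumr -big_split; apply: ler_sum => j _ /=.
  move: (X i j) (Y i j) => a b; rewrite -subr_ge0.
  have -> : c / 2 * a ^+ 2 + (2 * c)^-1 * b ^+ 2 - a * b =
      (2 * c)^-1 * (c * a - b) ^+ 2.
    by field; rewrite gt_eqF.
  by rewrite mulr_ge0 ?sqr_ge0// invr_ge0 mulr_ge0// ltW.
have h : c / 2 * \tr (X^T *m X) <= (2 * c)^-1 * \tr (Y^T *m Y).
  have := le_trans h1 h2; lra.
have c20 : 0 < 2 / c by rewrite divr_gt0.
rewrite -(ler_pM2l c20) in h; apply: le_trans (le_trans h _).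
  by rewrite le_eqVlt; apply/orP; left; apply/eqP; field; rewrite gt_eqF.
by rewrite le_eqVlt; apply/orP; left; apply/eqP; field; rewrite gt_eqF.
Qed.

Lemma trace_sqnorm_eq0 m (X : 'M[R]_m) : \tr (X^T *m X) <= 0 -> X = 0.
Proof.
rewrite trace_sqnorm => h; apply/matrixP => i j; rewrite mxE; apply/eqP.
have /eqP : \sum_i \sum_j X i j ^+ 2 = 0.
  apply/eqP; rewrite eq_le h /= sumr_ge0// => ? _.
  by rewrite sumr_ge0// => ? _; exact: sqr_ge0.
rewrite psumr_eq0 => [/allP/(_ i)|? _]; last first.
  by rewrite sumr_ge0// => ? _; exact: sqr_ge0.
rewrite mem_index_enum => /(_ isT)/=; rewrite psumr_eq0 => [/allP/(_ j)|? _].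
  by rewrite mem_index_enum => /(_ isT)/=; rewrite sqrf_eq0.
exact: sqr_ge0.
Qed.

Lemma sylvester_inj m (K L X : 'M[R]_m) : K^T = K -> posdef K -> posdef L ->
  X *m L + K *m X = 0 -> X = 0.
Proof.
move=> KT K0 L0 E; have [c _ /(_ L X L0)] := sylvester_coercive KT K0.
by rewrite E mulmx0 mxtrace0 mulr0; exact: trace_sqnorm_eq0.
Qed.

(** The difference of two roots solves a homogeneous Sylvester equation. *)
Lemma sqrtmx_uniq m (S K : 'M[R]_m) : K^T = K -> posdef K -> K *m K = S ->
  sqrtmx S = K.
Proof.
move=> KT K0 KK; have ST : S^T = S by rewrite -KK trmx_mul KT.
have S0 : posdef S.
  have := posdef_congr (posdef_unit K0) (@posdef1 R m).
  by rewrite mulmx1 KT KK.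
have [HT H0 HH] := sqrtmxP ST S0.
apply/eqP; rewrite -subr_eq0; apply/eqP.
apply: (sylvester_inj HT H0 K0).
by rewrite mulmxBl mulmxBr HH KK addrC addrA subrK subrr.
Qed.

(** The commutator of [B] with the root solves the homogeneous Sylvester equation that has the root
    on both sides. *)
Lemma sqrtmx_comm m (S B : 'M[R]_m) : S^T = S -> posdef S ->
  B *m S = S *m B -> B *m sqrtmx S = sqrtmx S *m B.
Proof.
move=> ST S0 BS; have [HT H0 HH] := sqrtmxP ST S0.
set H := sqrtmx S in HT H0 HH *.
apply/eqP; rewrite -subr_eq0; apply/eqP.
apply: (sylvester_inj HT H0 H0).
rewrite mulmxBl mulmxBr -!mulmxA HH mulmxA BS [H *m (H *m _)]mulmxA HH.
by rewrite addrC addrA subrK subrr.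
Qed.

End Sqrt.

(** * Differentiability of matrix-valued maps *)

Section MatrixDerivative.
Variables (R : realType) (V : normedModType R).

Lemma differentiable_entry m n (F : V -> 'M[R]_(m, n)) x i j :
  differentiable F x -> differentiable (fun y => F y i j) x.
Proof.
move=> dF; apply: (@differentiable_comp _ _ _ _ F (fun A => A i j)) => //.
exact: differentiable_coord.
Qed.

Lemma differentiable_mx m n (F : V -> 'M[R]_(m, n)) x :
  (forall i j, differentiable (fun y => F y i j) x) -> differentiable F x.
Proof.
move=> dF.
have -> : F = \sum_i \sum_j (fun y => F y i j *: delta_mx i j).
  apply/funext => y; rewrite fct_sumE [LHS]matrix_sum_delta.
  by apply: eq_bigr => i _; rewrite fct_sumE.
apply: differentiable_sum => i; apply: differentiable_sum => j.
exact: differentiableZl.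
Qed.

Lemma differentiable_mulmx m n p (F : V -> 'M[R]_(m, n)) (G : V -> 'M[R]_(n, p)) x :
  differentiable F x -> differentiable G x ->
  differentiable (fun y => F y *m G y) x.
Proof.
move=> dF dG; apply: differentiable_mx => i j.
have -> : (fun y => (F y *m G y) i j) =
    \sum_k ((fun y => F y i k) * (fun y => G y k j)).
  by apply/funext => y; rewrite fct_sumE mxE.
by apply: differentiable_sum => k; apply: differentiableM; exact: differentiable_entry.
Qed.

Lemma differentiable_trmx m n (F : V -> 'M[R]_(m, n)) x :
  differentiable F x -> differentiable (fun y => (F y)^T) x.
Proof.
move=> dF; apply: differentiable_mx => i j.
under eq_fun do rewrite mxE.
exact: differentiable_entry.
Qed.

Lemma derive_entry m n (F : V -> 'M[R]_(m, n)) x v i j : differentiable F x ->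
  ('D_v F x) i j = 'D_v (fun y => F y i j) x.
Proof.
by move=> dF; rewrite (derive_mx (@diff_derivable _ _ _ F x v dF)) mxE.
Qed.

Lemma derive_mulmx m n p (F : V -> 'M[R]_(m, n)) (G : V -> 'M[R]_(n, p)) x v :
  differentiable F x -> differentiable G x ->
  'D_v (fun y => F y *m G y) x = 'D_v F x *m G x + F x *m 'D_v G x.
Proof.
move=> dF dG; apply/matrixP => i j.
rewrite derive_entry; last exact: differentiable_mulmx.
have -> : (fun y => (F y *m G y) i j) =
    \sum_k ((fun y => F y i k) * (fun y => G y k j)).
  by apply/funext => y; rewrite fct_sumE mxE.
have dFe k : derivable (fun y => F y i k) x v.
  by apply: diff_derivable; exact: differentiable_entry.
have dGe k : derivable (fun y => G y k j) x v.
  by apply: diff_derivable; exact: differentiable_entry.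
rewrite derive_sum => [|k]; last exact: derivableM.
rewrite !mxE -big_split; apply: eq_bigr => k _ /=.
rewrite (deriveM (dFe k) (dGe k)) (derive_entry _ _ _ dF) (derive_entry _ _ _ dG).
by rewrite addrC; congr (_ + _); rewrite mulrC.
Qed.

Lemma derive_trmx m n (F : V -> 'M[R]_(m, n)) x v : differentiable F x ->
  'D_v (fun y => (F y)^T) x = ('D_v F x)^T.
Proof.
move=> dF; apply/matrixP => i j; rewrite mxE.
rewrite !derive_entry//; last exact: differentiable_trmx.
by under eq_fun do rewrite mxE.
Qed.

(** The first factor is bounded by a multiple of the distance to [x] and the second tends to 0, so
    the product has derivative zero although [f] is only continuous. *)
Lemma differentiable_mul_vanishing (s f : V -> R) x :
  differentiable s x -> {for x, continuous f} -> f x = 0 ->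
  differentiable (fun y => (s y - s x) * f y) x.
Proof.
move=> ds cf fx; set r := fun y => _.
have dc : continuous ('d s x) by exact: diff_continuous.
have [C C0 dC] := linear_lipschitz dc.
have sx : shift x y @[y --> (0 : V)] --> x.
  by rewrite -[X in _ --> X]add0r; apply: cvgD; [exact: cvg_id|exact: cvg_cst].
have rE : r \o shift x = cst (r x) + 'd (cst (0 : R)) x +o_ (0 : V) id.
  apply/eqaddoP => e e0.
  have /eqaddoP/(_ 1 ltr01) h1 := diff_locally ds.
  have e1 : 0 < e / (1 + C) by rewrite divr_gt0// addr_gt0.
  have h2 : \forall y \near (0 : V), `|f (y + x)| < e / (1 + C).
    have /cvgrPdist_lt/(_ _ e1) : f y @[y --> x] --> f x by exact: cf.
    rewrite fx => h.
    have {}h : \forall y \near (0 : V), `|0 - f (y + x)| < e / (1 + C) := sx _ h.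
    by apply: filterS h => y; rewrite sub0r normrN.
  near=> y.
  rewrite !fctE /= /r subrr mul0r add0r diff_cst /= subr0 normrM.
  have a1 : `|s (y + x) - s x| <= (1 + C) * `|y|.
    have : `|(s \o shift x - (cst (s x) + 'd s x)) y| <= 1 * `|y| by near: y.
    rewrite !fctE /= => h.
    rewrite -[X in `|X|](subrK ('d s x y)) mulrDl.
    rewrite (le_trans (ler_normD _ _))// lerD//.
    by rewrite -addrA -opprD.
  have a2 : `|f (y + x)| <= e / (1 + C) by apply: ltW; near: y.
  apply: le_trans (ler_pM _ _ a1 a2) _ => //.
  rewrite le_eqVlt; apply/orP; left; apply/eqP; field.
  by rewrite gt_eqF// addr_gt0.
have cz : continuous ('d (cst (0 : R)) x) by exact: diff_continuous.
by apply/diff_locallyP; rewrite (diff_unique cz rE).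
Unshelve. all: by end_near. Qed.

(** Caratheodory's criterion with a matrix-valued slope [f]. The increments of the square root have
    this form, with a slope that involves the root at the moving point and is known only to be
    continuous. *)
Lemma differentiable_caratheodory m n p (F : V -> 'M[R]_(m, p))
    (S : V -> 'M[R]_(m, n)) (f : V -> 'M[R]_(n, p)) x :
  differentiable S x -> {for x, continuous f} ->
  (\forall y \near x, F y = F x + (S y - S x) *m f y) -> differentiable F x.
Proof.
move=> dS cf FE.
apply: (near_differentiable (f := fun y =>
    F x + (S y - S x) *m f x + (S y - S x) *m (f y - f x))).
  by apply: filterS FE => y ->; rewrite mulmxBr -addrA [X in _ + X]addrC subrK.
have dSx : differentiable (fun y => S y - S x) x.
  by apply: differentiableB => //; exact: differentiable_cst.
apply: differentiableD.
  apply: differentiableD; first exact: differentiable_cst.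
  by apply: differentiable_mulmx => //; exact: differentiable_cst.
apply: differentiable_mx => i j.
have -> : (fun y => ((S y - S x) *m (f y - f x)) i j) =
    \sum_k (fun y => (S y i k - S x i k) * (f y k j - f x k j)).
  apply/funext => y; rewrite fct_sumE mxE; apply: eq_bigr => k _.
  by rewrite !mxE.
apply: differentiable_sum => k.
apply: (@differentiable_mul_vanishing (fun y => S y i k) (fun y => f y k j - f x k j)).
- exact: differentiable_entry.
- apply: continuousB; last exact: continuous_cst_at.
  apply: (@continuous_comp _ _ _ f (fun A : 'M[R]_(n, p) => A k j)) => //.
  exact: coord_continuous.
- by rewrite subrr.
Qed.

End MatrixDerivative.

(** * Smooth dependence of the square root *)

Section SqrtSmooth.
Variables (R : realType) (m : nat).
Implicit Types U : set 'rV[R]_m.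

Lemma continuous_linmx_at (T : topologicalType) (x : T) a b c d
    (L : {linear 'M[R]_(a, b) -> 'M[R]_(c, d)}) (f : T -> 'M[R]_(a, b)) :
  {for x, continuous f} -> {for x, continuous (fun y => L (f y))}.
Proof.
move=> /cvg_mxP fx; apply/cvg_mxP => k l.
have E A : L A k l = \sum_i \sum_j A i j * L (delta_mx i j) k l.
  rewrite {1}[A]matrix_sum_delta linear_sum summxE; apply: eq_bigr => i _.
  rewrite linear_sum summxE; apply: eq_bigr => j _.
  by rewrite linearZ mxE.
rewrite E; under eq_fun do rewrite E.
apply: (@cvg_sumr _ _ _ _ _ (fun i y => \sum_j f y i j * L (delta_mx i j) k l)) => i.
apply: (@cvg_sumr _ _ _ _ _ (fun j y => f y i j * L (delta_mx i j) k l)) => j.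
by apply: cvgM; [exact: fx|exact: cvg_cst].
Qed.

Lemma Ck_on_linmx k U a b c d (L : {linear 'M[R]_(a, b) -> 'M[R]_(c, d)})
    (F : 'rV[R]_m -> 'M[R]_(a, b)) :
  open U -> Ck_on k U F -> Ck_on k U (fun x => L (F x)).
Proof.
move=> Uo HF.
apply: (Ck_on_eq Uo (f := fun x => \sum_i \sum_j F x i j *: L (delta_mx i j))).
  move=> x _; rewrite [in RHS](matrix_sum_delta (F x)) linear_sum.
  by apply: eq_bigr => i _; rewrite linear_sum; apply: eq_bigr => j _; rewrite linearZ.
do 2!apply: Ck_on_sum => // ?; apply: Ck_on_scalel => //.
exact: Ck_on_coord.
Qed.

(** Acting on vectorised matrices, so that solving the Sylvester equation is multiplication by an
    [invmx], whose regularity is known. *)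
Definition sylvester n (K L : 'M[R]_n) : 'M[R]_(n * n) :=
  lin_mulmxr L + lin_mulmx K.

Lemma mul_vec_sylvester n (K L X : 'M[R]_n) :
  mxvec X *m sylvester K L = mxvec (X *m L + K *m X).
Proof. by rewrite mulmxDr !mul_vec_lin linearD. Qed.

Lemma sylvester_unit n (K L : 'M[R]_n) : K^T = K -> posdef K -> posdef L ->
  sylvester K L \in unitmx.
Proof.
move=> KT K0 L0; rewrite -row_free_unit -kermx_eq0.
apply/negPn/negP => /rowV0Pn[v /sub_kermxP vS v0].
move: vS; rewrite -(vec_mxK v) mul_vec_sylvester => /(congr1 vec_mx).
rewrite mxvecK linear0 => /(sylvester_inj KT K0 L0) h.
by move: v0; rewrite -(vec_mxK v) h linear0 eqxx.
Qed.

Lemma continuous_invmx_at (T : topologicalType) (x : T) n (f : T -> 'M[R]_n) :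
  f x \in unitmx -> {for x, continuous f} ->
  {for x, continuous (fun y => invmx (f y))}.
Proof.
move=> fu fc; have dc := continuous_det_at fc.
have d0 : \det (f x) != 0 by rewrite -unitfE -unitmxE.
have ad : {for x, continuous (fun y => (\det (f y))^-1 *: \adj (f y))}.
  apply/cvg_mxP => i j; rewrite mxE; under eq_fun do rewrite mxE.
  apply: cvgM; first exact: cvgV.
  rewrite mxE; under eq_fun do rewrite mxE; apply: cvgM; first exact: cvg_cst.
  apply: cvg_det; apply/cvg_mxP => k l; rewrite !mxE.
  by under eq_fun do rewrite !mxE; move/cvg_mxP : fc; exact.
rewrite /prop_for /continuous_at {2}/invmx fu.
apply: cvg_trans ad; apply: near_eq_cvg.
have n0 : nbhs (\det (f x)) [set t | t != 0].
  by apply: open_nbhs_nbhs; split => //; exact: open_neq.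
have h : \forall y \near x, \det (f y) != 0 := dc _ n0.
by apply: filterS h => y; rewrite -unitfE -unitmxE => fyu; rewrite /invmx fyu.
Qed.

Section Path.
Variables (U : set 'rV[R]_m) (n : nat) (S : 'rV[R]_m -> 'M[R]_n).
Hypotheses (Uo : open U) (ST : forall x, U x -> (S x)^T = S x)
  (S0 : forall x, U x -> posdef (S x)).
Let H x := sqrtmx (S x).

(** Taking the right factor at [y] and the left one at [x] makes the difference of squares exact,
    without a quadratic remainder. *)
Lemma sqrtmx_increment x y : U x -> U y ->
  (H y - H x) *m H y + H x *m (H y - H x) = S y - S x.
Proof.
move=> Ux Uy; have [_ _ <-] := sqrtmxP (ST Ux) (S0 Ux).
have [_ _ <-] := sqrtmxP (ST Uy) (S0 Uy).
by rewrite mulmxBl mulmxBr addrA subrK.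
Qed.

Lemma near_open (x : 'rV[R]_m) : U x -> \forall y \near x, U y.
Proof. by move=> Ux; apply: open_nbhs_nbhs. Qed.

Lemma sqrtmx_continuous x : U x -> {for x, continuous S} -> {for x, continuous H}.
Proof.
move=> Ux Sc; have [HT H0 _] := sqrtmxP (ST Ux) (S0 Ux).
have [c c0 cH] := sylvester_coercive HT H0.
have dS : {for x, continuous (fun y => \tr ((S y - S x)^T *m (S y - S x)))}.
  have dc : {for x, continuous (fun y => S y - S x)}.
    by apply: continuous_sub_at; [exact: Sc|exact: continuous_cst_at].
  apply: continuous_mxtrace_at.
  by apply: continuous_mulmx_at; [apply: continuous_trmx_at; exact: dc|exact: dc].
apply: continuous_mx_at => i j; apply: continuous_dist_at => e e0.
(* Coercivity multiplies the squared norm of the increment of [S] by [c], so this tolerance leaves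
   [e ^+ 2] for the squared norm of the increment of [H]. *)
have e1 : 0 < e ^+ 2 / c by rewrite divr_gt0// exprn_gt0.
have hS := dS _ (nbhsx_ballx _ _ e1).
rewrite /= subrr mulmx0 mxtrace0 in hS.
have {}hS : \forall y \near x, `|0 - \tr ((S y - S x)^T *m (S y - S x))| < e ^+ 2 / c := hS.
near=> y.
have Uy : U y by near: y; exact: near_open.
have [_ Hy0 _] := sqrtmxP (ST Uy) (S0 Uy).
have h1 := cH _ (H y - H x) Hy0.
rewrite sqrtmx_increment// in h1.
have h2 : \tr ((S y - S x)^T *m (S y - S x)) < e ^+ 2 / c.
  apply: le_lt_trans (ler_norm _) _; rewrite -normrN -sub0r.
  by near: y.
rewrite distrC -(@ltr_pXn2r _ 2%N) ?nnegrE ?(ltW e0)// real_normK ?num_real//.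
rewrite ltr_pdivlMr// mulrC in h2.
apply: le_lt_trans h2; rewrite (le_trans _ h1)// trace_sqnorm.
rewrite (bigD1 i)//= (bigD1 j)//= -addrA !mxE lerDl addr_ge0 ?sumr_ge0// => ? _.
  exact: sqr_ge0.
by rewrite sumr_ge0// => ? _; exact: sqr_ge0.
Unshelve. all: by end_near. Qed.

Lemma sqrtmx_differentiable x : U x -> differentiable S x -> differentiable H x.
Proof.
move=> Ux dS; have Hc := sqrtmx_continuous Ux (differentiable_continuous dS).
have [HT H0 _] := sqrtmxP (ST Ux) (S0 Ux).
have dv : differentiable (fun y => mxvec (S y)) x.
  apply: differentiable_mx => i j; rewrite ord1.
  case/mxvec_indexP: j => k l; under eq_fun do rewrite mxvecE.
  exact: differentiable_entry.
have dH : differentiable (fun y => mxvec (H y)) x.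
  apply: (differentiable_caratheodory (f := fun y => invmx (sylvester (H x) (H y))) dv).
    apply: continuous_invmx_at; first exact: sylvester_unit.
    apply: continuous_add_at; last exact: continuous_cst_at.
    exact: continuous_linmx_at.
  near=> y.
  have Uy : U y by near: y; exact: near_open.
  have [_ Hy0 _] := sqrtmxP (ST Uy) (S0 Uy).
  rewrite -linearB /= -(sqrtmx_increment Ux Uy) -mul_vec_sylvester.
  by rewrite mulmxK ?sylvester_unit// linearB /= addrC subrK.
apply: differentiable_mx => i j.
have -> : (fun y => H y i j) = (fun y => mxvec (H y) 0 (mxvec_index i j)).
  by apply/funext => y; rewrite mxvecE.
exact: differentiable_entry.
Unshelve. all: by end_near. Qed.

(** Differentiating [H *m H = S] gives a Sylvester equation for the derivative of [H] whose
    coefficients are [H] itself. Regularity [k] of [H] thus passes to its derivative, which is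
    regularity [k.+1] of [H]. *)
Lemma Ck_on_sqrtmx k : Ck_on k U S -> Ck_on k U H.
Proof.
elim: k => [|k IH] SC.
  by move=> x Ux; apply: sqrtmx_continuous => //; exact: SC.
have HC := IH (Ck_onW SC).
have [dS DS] := SC.
have dH x : U x -> differentiable H x.
  by move=> Ux; apply: sqrtmx_differentiable => //; exact: dS.
split=> // v.
apply: (Ck_on_eq Uo (f := fun x =>
    vec_mx (mxvec ('D_v S x) *m invmx (sylvester (H x) (H x))))).
  move=> x Ux; have [HT H0 HH] := sqrtmxP (ST Ux) (S0 Ux).
  have -> : 'D_v S x = 'D_v H x *m H x + H x *m 'D_v H x.
    rewrite -derive_mulmx; [|exact: dH|exact: dH].
    apply: near_eq_derive; near=> y.
    have Uy : U y by near: y; exact: near_open.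
    by have [_ _ ->] := sqrtmxP (ST Uy) (S0 Uy).
  by rewrite -mul_vec_sylvester mulmxK ?sylvester_unit// mxvecK.
apply: Ck_on_linmx => //; apply: Ck_on_mulmx => //.
  by apply: Ck_on_linmx => //; exact: DS.
apply: Ck_on_invmx => //.
  by move=> x Ux; have [HT H0 _] := sqrtmxP (ST Ux) (S0 Ux); exact: sylvester_unit.
by apply: Ck_on_add => //; exact: Ck_on_linmx.
Unshelve. all: by end_near. Qed.

End Path.
End SqrtSmooth.

(** * Levi-Civita connection *)

Section Schwarz.
Variables (R : realType) (m : nat).

Lemma near_square (V : normedModType R) (x u v : V) (A : set V) : nbhs x A ->
  exists2 h : R, 0 < h & forall s t, 0 <= s <= h -> 0 <= t <= h ->
    A (x + s *: u + t *: v).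
Proof.
move=> /nbhs_ballP[e /= e0 eA]; pose h := e / (`|u| + `|v| + 1).
have d0 : 0 < `|u| + `|v| + 1 by rewrite ltr_wpDl// addr_ge0.
exists h; first by rewrite divr_gt0.
move=> s t /andP[s0 sh] /andP[t0 th]; apply: eA; rewrite -ball_normE /=.
rewrite -addrA opprD addrA subrr sub0r normrN.
apply: le_lt_trans (ler_normD _ _) _; rewrite !normrZ !ger0_norm//.
apply: (@le_lt_trans _ _ (h * (`|u| + `|v|))).
  by rewrite mulrDr lerD// ler_wpM2r.
rewrite /h mulrAC ltr_pdivrMr// ltr_pM2l//.
by rewrite ltrDl.
Qed.

Lemma is_derive_line (V : normedModType R) (f : V -> R) (x v : V) (t : R) :
  differentiable f (x + t *: v) ->
  is_derive t 1 (fun s : R => f (x + s *: v)) ('D_v f (x + t *: v)).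
Proof.
move=> df; have E : (fun h : R => h^-1 *: (f (x + (h *: 1 + t) *: v) - f (x + t *: v)))
    = (fun h => h^-1 *: (f (h *: v + (x + t *: v)) - f (x + t *: v))).
  apply/funext => h; congr (_ *: (f _ - _)).
  by rewrite scalerDl -[h *: 1]/(h * 1) mulr1 addrCA.
have dv : derivable f (x + t *: v) v by exact: diff_derivable.
by apply: DeriveDef; rewrite /derivable /derive E.
Qed.

Lemma MVT_line (V : normedModType R) (f : V -> R) (x v : V) (h : R) : 0 < h ->
  (forall t, 0 <= t <= h -> differentiable f (x + t *: v)) ->
  exists2 t, 0 <= t <= h &
    f (x + h *: v) - f x = 'D_v f (x + t *: v) * h.
Proof.
move=> h0 df.
have d t : 0 <= t <= h ->
    is_derive t 1 (fun s : R => f (x + s *: v)) ('D_v f (x + t *: v)).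
  by move=> th; apply/is_derive_line/df.
have [t||t th E] := @MVT R (fun s => f (x + s *: v))
    (fun s => 'D_v f (x + s *: v)) 0 h h0.
- by rewrite in_itv /= => /andP[t0 th]; apply: d; rewrite !ltW.
- apply: derivable_within_continuous => t; rewrite in_itv /= => th.
  by have [] := d t th.
exists t; first by move: th; rewrite in_itv /= => /andP[t0 th]; rewrite !ltW.
by move: E; rewrite subr0 scale0r addr0.
Qed.

(** The mean value theorem is applied along [u] to the increment of [f] in the direction [v], and
    then along [v] to ['D_u f]. *)
Lemma second_difference (V : normedModType R) (f : V -> R) (x u v : V) (h : R) :
  0 < h ->
  (forall s t, 0 <= s <= h -> 0 <= t <= h ->
     differentiable f (x + s *: u + t *: v)) ->
  (forall s t, 0 <= s <= h -> 0 <= t <= h ->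
     differentiable ('D_u f) (x + s *: u + t *: v)) ->
  exists s t, [/\ 0 <= s <= h, 0 <= t <= h &
    f (x + h *: u + h *: v) - f (x + h *: u) - (f (x + h *: v) - f x) =
    'D_v ('D_u f) (x + s *: u + t *: v) * h * h].
Proof.
move=> h0 df ddf.
have hh : 0 <= h <= h by rewrite (ltW h0) /=.
have h00 : (0 : R) <= 0 <= h by rewrite lexx (ltW h0).
have df1 s : 0 <= s <= h -> differentiable f (x + s *: u).
  by move=> sh; have := df s 0 sh h00; rewrite scale0r addr0.
have df2 s : 0 <= s <= h -> differentiable f (x + h *: v + s *: u).
  by move=> sh; have := df s h sh hh; rewrite addrAC.
pose g := (f \o shift (h *: v)) - f.
have dg s : 0 <= s <= h -> differentiable (f \o shift (h *: v)) (x + s *: u).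
  move=> sh; apply: differentiable_comp.
    by apply: differentiableD; [exact: ex_diff|exact: differentiable_cst].
  by rewrite /= addrAC; exact: df2.
have [s sh E1] : exists2 s, 0 <= s <= h &
    g (x + h *: u) - g x = 'D_u g (x + s *: u) * h.
  by apply: MVT_line => // s sh; apply: differentiableB; [exact: dg|exact: df1].
have Dg : 'D_u g (x + s *: u) =
    'D_u f (x + s *: u + h *: v) - 'D_u f (x + s *: u).
  rewrite deriveB; [|exact/diff_derivable/dg|exact/diff_derivable/df1].
  have E : (fun k : R => k^-1 *: ((f \o shift (h *: v)) (k *: u + (x + s *: u))
                                 - (f \o shift (h *: v)) (x + s *: u))) =
      (fun k => k^-1 *: (f (k *: u + (x + s *: u + h *: v))
                        - f (x + s *: u + h *: v))).
    by apply/funext => k /=; rewrite !addrA.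
  by rewrite /derive E.
have [t th E2] : exists2 t, 0 <= t <= h &
    'D_u f (x + s *: u + h *: v) - 'D_u f (x + s *: u) =
    'D_v ('D_u f) (x + s *: u + t *: v) * h.
  by apply: (@MVT_line _ ('D_u f)) => // t th; exact: (ddf s t sh th).
by exists s, t; split => //; rewrite -E2 -Dg -E1 /g !fctE /=.
Qed.

(** The second difference over a small parallelogram is symmetric in the two directions, so the two
    mixed derivatives agree at two, possibly different, points of it; continuity at [x] brings these
    values together. *)
Lemma schwarz (V : normedModType R) (f : V -> R) (A : set V) (x u v : V) :
  nbhs x A -> (forall y, A y -> differentiable f y) ->
  (forall w y, A y -> differentiable ('D_w f) y) ->
  {for x, continuous ('D_u ('D_v f))} -> {for x, continuous ('D_v ('D_u f))} ->
  'D_u ('D_v f) x = 'D_v ('D_u f) x.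
Proof.
move=> nA df ddf c1 c2; apply/eqP; rewrite -subr_eq0 -normr_le0.
apply/ler_addgt0Pl => e e0; rewrite addr0.
have e2 : 0 < e / 2 by rewrite divr_gt0.
have n1 : \forall y \near x, `|'D_u ('D_v f) x - 'D_u ('D_v f) y| < e / 2.
  exact: c1 _ (nbhsx_ballx _ _ e2).
have n2 : \forall y \near x, `|'D_v ('D_u f) x - 'D_v ('D_u f) y| < e / 2.
  exact: c2 _ (nbhsx_ballx _ _ e2).
have [h h0 H] := near_square u v (filterI nA (filterI n1 n2)).
have [|?? s t|s [t [sh th E1]]] := @second_difference _ f x u v h h0.
- by move=> s t sh th; apply: df; have [] := H s t sh th.
- by apply: ddf; have [] := H _ _ s t.
have H' s' t' : 0 <= s' <= h -> 0 <= t' <= h -> A (x + s' *: v + t' *: u).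
  by move=> a b; rewrite addrAC; have [] := H _ _ b a.
have [|?? s' t'|s' [t' [sh' th' E2]]] := @second_difference _ f x v u h h0.
- by move=> s' t' a b; apply: df; exact: H'.
- by apply: ddf; exact: H'.
have E : 'D_v ('D_u f) (x + s *: u + t *: v) =
         'D_u ('D_v f) (x + s' *: v + t' *: u).
  have : 'D_v ('D_u f) (x + s *: u + t *: v) * h * h =
         'D_u ('D_v f) (x + s' *: v + t' *: u) * h * h.
    apply: (etrans (esym E1)); apply: (etrans _ E2).
    have alg (a b c d : R) : a - b - (c - d) = a - c - (b - d) by ring.
    by rewrite (addrAC x (h *: v)); exact: alg.
  move: ('D_v _ _) ('D_u _ _) => a b /eqP.
  have hn : h != 0 by rewrite gt_eqF.
  by rewrite !(inj_eq (mulIf hn)) => /eqP.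
have [_ [_ b2]] := H s t sh th.
have [_ [b1 _]] := H t' s' th' sh'.
have tri (a b c : R) : `|a - c| < e / 2 -> `|b - c| < e / 2 -> `|a - b| <= e.
  move=> ac bc; rewrite -(subrK c a) -addrA [e]splitr.
  apply: le_trans (ler_normD _ _) _; apply: lerD; first exact: ltW.
  by rewrite distrC ltW.
apply: (tri _ _ ('D_v ('D_u f) (x + s *: u + t *: v))); last exact: b2.
by rewrite E (addrAC x (s' *: v)); exact: b1.
Qed.

Lemma schwarz_rV k (U : set 'rV[R]_m) (f : 'rV[R]_m -> 'rV[R]_k) x u v :
  open U -> U x -> Ck_on 2 U f -> 'D_u ('D_v f) x = 'D_v ('D_u f) x.
Proof.
move=> Uo Ux f2; have [df Df] := f2.
apply/rowP => j.
have f2j : Ck_on 2 U (fun y => f y 0 j) by exact: Ck_on_coord.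
have [dfj Dfj] := f2j.
have Uj w : \forall y \near x, ('D_w f y) 0 j = 'D_w (fun y => f y 0 j) y.
  have : \near x, U x by apply: open_nbhs_nbhs.
  by apply: filterS => y Uy; rewrite derive_entry//; exact: df.
have entry w w' : ('D_w ('D_w' f) x) 0 j = 'D_w ('D_w' (fun y => f y 0 j)) x.
  rewrite derive_entry; last by have [h _] := Df w'; exact: (h x Ux).
  by apply: near_eq_derive; exact: Uj.
apply: (etrans (entry u v)); apply: (etrans _ (esym (entry v u))).
apply: (@schwarz _ (fun y => f y 0 j) U).
- exact: open_nbhs_nbhs.
- exact: dfj.
- by move=> w y Uy; have [h _] := Dfj w; exact: (h y Uy).
- by have [_ h] := Dfj v; exact: (h u x Ux).
- by have [_ h] := Dfj u; exact: (h v x Ux).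
Qed.

End Schwarz.

(** * The Levi-Civita derivative in coordinates and its transformation law *)

Section Christoffel.
Variables (R : realType) (m : nat).
Implicit Types (D : 'rV[R]_m -> 'M[R]_m) (u v w : 'rV[R]_m).

(* [koszul D u v *m w^T] is D_u G(v,w) + D_v G(u,w) - D_w G(u,v). *)
Definition koszul D u v : 'rV[R]_m :=
  v *m D u + u *m D v - \row_k (u *m D (delta_mx 0 k) *m v^T) 0 0.

Lemma koszul_dot D u v w : linear D ->
  koszul D u v *m w^T =
  v *m D u *m w^T + u *m D v *m w^T - u *m D w *m v^T.
Proof.
move=> linD; rewrite /koszul !mulmxDl mulNmx; congr (_ - _).
pose L : {linear 'rV[R]_m -> 'M[R]_m} :=
  HB.pack D (GRing.isLinear.Build _ _ _ _ _ linD).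
apply/matrixP => i j; rewrite !ord1 {i j}.
have -> : D w = \sum_k w 0 k *: D (delta_mx 0 k).
  have : L w = \sum_k w 0 k *: L (delta_mx 0 k).
    rewrite {1}[w]row_sum_delta linear_sum.
    by apply: eq_bigr => k _; rewrite linearZ.
  by [].
rewrite mulmx_sumr mulmx_suml summxE mxE; apply: eq_bigr => k _.
by rewrite -scalemxAr -scalemxAl !mxE mulrC.
Qed.

(** The hypothesis on [D] is the derivative of [G = A G' A^T], with [a] the derivative of the
    Jacobian [A]. Of the six terms containing [a], the symmetry of second derivatives cancels four
    and leaves twice [v *m a u], the inhomogeneous term in the transformation law of the Christoffel
    symbols. *)
Lemma koszul_transform D D' (a : 'rV[R]_m -> 'M[R]_m) (A G' : 'M[R]_m) u v :
  linear D -> linear D' -> A \in unitmx -> G' \in unitmx -> G'^T = G' ->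
  (forall u, D u = a u *m G' *m A^T + A *m D' (u *m A) *m A^T
                   + A *m G' *m (a u)^T) ->
  (forall u v, v *m a u = u *m a v) ->
  koszul D u v *m invmx (A *m G' *m A^T) *m A =
  2 *: (v *m a u) + koszul D' (u *m A) (v *m A) *m invmx G'.
Proof.
move=> linD linD' Au Gu GT DE asym.
pose f (p q : 'rV[R]_m) := p *m G' *m q^T.
have fC p q : f p q = f q p.
  have -> : f p q = (f p q)^T by apply/matrixP => i j; rewrite !ord1 [RHS]mxE.
  by rewrite /f !trmx_mul trmxK GT mulmxA.
have Mu : G' *m A^T \in unitmx by rewrite unitmx_mul Gu unitmx_tr.
apply: (can_inj (mulmxK Mu)).
have Wu : A *m G' *m A^T \in unitmx by rewrite !unitmx_mul Au Gu unitmx_tr.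
have -> : koszul D u v *m invmx (A *m G' *m A^T) *m A *m (G' *m A^T) = koszul D u v.
  by rewrite -(mulmxA _ A) (mulmxA A G') mulmxKV.
rewrite mulmxDl (mulmxA (koszul D' _ _ *m _)) mulmxKV//.
suff H w : koszul D u v *m w^T =
    (2 *: (v *m a u) *m (G' *m A^T) + koszul D' (u *m A) (v *m A) *m A^T) *m w^T.
  apply/rowP => k; have /matrixP/(_ 0 0) := H (delta_mx 0 k).
  by rewrite trmx_delta -!colE !mxE.
rewrite koszul_dot// mulmxDl -(mulmxA _ A^T) -trmx_mul koszul_dot//.
have E p q r : p *m D q *m r^T =
    f (p *m a q) (r *m A) + (p *m A) *m D' (q *m A) *m (r *m A)^T
    + f (p *m A) (r *m a q).
  by rewrite DE !mulmxDr !mulmxDl /f !trmx_mul !mulmxA.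
rewrite !E (asym u v) (asym u w) (asym v w).
have -> : 2 *: (u *m a v) *m (G' *m A^T) *m w^T = 2 *: f (u *m a v) (w *m A).
  by rewrite -!scalemxAl /f trmx_mul !mulmxA.
rewrite (fC (v *m A) (u *m a w)).
move: (f (u *m a v) (w *m A)) (f (u *m a w) (v *m A)) (f (u *m A) (v *m a w)).
move=> x y z.
move: (v *m A *m _ *m _) (u *m A *m D' (v *m A) *m _)
      (u *m A *m D' (w *m A) *m _) => p q r.
by apply/matrixP => i j; rewrite !mxE; ring.
Qed.

(** [u] is a single tangent vector and [Y] a field. Half of [koszul] is the Christoffel term with
    its index lowered; on row vectors the index is raised by the inverse of [G] acting on the
    right. *)
Definition levi_civita (G : 'rV[R]_m -> 'M[R]_m) (Y : 'rV[R]_m -> 'rV[R]_m) u x :=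
  'D_u Y x + 2^-1 *: (koszul (fun w => 'D_w G x) u (Y x) *m invmx (G x)).

Lemma derive_linear (W : normedModType R) (F : 'rV[R]_m -> W) x :
  differentiable F x -> linear (fun w => 'D_w F x).
Proof. by move=> dF k v w; rewrite !deriveE// linearP. Qed.

Lemma derive_comp (W : normedModType R) (h : 'rV[R]_m -> 'rV[R]_m)
    (F : 'rV[R]_m -> W) x u :
  differentiable h x -> differentiable F (h x) ->
  'D_u (F \o h) x = 'D_(u *m 'J h x) F (h x).
Proof.
move=> dh dF; rewrite deriveE; last exact: differentiable_comp.
by rewrite diff_comp//= (deriveE _ dF) -deriveEjacobian// (deriveE _ dh).
Qed.

Lemma near_eq_diff (V W : normedModType R) (f g : V -> W) (x v : V) :
  (\near x, f x = g x) -> 'D_v f x = 'D_v g x.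
Proof. by move=> fg; apply: near_eq_derive. Qed.

Lemma Ck_on_jacobian k (U : set 'rV[R]_m) (h : 'rV[R]_m -> 'rV[R]_m) :
  open U -> Ck_on k.+1 U h -> Ck_on k U (fun z => 'J h z).
Proof.
move=> Uo [dh Dh]; apply: Ck_on_mx => // i j.
apply: (Ck_on_eq Uo (f := fun z => ('D_(delta_mx 0 i) h z) 0 j)).
  by move=> z Uz; rewrite (deriveEjacobian _ (dh z Uz)) -rowE mxE.
by apply: Ck_on_coord => //; exact: Dh.
Qed.

(** The second derivative of [h] enters twice, with opposite signs: through the derivative of
    [Y *m 'J h] and through the Koszul term. *)
Lemma levi_civita_transform (U : set 'rV[R]_m) (h : 'rV[R]_m -> 'rV[R]_m)
    (G G' : 'rV[R]_m -> 'M[R]_m) (Y Y' : 'rV[R]_m -> 'rV[R]_m) x u :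
  open U -> U x -> Ck_on 2 U h ->
  (forall z, U z -> G z = 'J h z *m G' (h z) *m ('J h z)^T) ->
  (forall z, U z -> Y z *m 'J h z = Y' (h z)) ->
  differentiable G x -> differentiable Y x ->
  differentiable G' (h x) -> differentiable Y' (h x) ->
  'J h x \in unitmx -> G' (h x) \in unitmx -> (G' (h x))^T = G' (h x) ->
  levi_civita G Y u x *m 'J h x = levi_civita G' Y' (u *m 'J h x) (h x).
Proof.
move=> Uo Ux h2 GE YE dG dY dG' dY' Ju Gu GT.
have [dh Dh] := h2.
have nU : \near x, U x by apply: open_nbhs_nbhs.
have JC : Ck_on 1 U (fun z => 'J h z) by exact: Ck_on_jacobian.
have dJ : differentiable (fun z => 'J h z) x by have [d _] := JC; exact: d.
pose a w := 'D_w (fun z => 'J h z) x.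
have asym w v : v *m a w = w *m a v.
  have E p q : p *m a q = 'D_q ('D_p h) x.
    transitivity ('D_q (fun z => p *m 'J h z) x).
      rewrite (derive_mulmx (F := fun=> p))//.
      by rewrite derive_cst mul0mx add0r.
    apply: near_eq_diff; apply: filterS nU => z Uz.
    by rewrite deriveEjacobian//; exact: dh.
  by rewrite !E; apply: schwarz_rV Uo Ux h2.
have dYE w : 'D_w Y x *m 'J h x + Y x *m a w = 'D_(w *m 'J h x) Y' (h x).
  rewrite -derive_mulmx// -(derive_comp _ (dh x Ux) dY').
  by apply: near_eq_diff; apply: filterS nU => z Uz; exact: YE.
have dGh : differentiable (G' \o h) x by apply: differentiable_comp => //; exact: dh.
have dJT : differentiable (fun z => ('J h z)^T) x by exact: differentiable_trmx.
have dJG : differentiable (fun z => 'J h z *m G' (h z)) x.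
  exact: differentiable_mulmx.
have dGE w : 'D_w G x = a w *m G' (h x) *m ('J h x)^T
    + 'J h x *m 'D_(w *m 'J h x) G' (h x) *m ('J h x)^T
    + 'J h x *m G' (h x) *m (a w)^T.
  transitivity ('D_w (fun z => 'J h z *m G' (h z) *m ('J h z)^T) x).
    by apply: near_eq_diff; apply: filterS nU => z Uz; exact: GE.
  rewrite (derive_mulmx _ dJG dJT) (derive_mulmx _ dJ dGh) mulmxDl.
  by rewrite (derive_trmx _ dJ) (derive_comp _ (dh x Ux) dG').
rewrite /levi_civita mulmxDl -scalemxAl (GE x Ux).
have K := koszul_transform u (Y x) (derive_linear dG) (derive_linear dG') Ju Gu GT
  dGE asym.
rewrite K scalerDr scalerA mulVf ?pnatr_eq0// scale1r addrA -(YE x Ux).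
by rewrite -dYE.
Qed.

End Christoffel.

(** * Jacobians of transition maps and fields in charts *)

Section ChartJacobians.
Variables (R : realType) (m : nat).

Lemma eq_row_mul n (A B : 'M[R]_(m, n)) :
  (forall v : 'rV[R]_m, v *m A = v *m B) -> A = B.
Proof. by move=> AB; apply/row_matrixP => i; rewrite !rowE. Qed.

Lemma near_overlap (T : topologicalType) (c c' : chart R T m) x :
  overlap c c' x -> \forall y \near x, overlap c c' y.
Proof. by move=> cx; apply: open_nbhs_nbhs; split => //; exact: overlap_open. Qed.

Lemma overlap_at (T : topologicalType) (c c' : chart R T m) p :
  chart_dom c p -> chart_dom c' p -> overlap c c' (c p).
Proof.
by move=> cp c'p; split; [exact: chart_funP|rewrite /preimage /= chart_funK].
Qed.

(** The composite of the two transitions agrees with the direct one only where the intermediate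
    chart is defined, that is near [c p]; the chain rule is therefore combined with equality of
    derivatives of locally equal maps. *)
Lemma jacobian_trans (T : topologicalType) (c c' c'' : chart R T m) p :
  chart_dom c p -> chart_dom c' p -> chart_dom c'' p ->
  differentiable (c' \o chart_inv c) (c p) ->
  differentiable (c'' \o chart_inv c') (c' p) ->
  'J (c'' \o chart_inv c) (c p) =
  'J (c' \o chart_inv c) (c p) *m 'J (c'' \o chart_inv c') (c' p).
Proof.
move=> cp c'p c''p d1 d2.
have e1 : (c' \o chart_inv c) (c p) = c' p by rewrite /= chart_funK.
have E : \forall y \near c p,
    ((c'' \o chart_inv c') \o (c' \o chart_inv c)) y = (c'' \o chart_inv c) y.
  apply: filterS (near_overlap (overlap_at cp c'p)) => y [_ c'y].
  by rewrite /= chart_funK.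
have d2' : differentiable (c'' \o chart_inv c') ((c' \o chart_inv c) (c p)).
  by rewrite e1.
have d3 : differentiable (c'' \o chart_inv c) (c p).
  apply: near_differentiable E _; exact: differentiable_comp.
apply: eq_row_mul => v; rewrite -(deriveEjacobian _ d3) -(near_eq_diff v E).
by rewrite (derive_comp v d1 d2') e1 (deriveEjacobian _ d2) mulmxA.
Qed.

Lemma jacobian_id (T : topologicalType) (c : chart R T m) p :
  chart_dom c p -> 'J (c \o chart_inv c) (c p) = 1%:M.
Proof.
move=> cp; have E : \forall y \near c p, id y = (c \o chart_inv c) y.
  apply: filterS (near_overlap (overlap_at cp cp)) => y [cy _].
  by rewrite /= chart_invK.
have d : differentiable (c \o chart_inv c) (c p).
  by apply: near_differentiable E _; exact: ex_diff.
apply: eq_row_mul => v; rewrite -(deriveEjacobian _ d) -(near_eq_diff v E).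
by rewrite derive_id mulmx1.
Qed.

Lemma compatible_differentiable (T : topologicalType) (c c' : chart R T m) p :
  compatible c c' -> chart_dom c p -> chart_dom c' p ->
  differentiable (c' \o chart_inv c) (c p).
Proof. by move=> [/(_ 1%N)[d _] _] cp c'p; apply: d; exact: overlap_at. Qed.

Lemma compatible_sym (T : topologicalType) (c c' : chart R T m) :
  compatible c c' -> compatible c' c.
Proof. by case. Qed.

Variable M : manifold R m.

(* Charts of the smooth structure that need not belong to the atlas. *)
Definition smooth_chart (c : chart R M m) : Prop :=
  forall c', atlas M c' -> compatible c c'.

Lemma atlas_smooth_chart c : atlas M c -> smooth_chart c.
Proof. by move=> Ac c' Ac'; exact: atlas_compatible. Qed.

(** Every transition factors through the chart selected at [p], so that all coordinate changes are
    expressed by [of_chart] and [to_chart], which are inverse to each other for a given chart. *)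
Lemma jacobian_to_of c c' p : smooth_chart c -> smooth_chart c' ->
  chart_dom c p -> chart_dom c' p ->
  'J (c' \o chart_inv c) (c p) = of_chart c p *m to_chart c' p.
Proof.
move=> cs cs' cp c'p; have Ap := chart_at_atlas p.
apply: jacobian_trans => //; first exact: chart_at_dom.
  by apply: compatible_differentiable (cs _ Ap) _ _ => //; exact: chart_at_dom.
apply: compatible_differentiable (compatible_sym (cs' _ Ap)) _ _ => //.
exact: chart_at_dom.
Qed.

Lemma of_to_chart c p : smooth_chart c -> chart_dom c p ->
  of_chart c p *m to_chart c p = 1%:M.
Proof. by move=> cs cp; rewrite -jacobian_to_of// jacobian_id. Qed.

Lemma to_of_chart c p : smooth_chart c -> chart_dom c p ->
  to_chart c p *m of_chart c p = 1%:M.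
Proof. by move=> cs cp; apply: mulmx1C; exact: of_to_chart. Qed.

Lemma to_chart_at (p : M) : to_chart (chart_at p) p = 1%:M.
Proof. by rewrite /to_chart jacobian_id//; exact: chart_at_dom. Qed.

Lemma of_chart_at (p : M) : of_chart (chart_at p) p = 1%:M.
Proof. by rewrite /of_chart jacobian_id//; exact: chart_at_dom. Qed.

Lemma of_chart_unit c p : smooth_chart c -> chart_dom c p -> of_chart c p \in unitmx.
Proof. by move=> cs cp; exact: (mulmx1_unit (of_to_chart cs cp)).1. Qed.

Lemma to_chart_unit c p : smooth_chart c -> chart_dom c p -> to_chart c p \in unitmx.
Proof. by move=> cs cp; exact: (mulmx1_unit (to_of_chart cs cp)).1. Qed.

Definition vec_in (c : chart R M m) (X : vfield M) : 'rV[R]_m -> 'rV[R]_m :=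
  fun x => X (chart_inv c x) *m to_chart c (chart_inv c x).
Definition form1_in (c : chart R M m) (eta : form1 M) : 'rV[R]_m -> 'cV[R]_m :=
  fun x => of_chart c (chart_inv c x) *m eta (chart_inv c x).
Definition tensor11_in (c : chart R M m) (th : tensor11 M) : 'rV[R]_m -> 'M[R]_m :=
  fun x => of_chart c (chart_inv c x) *m th (chart_inv c x)
           *m to_chart c (chart_inv c x).
Definition tensor02_in (c : chart R M m) (g : tensor02 M) : 'rV[R]_m -> 'M[R]_m :=
  fun x => of_chart c (chart_inv c x) *m g (chart_inv c x)
           *m (of_chart c (chart_inv c x))^T.

Lemma smooth_vfieldP X k c : smooth_vfield X -> atlas M c ->
  Ck_on k (chart_cod c) (vec_in c X).
Proof. by move=> sX Ac; exact: (sX c Ac k). Qed.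

Lemma smooth_form1P eta k c : smooth_form1 eta -> atlas M c ->
  Ck_on k (chart_cod c) (form1_in c eta).
Proof. by move=> sX Ac; exact: (sX c Ac k). Qed.

Lemma smooth_tensor11P th k c : smooth_tensor11 th -> atlas M c ->
  Ck_on k (chart_cod c) (tensor11_in c th).
Proof. by move=> sX Ac; exact: (sX c Ac k). Qed.

Lemma smooth_tensor02P g k c : smooth_tensor02 g -> atlas M c ->
  Ck_on k (chart_cod c) (tensor02_in c g).
Proof. by move=> sX Ac; exact: (sX c Ac k). Qed.

Section FieldOperations.
Implicit Types (th : tensor11 M) (X Y : vfield M) (g : tensor02 M).

Lemma smooth_tensor11M th th' : smooth_tensor11 th -> smooth_tensor11 th' ->
  smooth_tensor11 (fun p => th p *m th' p).
Proof.
move=> s s' c Ac k; have Uo := @chart_cod_open _ _ _ c.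
apply: (Ck_on_eq Uo) (Ck_on_mulmx Uo (smooth_tensor11P k s Ac)
  (smooth_tensor11P k s' Ac)) => x cx.
rewrite /tensor11_in /=; have := to_of_chart (atlas_smooth_chart Ac) (chart_invP cx).
move: (to_chart c _) (of_chart c _) => A B AB.
by rewrite !mulmxA -(mulmxA _ A B) AB mulmx1.
Qed.

Lemma smooth_tensor11D th th' : smooth_tensor11 th -> smooth_tensor11 th' ->
  smooth_tensor11 (fun p => th p + th' p).
Proof.
move=> s s' c Ac k; have Uo := @chart_cod_open _ _ _ c.
apply: (Ck_on_eq Uo) (Ck_on_add Uo (smooth_tensor11P k s Ac)
  (smooth_tensor11P k s' Ac)) => x cx.
by rewrite /tensor11_in /= mulmxDr mulmxDl.
Qed.

Lemma smooth_tensor11N th : smooth_tensor11 th ->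
  smooth_tensor11 (fun p => - th p).
Proof.
move=> s c Ac k; have Uo := @chart_cod_open _ _ _ c.
apply: (Ck_on_eq Uo) (Ck_onN Uo (smooth_tensor11P k s Ac)) => x cx.
by rewrite /tensor11_in /= mulmxN mulNmx.
Qed.

Lemma smooth_tensor11_id : smooth_tensor11 (fun _ : M => 1%:M).
Proof.
move=> c Ac k; have Uo := @chart_cod_open _ _ _ c.
apply: (Ck_on_eq Uo) (Ck_on_cst k (chart_cod c) 1%:M) => x cx /=.
by rewrite mulmx1 (of_to_chart (atlas_smooth_chart Ac) (chart_invP cx)).
Qed.

Lemma smooth_apply11 th X : smooth_tensor11 th -> smooth_vfield X ->
  smooth_vfield (apply11 th X).
Proof.
move=> s s' c Ac k; have Uo := @chart_cod_open _ _ _ c.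
apply: (Ck_on_eq Uo) (Ck_on_mulmx Uo (smooth_vfieldP k s' Ac)
  (smooth_tensor11P k s Ac)) => x cx.
rewrite /tensor11_in /vec_in /apply11 /ev11 /=.
have := to_of_chart (atlas_smooth_chart Ac) (chart_invP cx).
move: (to_chart c _) (of_chart c _) => A B AB.
by rewrite !mulmxA -(mulmxA _ A B) AB mulmx1.
Qed.

Lemma smooth_vfieldD X Y : smooth_vfield X -> smooth_vfield Y ->
  smooth_vfield (fun p => X p + Y p).
Proof.
move=> s s' c Ac k; have Uo := @chart_cod_open _ _ _ c.
apply: (Ck_on_eq Uo) (Ck_on_add Uo (smooth_vfieldP k s Ac)
  (smooth_vfieldP k s' Ac)) => x cx.
by rewrite /vec_in /= mulmxDl.
Qed.

Lemma smooth_vfieldN X : smooth_vfield X -> smooth_vfield (fun p => - X p).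
Proof.
move=> s c Ac k; have Uo := @chart_cod_open _ _ _ c.
apply: (Ck_on_eq Uo) (Ck_onN Uo (smooth_vfieldP k s Ac)) => x cx.
by rewrite /vec_in /= mulNmx.
Qed.

Lemma smooth_vfieldZ (f : M -> R) X : smooth_fun f -> smooth_vfield X ->
  smooth_vfield (fun p => f p *: X p).
Proof.
move=> s s' c Ac k; have Uo := @chart_cod_open _ _ _ c.
apply: (Ck_on_eq Uo) (Ck_on_scale Uo (s c Ac k) (smooth_vfieldP k s' Ac)) => x cx.
by rewrite /vec_in /= scalemxAl.
Qed.

Lemma smooth_fun_cst (a : R) : smooth_fun (fun _ : M => a).
Proof. by move=> c Ac k; exact: Ck_on_cst. Qed.

End FieldOperations.

End ChartJacobians.

(** * Connection rules and metric compatibility in coordinates *)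

Section LocalLeviCivita.
Variables (R : realType) (m : nat).
Implicit Types (u v w x : 'rV[R]_m) (G : 'rV[R]_m -> 'M[R]_m).

Lemma koszul_linearl (D : 'rV[R]_m -> 'M[R]_m) k u u' v : linear D ->
  koszul D (k *: u + u') v = k *: koszul D u v + koszul D u' v.
Proof.
move=> linD; rewrite /koszul linD !mulmxDl !mulmxDr -!scalemxAl -scalemxAr.
rewrite !scalerBr !scalerDr.
pose r w := \row_k (w *m D (delta_mx 0 k) *m v^T) 0 0.
have rE w i : r w 0 i = (w *m D (delta_mx 0 i) *m v^T) 0 0 by rewrite [LHS]mxE.
rewrite -/(r _) -/(r u) -/(r u').
have -> : r (k *: u + u') = k *: r u + r u'.
  apply/rowP => i; rewrite [RHS]mxE [X in _ = X + _]mxE !rE !mulmxDl -!scalemxAl.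
  by rewrite [LHS]mxE [X in X + _ = _]mxE.
by rewrite opprD [X in X + _]addrACA [LHS]addrACA.
Qed.

Lemma koszul_linearr (D : 'rV[R]_m -> 'M[R]_m) k u v v' : linear D ->
  koszul D u (k *: v + v') = k *: koszul D u v + koszul D u v'.
Proof.
move=> linD; rewrite /koszul linD !mulmxDl !mulmxDr -!scalemxAl -scalemxAr.
rewrite !scalerBr !scalerDr.
pose r w := \row_k (u *m D (delta_mx 0 k) *m w^T) 0 0.
have rE w i : r w 0 i = (u *m D (delta_mx 0 i) *m w^T) 0 0 by rewrite [LHS]mxE.
rewrite -/(r _) -/(r v) -/(r v').
have -> : r (k *: v + v') = k *: r v + r v'.
  apply/rowP => i; rewrite [RHS]mxE [X in _ = X + _]mxE !rE linearP /= mulmxDr.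
  by rewrite -!scalemxAr [LHS]mxE [X in X + _ = _]mxE.
by rewrite opprD [X in X + _]addrACA [LHS]addrACA.
Qed.

Lemma levi_civita_linearl G (Y : 'rV[R]_m -> 'rV[R]_m) k u u' x :
  differentiable G x -> differentiable Y x ->
  levi_civita G Y (k *: u + u') x =
  k *: levi_civita G Y u x + levi_civita G Y u' x.
Proof.
move=> dG dY; rewrite /levi_civita (derive_linear dY).
rewrite (koszul_linearl _ _ _ _ (derive_linear dG)) mulmxDl -scalemxAl.
move: ('D_u Y x) ('D_u' Y x) (koszul _ _ _ *m _) (koszul _ u' _ *m _) => a b c d.
by rewrite !scalerDr !scalerA (mulrC k) addrACA.
Qed.

Lemma levi_civitaD G (Y Y' : 'rV[R]_m -> 'rV[R]_m) u x :
  differentiable G x -> differentiable Y x -> differentiable Y' x ->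
  levi_civita G (fun z => Y z + Y' z) u x =
  levi_civita G Y u x + levi_civita G Y' u x.
Proof.
move=> dG dY dY'; rewrite /levi_civita.
have -> : 'D_u (fun z => Y z + Y' z) x = 'D_u Y x + 'D_u Y' x.
  exact: deriveD (diff_derivable dY) (diff_derivable dY').
have := koszul_linearr 1 u (Y x) (Y' x) (derive_linear dG).
by rewrite !scale1r => ->; rewrite mulmxDl scalerDr addrACA.
Qed.

Lemma differentiable_scale n p (f : 'rV[R]_m -> R) (F : 'rV[R]_m -> 'M[R]_(n, p)) x :
  differentiable f x -> differentiable F x ->
  differentiable (fun z => f z *: F z) x.
Proof.
move=> df dF; apply: differentiable_mx => i j.
under eq_fun do rewrite mxE.
by apply: differentiableM => //; exact: differentiable_entry.
Qed.

Lemma derive_scale n p (f : 'rV[R]_m -> R) (F : 'rV[R]_m -> 'M[R]_(n, p)) x u :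
  differentiable f x -> differentiable F x ->
  'D_u (fun z => f z *: F z) x = 'D_u f x *: F x + f x *: 'D_u F x.
Proof.
move=> df dF; apply/matrixP => i j.
rewrite (derive_entry _ _ _ (differentiable_scale df dF)).
under eq_fun do rewrite mxE.
have dFe := differentiable_entry i j dF.
rewrite (deriveM (diff_derivable df) (diff_derivable dFe)).
by rewrite !mxE (derive_entry _ _ _ dF) addrC; congr (_ + _); rewrite mulrC.
Qed.

Lemma levi_civitaZ G (f : 'rV[R]_m -> R) (Y : 'rV[R]_m -> 'rV[R]_m) u x :
  differentiable G x -> differentiable f x -> differentiable Y x ->
  levi_civita G (fun z => f z *: Y z) u x =
  'D_u f x *: Y x + f x *: levi_civita G Y u x.
Proof.
move=> dG df dY; rewrite /levi_civita (derive_scale u df dY).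
have := koszul_linearr (f x) u (Y x) 0 (derive_linear dG).
have -> : koszul (fun w => 'D_w G x) u 0 = 0.
  have := koszul_linearr (-1) u 0 0 (derive_linear dG).
  by rewrite scaler0 addr0 scaleN1r addNr.
rewrite !addr0 => ->.
by rewrite -scalemxAl !scalerDr !scalerA (mulrC (f x)) addrA.
Qed.

(** After lowering, the Koszul terms for [X] and for [Y] are c + d - e and c + e - d, where c is the
    derivative of [G] paired with both fields; their half sum is c. *)
Lemma levi_civita_metric G (X Y : 'rV[R]_m -> 'rV[R]_m) u x :
  (\forall z \near x, (G z)^T = G z) -> G x \in unitmx ->
  differentiable G x -> differentiable X x -> differentiable Y x ->
  'D_u (fun z => X z *m G z *m (Y z)^T) x =
  levi_civita G X u x *m G x *m (Y x)^T + X x *m G x *m (levi_civita G Y u x)^T.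
Proof.
move=> GT Gu dG dX dY.
have halves (a b c d e : 'M[R]_1) : a + c + b =
    a + 2^-1 *: (c + d - e) + (b + 2^-1 *: (c + e - d)).
  by apply/matrixP => i j; rewrite !mxE; field.
have dGT w : ('D_w G x)^T = 'D_w G x.
  by rewrite -(derive_trmx _ dG); apply: near_eq_diff.
have G0 := nbhs_singleton GT.
have dXG := differentiable_mulmx dX dG.
rewrite (derive_mulmx _ dXG (differentiable_trmx dY)) (derive_mulmx _ dX dG).
rewrite (derive_trmx _ dY) /levi_civita.
set K := fun w => 'D_w G x; pose r := X x; pose s := Y x.
have K1 : koszul K u r *m s^T = r *m K u *m s^T + u *m K r *m s^T - u *m K s *m r^T.
  exact: koszul_dot (derive_linear dG).
have K2 : r *m (koszul K u s)^T = r *m K u *m s^T + u *m K s *m r^T - u *m K r *m s^T.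
  have -> : r *m (koszul K u s)^T = (koszul K u s *m r^T)^T.
    by rewrite trmx_mul trmxK.
  rewrite (koszul_dot _ _ _ (derive_linear dG)) linearB linearD /=.
  congr (_ + _ - _); first by rewrite !trmx_mul trmxK dGT mulmxA.
    by apply/matrixP => i j; rewrite !ord1 [LHS]mxE.
  by apply/matrixP => i j; rewrite !ord1 [LHS]mxE.
have H1 : ('D_u X x + 2^-1 *: (koszul K u r *m invmx (G x))) *m G x *m s^T =
    'D_u X x *m G x *m s^T + 2^-1 *: (koszul K u r *m s^T).
  by rewrite mulmxDl -scalemxAl (mulmxKV Gu) mulmxDl -scalemxAl.
have H2 : r *m G x *m ('D_u Y x + 2^-1 *: (koszul K u s *m invmx (G x)))^T =
    r *m G x *m ('D_u Y x)^T + 2^-1 *: (r *m (koszul K u s)^T).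
  move: ('D_u Y x) (koszul K u s) => a b.
  rewrite linearD linearZ /= trmx_mul trmx_inv G0 mulmxDr -scalemxAr mulmxA.
  by rewrite (mulmxK Gu).
rewrite -/(K u) -/r -/s H1 H2 K1 K2 mulmxDl.
exact: halves.
Qed.

Lemma Ck_on_levi_civita k (U : set 'rV[R]_m) G (Y v : 'rV[R]_m -> 'rV[R]_m) :
  open U -> (forall x, U x -> G x \in unitmx) ->
  Ck_on k.+1 U G -> Ck_on k.+1 U Y -> Ck_on k U v ->
  Ck_on k U (fun x => levi_civita G Y (v x) x).
Proof.
move=> Uo Gu HG HY Hv.
have HYk := Ck_onW HY.
apply: (Ck_on_add Uo); first exact: Ck_on_derive.
apply: (Ck_on_scale Uo); first exact: Ck_on_cst.
apply: (Ck_on_mulmx Uo); last by apply: Ck_on_invmx => //; exact: Ck_onW.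
apply: (Ck_on_add Uo).
  apply: (Ck_on_add Uo); apply: (Ck_on_mulmx Uo) => //; exact: Ck_on_derive.
apply: (Ck_onN Uo); apply: (Ck_on_mx Uo) => i j.
apply: (Ck_on_eq Uo (f := fun x => (v x *m 'D_(delta_mx 0 j) G x *m (Y x)^T) 0 0)).
  by move=> x _; rewrite [RHS]mxE.
apply: (Ck_on_coord _ _ Uo); apply: (Ck_on_mulmx Uo).
  by apply: (Ck_on_mulmx Uo) => //; have [_ h] := HG; exact: h.
exact: Ck_on_trmx.
Qed.

End LocalLeviCivita.

(** * The global metric connection *)

Section MetricConnection.
Variables (R : realType) (m : nat) (M : manifold R m).
Implicit Types (g : tensor02 M) (X Y : vfield M) (c : chart R M m) (p : M).

Section Points.
Variables (c : chart R M m) (p : M).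
Hypothesis cp : chart_dom c p.

Lemma vec_in_at (X : vfield M) : vec_in c X (c p) = X p *m to_chart c p.
Proof. by rewrite /vec_in chart_funK. Qed.

Lemma tensor02_in_at (g : tensor02 M) :
  tensor02_in c g (c p) = of_chart c p *m g p *m (of_chart c p)^T.
Proof. by rewrite /tensor02_in chart_funK. Qed.

End Points.

Lemma ev02_matrix (g : tensor02 M) p u v : u *m g p *m v^T = (ev02 g p u v)%:M.
Proof. by rewrite [LHS]mx11_scalar. Qed.

Lemma bilinear_form_inj (A B : 'M[R]_m) :
  (forall u v : 'rV[R]_m, u *m A *m v^T = u *m B *m v^T) -> A = B.
Proof.
move=> AB; apply/matrixP => i j.
have /matrixP/(_ 0 0) := AB (delta_mx 0 i) (delta_mx 0 j).
by rewrite -!rowE trmx_delta -!colE !mxE.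
Qed.

Lemma metric_sym g p : riemannian_metric g -> (g p : 'M[R]_m)^T = g p.
Proof.
move=> [_ gsym _]; apply: bilinear_form_inj => u v.
rewrite ev02_matrix gsym -ev02_matrix.
have -> : u *m (g p)^T *m v^T = (v *m g p *m u^T)^T.
  by rewrite !trmx_mul trmxK mulmxA.
by apply/matrixP => i j; rewrite !ord1 [LHS]mxE.
Qed.

Lemma metric_posdef g p : riemannian_metric g -> posdef (g p : 'M[R]_m).
Proof. by move=> [_ _ g0] v v0; exact: g0. Qed.

Lemma tensor02_in_sym g c x : riemannian_metric g ->
  (tensor02_in c g x)^T = tensor02_in c g x.
Proof.
move=> gr; have := metric_sym (chart_inv c x) gr; rewrite /tensor02_in.
by move: (of_chart _ _) (g _) => A B BT; rewrite !trmx_mul trmxK BT mulmxA.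
Qed.

Lemma tensor02_in_posdef g c x : riemannian_metric g -> smooth_chart c ->
  chart_cod c x -> posdef (tensor02_in c g x).
Proof.
move=> gr cs cx; apply: posdef_congr; last exact: metric_posdef.
exact: of_chart_unit cs (chart_invP cx).
Qed.

Lemma near_cod (c : chart R M m) x : chart_cod c x -> \forall y \near x, chart_cod c y.
Proof. by move=> cx; apply: open_nbhs_nbhs; split => //; exact: chart_cod_open. Qed.

Lemma vec_in_differentiable X c x : smooth_vfield X -> atlas M c ->
  chart_cod c x -> differentiable (vec_in c X) x.
Proof. by move=> sX Ac; have [d _] := smooth_vfieldP 1 sX Ac; exact: d. Qed.

Lemma tensor02_in_differentiable g c x : riemannian_metric g -> atlas M c ->
  chart_cod c x -> differentiable (tensor02_in c g) x.
Proof. by move=> [sg _ _] Ac; have [d _] := smooth_tensor02P 1 sg Ac; exact: d. Qed.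

Lemma fun_in_differentiable (f : M -> R) c x : smooth_fun f -> atlas M c ->
  chart_cod c x -> differentiable (f \o chart_inv c) x.
Proof. by move=> sf Ac; have [d _] := sf c Ac 1%N; exact: d. Qed.

Variable g : tensor02 M.
Hypothesis gr : riemannian_metric g.

(** The selected chart varies arbitrarily with [p], so this pointwise formula shows no regularity.
    By the transformation law it agrees with the same formula in any fixed chart of the atlas, where
    smoothness is visible. *)
Definition lc_connection (X Y : vfield M) : vfield M := fun p =>
  levi_civita (tensor02_in (chart_at p) g) (vec_in (chart_at p) Y) (X p)
              (chart_at p p).

Lemma lc_connection_in c X Y p : smooth_vfield Y -> atlas M c -> chart_dom c p ->
  lc_connection X Y p *m to_chart c p =
  levi_civita (tensor02_in c g) (vec_in c Y) (X p *m to_chart c p) (c p).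
Proof.
move=> sY Ac cp; pose c0 := chart_at p.
have A0 : atlas M c0 by exact: chart_at_atlas.
have c0p : chart_dom c0 p by exact: chart_at_dom.
have cs := atlas_smooth_chart Ac; have cs0 := atlas_smooth_chart A0.
pose h := c \o chart_inv c0.
have hx : h (c0 p) = c p by rewrite /h /= chart_funK.
have J0 : 'J h (c0 p) = to_chart c p by [].
have JE z : overlap c0 c z -> 'J h z =
    of_chart c0 (chart_inv c0 z) *m to_chart c (chart_inv c0 z).
  move=> [c0z cz]; have E := jacobian_to_of cs0 cs (chart_invP c0z) cz.
  have zE := chart_invK c0z.
  exact: etrans (congr1 (fun y => 'J h y) (esym zE)) E.
suff T : levi_civita (tensor02_in c0 g) (vec_in c0 Y) (X p) (c0 p) *m 'J h (c0 p) =
    levi_civita (tensor02_in c g) (vec_in c Y) (X p *m 'J h (c0 p)) (h (c0 p)).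
  by rewrite hx in T; exact: T.
apply: (@levi_civita_transform _ _ (overlap c0 c) h (tensor02_in c0 g)
  (tensor02_in c g) (vec_in c0 Y) (vec_in c Y)).
- exact: overlap_open.
- exact: overlap_at.
- exact: (atlas_compatible A0 Ac).1.
- move=> z oz; rewrite (JE z oz); have [c0z cz] := oz.
  rewrite /tensor02_in /h /= (chart_funK cz).
  have := to_of_chart cs cz.
  move: (to_chart c _) (of_chart c _) (of_chart c0 _) (g _) => A B C G AB.
  have BA : B^T *m A^T = 1%:M by rewrite -trmx_mul AB trmx1.
  rewrite !trmx_mul !mulmxA -(mulmxA C A) AB mulmx1.
  by rewrite -(mulmxA _ (B^T)) BA mulmx1.
- move=> z oz; rewrite (JE z oz); have [c0z cz] := oz.
  rewrite /vec_in /h /= (chart_funK cz).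
  have := to_of_chart cs0 (chart_invP c0z).
  move: (to_chart c0 _) (of_chart c0 _) (to_chart c _) => A B C AB.
  by rewrite mulmxA -(mulmxA _ A) AB mulmx1.
- by apply: tensor02_in_differentiable => //; exact: chart_funP.
- by apply: vec_in_differentiable => //; exact: chart_funP.
- by rewrite hx; apply: tensor02_in_differentiable => //; exact: chart_funP.
- by rewrite hx; apply: vec_in_differentiable => //; exact: chart_funP.
- rewrite J0; exact: to_chart_unit.
- by rewrite hx; apply/posdef_unit/tensor02_in_posdef => //; exact: chart_funP.
- exact: tensor02_in_sym.
Qed.

Lemma lc_connection_smooth X Y : smooth_vfield X -> smooth_vfield Y ->
  smooth_vfield (lc_connection X Y).
Proof.
move=> sX sY c Ac k; have Uo := @chart_cod_open _ _ _ c.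
apply: (Ck_on_eq Uo (f := fun x =>
    levi_civita (tensor02_in c g) (vec_in c Y) (vec_in c X x) x)).
  move=> x cx /=; rewrite (lc_connection_in X sY Ac (chart_invP cx)).
  by rewrite (chart_invK cx).
apply: (Ck_on_levi_civita Uo).
- move=> x cx; apply/posdef_unit/tensor02_in_posdef => //.
  exact: atlas_smooth_chart.
- by have [sg _ _] := gr; exact: smooth_tensor02P.
- exact: smooth_vfieldP.
- exact: smooth_vfieldP.
Qed.

Section AtPoint.
Variable p : M.
Let c0 := chart_at p.
Let A0 : atlas M c0 := chart_at_atlas p.
Let c0p : chart_dom c0 p := chart_at_dom p.
Let cod0 : chart_cod c0 (c0 p) := chart_funP c0p.

Let vec_at X : vec_in c0 X (c0 p) = X p.
Proof. by rewrite (vec_in_at c0p) to_chart_at mulmx1. Qed.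

Let dG : differentiable (tensor02_in c0 g) (c0 p).
Proof. exact: tensor02_in_differentiable. Qed.

Let dV X : smooth_vfield X -> differentiable (vec_in c0 X) (c0 p).
Proof. by move=> sX; exact: vec_in_differentiable. Qed.

Lemma dirderE (X : vfield M) f : smooth_fun f ->
  dirder X f p = 'D_(X p) (f \o chart_inv c0) (c0 p).
Proof.
by move=> sf; rewrite (deriveE _ (fun_in_differentiable sf A0 cod0)).
Qed.

Lemma lc_connection_linearl (f : M -> R) X X' Y : smooth_vfield Y ->
  lc_connection (fun q => f q *: X q + X' q) Y p =
  f p *: lc_connection X Y p + lc_connection X' Y p.
Proof. by move=> sY; exact: levi_civita_linearl dG (dV sY). Qed.

Lemma lc_connectionD X Y Y' : smooth_vfield Y -> smooth_vfield Y' ->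
  lc_connection X (fun q => Y q + Y' q) p =
  lc_connection X Y p + lc_connection X Y' p.
Proof.
move=> sY sY'; have E : vec_in c0 (fun q => Y q + Y' q) =
    (fun z => vec_in c0 Y z + vec_in c0 Y' z).
  by apply/funext => x; exact: mulmxDl.
apply: etrans (levi_civitaD _ dG (dV sY) (dV sY')).
by rewrite -E.
Qed.

Lemma lc_connectionZ f X Y : smooth_fun f -> smooth_vfield Y ->
  lc_connection X (fun q => f q *: Y q) p =
  dirder X f p *: Y p + f p *: lc_connection X Y p.
Proof.
move=> sf sY; have df := fun_in_differentiable sf A0 cod0.
have E : vec_in c0 (fun q => f q *: Y q) =
    (fun z => (f \o chart_inv c0) z *: vec_in c0 Y z).
  by apply/funext => x; exact/esym/scalemxAl.
have := levi_civitaZ (X p) dG df (dV sY).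
rewrite (dirderE X sf) vec_at /= (chart_funK c0p) => T; apply: etrans _ T.
by rewrite -E.
Qed.

Lemma lc_connection_metric X Y Z :
  smooth_vfield X -> smooth_vfield Y -> smooth_vfield Z ->
  dirder Z (fun q => ev02 g q (X q) (Y q)) p =
  ev02 g p (lc_connection Z X p) (Y p) + ev02 g p (X p) (lc_connection Z Y p).
Proof.
move=> sX sY sZ.
have GT : \forall z \near c0 p, (tensor02_in c0 g z)^T = tensor02_in c0 g z.
  by apply: filterS (near_cod cod0) => z _; exact: tensor02_in_sym.
have Gu : tensor02_in c0 g (c0 p) \in unitmx.
  apply/posdef_unit/tensor02_in_posdef => //; exact: atlas_smooth_chart.
have := levi_civita_metric (Z p) GT Gu dG (dV sX) (dV sY).
rewrite !vec_at (tensor02_in_at c0p) of_chart_at trmx1 mulmx1 mul1mx.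
move=> /(congr1 (fun B : 'M[R]_1 => B 0 0)).
rewrite [RHS]mxE => <-.
have dXGY : differentiable (fun z => vec_in c0 X z *m tensor02_in c0 g z
    *m (vec_in c0 Y z)^T) (c0 p).
  apply: differentiable_mulmx.
    by apply: differentiable_mulmx; [exact: dV|exact: dG].
  by apply: differentiable_trmx; exact: dV.
have E : \forall z \near c0 p, (vec_in c0 X z *m tensor02_in c0 g z
    *m (vec_in c0 Y z)^T) 0 0 =
    ((fun q => ev02 g q (X q) (Y q)) \o chart_inv c0) z.
  apply: filterS (near_cod cod0) => z cz; rewrite /ev02 /=.
  have := to_of_chart (atlas_smooth_chart A0) (chart_invP cz).
  rewrite /vec_in /tensor02_in.
  move: (to_chart c0 _) (of_chart c0 _) (g _) (X _) (Y _) => A B G x y AB.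
  have BA : B^T *m A^T = 1%:M by rewrite -trmx_mul AB trmx1.
  by rewrite !trmx_mul !mulmxA -(mulmxA x A) AB mulmx1 -(mulmxA _ (B^T)) BA mulmx1.
rewrite (derive_entry _ _ _ dXGY) (near_eq_diff _ E) deriveE//.
exact: near_differentiable E (differentiable_entry 0 0 dXGY).
Qed.

End AtPoint.

Lemma metric_connection_exists :
  exists2 D : vfield M -> vfield M -> vfield M, affine_connection D & self_dual g D.
Proof.
exists lc_connection; last by move=> X Y Z sX sY sZ p; exact: lc_connection_metric.
split.
- exact: lc_connection_smooth.
- by move=> f X X' Y _ _ _ sY p; exact: lc_connection_linearl.
- by move=> X Y Y' _ sY sY' p; exact: lc_connectionD.
- by move=> f X Y sf _ sY p; exact: lc_connectionZ.
Qed.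

End MetricConnection.

(** * Connections preserving a skew field *)

Section ParallelConnection.
Variables (R : realType) (m : nat) (M : manifold R m).
Implicit Types (g : tensor02 M) (X Y Z : vfield M).

Lemma ev02_in g X Y c x : atlas M c -> chart_cod c x ->
  ev02 g (chart_inv c x) (X (chart_inv c x)) (Y (chart_inv c x)) =
  (vec_in c X x *m tensor02_in c g x *m (vec_in c Y x)^T) 0 0.
Proof.
move=> Ac cx; rewrite /ev02 /vec_in /tensor02_in.
have := to_of_chart (atlas_smooth_chart Ac) (chart_invP cx).
move: (to_chart c _) (of_chart c _) (g _) (X _) (Y _) => A B G u v AB.
have BA : B^T *m A^T = 1%:M by rewrite -trmx_mul AB trmx1.
by rewrite !trmx_mul !mulmxA -(mulmxA u A) AB mulmx1 -(mulmxA _ (B^T)) BA mulmx1.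
Qed.

Lemma smooth_ev02 g X Y : smooth_tensor02 g -> smooth_vfield X -> smooth_vfield Y ->
  smooth_fun (fun q => ev02 g q (X q) (Y q)).
Proof.
move=> sg sX sY c Ac k; have Uo := @chart_cod_open _ _ _ c.
apply: (Ck_on_eq Uo (f := fun x =>
    (vec_in c X x *m tensor02_in c g x *m (vec_in c Y x)^T) 0 0)).
  by move=> x cx; rewrite -ev02_in.
apply: (Ck_on_coord _ _ Uo); apply: (Ck_on_mulmx Uo).
  by apply: (Ck_on_mulmx Uo); [exact: smooth_vfieldP|exact: smooth_tensor02P].
by apply: (Ck_on_trmx Uo); exact: smooth_vfieldP.
Qed.

Lemma dirderD Z (f f' : M -> R) p : smooth_fun f -> smooth_fun f' ->
  dirder Z (fun q => f q + f' q) p = dirder Z f p + dirder Z f' p.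
Proof.
move=> sf sf'; have A0 := chart_at_atlas p.
have c0 := chart_funP (chart_at_dom p).
rewrite /dirder; have -> : (fun q => f q + f' q) \o chart_inv (chart_at p) =
    (f \o chart_inv (chart_at p)) + (f' \o chart_inv (chart_at p)) by [].
by rewrite (diffD (fun_in_differentiable sf A0 c0) (fun_in_differentiable sf' A0 c0)).
Qed.

Lemma dirderZ Z (a : R) (f : M -> R) p : smooth_fun f ->
  dirder Z (fun q => a * f q) p = a * dirder Z f p.
Proof.
move=> sf; have A0 := chart_at_atlas p.
have c0 := chart_funP (chart_at_dom p).
rewrite /dirder.
have -> : (fun q => a * f q) \o chart_inv (chart_at p) =
    a \*: (f \o chart_inv (chart_at p)) by [].
by rewrite (diffZ _ (fun_in_differentiable sf A0 c0)).
Qed.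

Lemma smooth_funD (f f' : M -> R) : smooth_fun f -> smooth_fun f' ->
  smooth_fun (fun q => f q + f' q).
Proof.
move=> sf sf' c Ac k.
exact: Ck_on_add (@chart_cod_open _ _ _ c) (sf c Ac k) (sf' c Ac k).
Qed.

Lemma smooth_funZ (a : R) (f : M -> R) : smooth_fun f -> smooth_fun (fun q => a * f q).
Proof.
move=> sf c Ac k.
exact: Ck_onM (@chart_cod_open _ _ _ c) (Ck_on_cst k (chart_cod c) a) (sf c Ac k).
Qed.

Section ZeroVector.
Variable D : vfield M -> vfield M -> vfield M.
Hypothesis Dc : affine_connection D.

Lemma smooth_vfield0 : smooth_vfield (fun _ : M => 0).
Proof.
move=> c Ac k; have Uo := @chart_cod_open _ _ _ c.
apply: (Ck_on_eq Uo) (Ck_on_cst k (chart_cod c) 0) => x _ /=.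
by rewrite mul0mx.
Qed.

Lemma connection0 X p : smooth_vfield X -> D X (fun=> 0) p = 0.
Proof.
move=> sX; have [_ _ DD _] := Dc.
have := DD X _ _ sX smooth_vfield0 smooth_vfield0 p.
have -> : (fun q : M => 0 + 0 : 'rV[R]_m) = (fun=> 0) by apply/funext => q; rewrite addr0.
by move=> /eqP; rewrite -subr_eq0 opprD addrA subrr sub0r oppr_eq0 => /eqP.
Qed.

Lemma connectionN X Y p : smooth_vfield X -> smooth_vfield Y ->
  D X (fun q => - Y q) p = - D X Y p.
Proof.
move=> sX sY; have [_ _ DD _] := Dc.
have := DD X _ _ sX sY (smooth_vfieldN sY) p.
have -> : (fun q : M => Y q - Y q) = (fun=> 0) by apply/funext => q; rewrite subrr.
by rewrite connection0// => /esym/eqP; rewrite addrC addr_eq0 => /eqP.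
Qed.

End ZeroVector.

Variables (g : tensor02 M) (th : tensor11 M) (D : vfield M -> vfield M -> vfield M).
Hypotheses (gr : riemannian_metric g) (Dc : affine_connection D) (Dg : self_dual g D).
Hypotheses (ths : smooth_tensor11 th)
  (thg : forall p u v, ev02 g p (ev11 th p u) v = - ev02 g p u (ev11 th p v))
  (th3 : forall p, th p *m th p *m th p = - th p).

Variables P Q : tensor11 M.
Hypotheses (PE : forall p, P p = - (th p *m th p))
  (Q1 : forall p, Q p = 1%:M + th p *m th p).

(* [P] and [Q] are the orthogonal projections on the image and on the kernel
   of [th]; the three terms average [D] over the parallel structure. *)
Definition parallelize (X Y : vfield M) : vfield M := fun p =>
  2^-1 *: (D X (apply11 P Y) p *m P p - D X (apply11 th Y) p *m th p)
  + D X (apply11 Q Y) p *m Q p.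

Let sP : smooth_tensor11 P.
Proof.
have -> : P = (fun p => - (th p *m th p)) by apply/funext.
exact/smooth_tensor11N/smooth_tensor11M.
Qed.

Let sQ : smooth_tensor11 Q.
Proof.
have -> : Q = (fun p => 1%:M + th p *m th p) by apply/funext.
by apply: smooth_tensor11D; [exact: smooth_tensor11_id|exact: smooth_tensor11M].
Qed.

Let sPY Y : smooth_vfield Y -> smooth_vfield (apply11 P Y).
Proof. exact: smooth_apply11. Qed.

Let sQY Y : smooth_vfield Y -> smooth_vfield (apply11 Q Y).
Proof. exact: smooth_apply11. Qed.

Let stY Y : smooth_vfield Y -> smooth_vfield (apply11 th Y).
Proof. exact: smooth_apply11. Qed.

Let Pth p : P p *m th p = th p.
Proof. by rewrite PE mulNmx th3 opprK. Qed.

Let thP p : th p *m P p = th p.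
Proof. by rewrite PE mulmxN mulmxA th3 opprK. Qed.

Let Qth p : Q p *m th p = 0.
Proof. by rewrite Q1 mulmxDl mul1mx th3 subrr. Qed.

Let thQ p : th p *m Q p = 0.
Proof. by rewrite Q1 mulmxDr mulmx1 mulmxA th3 subrr. Qed.

Let PP p : P p *m P p = P p.
Proof. by rewrite {1}PE mulNmx -mulmxA thP. Qed.

Let thth p : th p *m th p = - P p.
Proof. by rewrite PE opprK. Qed.

Let QE p : Q p = 1%:M - P p.
Proof. by rewrite Q1 PE opprK. Qed.

Let QQ p : Q p *m Q p = Q p.
Proof. by rewrite {2}Q1 mulmxDr mulmx1 mulmxA Qth mul0mx addr0. Qed.

Let thG p : th p *m g p = - (g p *m (th p)^T).
Proof.
apply: bilinear_form_inj => u v; rewrite mulmxN mulNmx.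
have := thg p u v; rewrite /ev02 /ev11 => E.
rewrite !mulmxA; apply/matrixP => i j; rewrite !ord1 E [RHS]mxE trmx_mul.
by rewrite !mulmxA.
Qed.

Let PG p : P p *m g p = g p *m (P p)^T.
Proof.
rewrite PE mulNmx -mulmxA thG mulmxN mulmxA thG mulNmx opprK.
by rewrite linearN /= trmx_mul mulmxN mulmxA.
Qed.

Let QG p : Q p *m g p = g p *m (Q p)^T.
Proof. by rewrite QE mulmxBl mul1mx PG linearB /= trmx1 mulmxBr mulmx1. Qed.

Let apply11D (A : tensor11 M) Y Y' : apply11 A (fun q => Y q + Y' q) =
  (fun q => apply11 A Y q + apply11 A Y' q).
Proof. by apply/funext => q; exact: mulmxDl. Qed.

Let apply11Z (A : tensor11 M) (f : M -> R) Y : apply11 A (fun q => f q *: Y q) =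
  (fun q => f q *: apply11 A Y q).
Proof. by apply/funext => q; rewrite /apply11 /ev11 scalemxAl. Qed.

Lemma parallelize_connection : affine_connection parallelize.
Proof.
have [D1 D2 D3 D4] := Dc.
split.
- move=> X Y sX sY.
  have sA (A B : tensor11 M) : smooth_tensor11 A -> smooth_tensor11 B ->
      smooth_vfield (fun p => D X (apply11 A Y) p *m B p).
    move=> sA sB; apply: (smooth_apply11 sB).
    by apply: D1 => //; exact: smooth_apply11.
  apply: smooth_vfieldD; last exact: sA.
  apply: (smooth_vfieldZ (f := fun=> 2^-1)); first exact: smooth_fun_cst.
  apply: smooth_vfieldD; first exact: sA.
  by apply: smooth_vfieldN; exact: sA.
- move=> f X X' Y sf sX sX' sY p; rewrite /parallelize.
  rewrite (D2 _ _ _ _ sf sX sX' (sPY sY)) (D2 _ _ _ _ sf sX sX' (stY sY)).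
  rewrite (D2 _ _ _ _ sf sX sX' (sQY sY)).
  rewrite !mulmxDl -!scalemxAl.
  move: (_ *m P p) (_ *m P p) (_ *m th p) (_ *m th p) (_ *m Q p) (_ *m Q p).
  by move=> a b c d e h; apply/matrixP => i j; rewrite !mxE; ring.
- move=> X Y Y' sX sY sY' p; rewrite /parallelize !apply11D.
  rewrite (D3 _ _ _ sX (sPY sY) (sPY sY')) (D3 _ _ _ sX (stY sY) (stY sY')).
  rewrite (D3 _ _ _ sX (sQY sY) (sQY sY')) !mulmxDl.
  move: (_ *m P p) (_ *m P p) (_ *m th p) (_ *m th p) (_ *m Q p) (_ *m Q p).
  by move=> a b c d e h; apply/matrixP => i j; rewrite !mxE; ring.
move=> f X Y sf sX sY p; rewrite /parallelize !apply11Z.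
rewrite (D4 _ _ _ sf sX (sPY sY)) (D4 _ _ _ sf sX (stY sY)).
rewrite (D4 _ _ _ sf sX (sQY sY)) !mulmxDl -!scalemxAl.
(* The Leibniz terms add up to [Y p]: [P] and [- (th *m th)] each contribute half of the projection
   on the image, and [Q] contributes the rest. *)
have eP : apply11 P Y p *m P p = Y p *m P p by rewrite /apply11 /ev11 -mulmxA PP.
have et : apply11 th Y p *m th p = - (Y p *m P p).
  by rewrite /apply11 /ev11 -mulmxA thth mulmxN.
have eQ : apply11 Q Y p *m Q p = Y p - Y p *m P p.
  by rewrite /apply11 /ev11 -mulmxA QQ QE mulmxBr mulmx1.
rewrite eP et eQ.
move: (Y p *m P p) (D X (apply11 P Y) p *m _) (D X (apply11 th Y) p *m _) => a b c.
move: (D X (apply11 Q Y) p *m _) => d.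
by apply/matrixP => i j; rewrite !mxE; field.
Qed.

(** [g] itself is half the sum of its pull-backs by [P] and by [th], plus its pull-back by [Q].
    Since [P] and [Q] are self-adjoint and [th] is skew, the metric identities for [D] on the three
    transformed pairs of fields add up to the one for the average. *)
Lemma parallelize_self_dual : self_dual g parallelize.
Proof.
have [sg _ _] := gr.
move=> X Y Z sX sY sZ p.
have E : (fun q => ev02 g q (X q) (Y q)) = (fun q =>
    2^-1 * ev02 g q (apply11 P X q) (apply11 P Y q)
    + (2^-1 * ev02 g q (apply11 th X q) (apply11 th Y q)
       + ev02 g q (apply11 Q X q) (apply11 Q Y q))).
  apply/funext => q; rewrite /ev02 /apply11 /ev11 !trmx_mul !mulmxA.
  have EP (A : 'M[R]_m) : X q *m A *m g q *m A^T *m (Y q)^T =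
      X q *m (A *m (g q *m A^T)) *m (Y q)^T by rewrite !mulmxA.
  rewrite !EP -PG -QG.
  have -> : g q *m (th q)^T = - (th q *m g q) by rewrite thG opprK.
  rewrite mulmxN !(mulmxA (P q)) !(mulmxA (Q q)) !(mulmxA (th q)) PP QQ thth QE.
  have -> : - (- P q *m g q) = P q *m g q by rewrite mulNmx opprK.
  rewrite (mulmxBl 1%:M) mul1mx mulmxBr (mulmxBl (X q *m g q)).
  move: (X q *m (P q *m g q) *m _) (X q *m g q *m _) => a b.
  by rewrite !mxE; field.
rewrite E.
have s1 := smooth_ev02 sg (sPY sX) (sPY sY).
have s2 := smooth_ev02 sg (stY sX) (stY sY).
have s3 := smooth_ev02 sg (sQY sX) (sQY sY).
have half U V : smooth_vfield U -> ev02 g p (parallelize Z U p) (V p) =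
    2^-1 * ev02 g p (D Z (apply11 P U) p) (apply11 P V p)
    + (2^-1 * ev02 g p (D Z (apply11 th U) p) (apply11 th V p)
       + ev02 g p (D Z (apply11 Q U) p) (apply11 Q V p)).
  move=> sU; rewrite /ev02 /parallelize.
  move: (D Z (apply11 P U) p) (D Z (apply11 th U) p) (D Z (apply11 Q U) p) => a b c.
  rewrite /apply11 /ev11 !trmx_mul !mulmxA.
  have aG A : a *m g p *m (A p)^T = a *m (g p *m (A p)^T) by rewrite !mulmxA.
  have bG A : b *m g p *m (A p)^T = b *m (g p *m (A p)^T) by rewrite !mulmxA.
  have cG A : c *m g p *m (A p)^T = c *m (g p *m (A p)^T) by rewrite !mulmxA.
  rewrite aG bG cG -PG -QG.
  have -> : g p *m (th p)^T = - (th p *m g p) by rewrite thG opprK.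
  rewrite mulmxDl -scalemxAl mulmxBl mulmxDl -scalemxAl mulmxBl mulmxN mulNmx.
  rewrite !mulmxA.
  move: (a *m P p *m g p *m _) (b *m th p *m g p *m _) (c *m Q p *m g p *m _).
  by move=> x y z; rewrite !mxE; ring.
have gC u v : ev02 g p u v = ev02 g p v u by have [_ + _] := gr; exact.
rewrite (half X Y sX) (gC (X p)) (half Y X sY).
rewrite (dirderD _ _ (smooth_funZ 2^-1 s1) (smooth_funD (smooth_funZ 2^-1 s2) s3)).
rewrite (dirderD _ _ (smooth_funZ 2^-1 s2) s3).
rewrite (dirderZ _ _ _ s1) (dirderZ _ _ _ s2).
rewrite (Dg (sPY sX) (sPY sY) sZ) (Dg (stY sX) (stY sY) sZ) (Dg (sQY sX) (sQY sY) sZ).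
rewrite (gC (D Z (apply11 P Y) p)) (gC (D Z (apply11 th Y) p)).
rewrite (gC (D Z (apply11 Q Y) p)).
have alg (a b c d e h : R) : 2^-1 * (a + b) + (2^-1 * (c + d) + (e + h)) =
  2^-1 * a + (2^-1 * c + e) + (2^-1 * b + (2^-1 * d + h)) by field.
exact: alg.
Qed.

(** Applying [th] interchanges the first two terms of the average, because [th *m th = - P] and
    [P *m th = th]; the third vanishes on both sides since [th] and [Q] annihilate each other. *)
Lemma parallelize_gauge : gauge_equation parallelize parallelize th.
Proof.
move=> X Y sX sY p; rewrite /parallelize /ev11.
have e1 : apply11 P (apply11 th Y) = apply11 th Y.
  by apply/funext => q; rewrite /apply11 /ev11 -mulmxA thP.
have e2 : apply11 th (apply11 th Y) = (fun q => - apply11 P Y q).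
  by apply/funext => q; rewrite /apply11 /ev11 -mulmxA thth mulmxN.
have e3 : apply11 Q (apply11 th Y) = (fun=> 0).
  by apply/funext => q; rewrite /apply11 /ev11 -mulmxA thQ mulmx0.
rewrite e1 e2 e3 (connection0 Dc _ sX) (connectionN Dc _ sX (sPY sY)).
rewrite mul0mx addr0.
move: (D X (apply11 th Y) p) (D X (apply11 P Y) p) (D X (apply11 Q Y) p).
move=> a b c; rewrite mulmxDl -scalemxAl mulmxBl -!mulmxA Pth Qth mulmx0 addr0.
by rewrite thth mulmxN mulNmx !opprK addrC.
Qed.

End ParallelConnection.

(** Common source of gauge solutions for almost contact and almost complex structures: both satisfy
    the cubic identity, the projection on the kernel having rank one in the first case and rank zero
    in the second. *)
Lemma skew_cubic_gauge_solution (R : realType) (m : nat) (M : manifold R m) r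
    (g : tensor02 M) (th : tensor11 M) :
  riemannian_metric g -> smooth_tensor11 th ->
  (forall p u v, ev02 g p (ev11 th p u) v = - ev02 g p u (ev11 th p v)) ->
  (forall p, th p *m th p *m th p = - th p) ->
  (forall p, \rank (th p) = r) ->
  skew_gauge_solution_of_rank M r.
Proof.
move=> gr ths thg th3 thr; have [D Dc Dg] := metric_connection_exists gr.
pose P : tensor11 M := fun p => - (th p *m th p).
pose Q : tensor11 M := fun p => 1%:M + th p *m th p.
exists g, (parallelize th D P Q), th; split; split => //.
- exact: parallelize_connection.
- exact: parallelize_self_dual.
- exact: parallelize_gauge.
Qed.

(** * Almost complex structures from nondegenerate 2-forms *)

Section Polar.
Variables (R : realType) (m : nat).
Implicit Types (g w J : 'M[R]_m).

(* In a [g]-orthonormal frame, the orthogonal factor of the polar decomposition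
   of the skew endomorphism corresponding to [w]. *)
Definition polar g w : 'M[R]_m :=
  let C := invmx (sqrtmx g) in let a := C *m w *m C in
  sqrtmx g *m (invmx (sqrtmx (a *m a^T)) *m a) *m C.

(** [J] is a [g]-isometric complex structure for which [w(u, J v)] is symmetric and positive. These
    conditions mention no frame and are preserved by congruence, unlike the square roots in the
    formula for [polar]; they also determine [J]. *)
Definition tamed g w J : Prop :=
  [/\ J *m J = - 1%:M, J *m g *m J^T = g, (w *m J^T)^T = w *m J^T
    & posdef (w *m J^T)].

Section OrthonormalFrame.
Variables H C a K : 'M[R]_m.
Hypotheses (HT : H^T = H) (Hu : H \in unitmx) (CT : C^T = C)
  (CH : C *m H = 1%:M) (HC : H *m C = 1%:M) (aT : a^T = - a)
  (KT : K^T = K) (K0 : posdef K) (KK : K *m K = a *m a^T).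

Let Ku : K \in unitmx. Proof. exact: posdef_unit. Qed.

(** As [K] commutes with the skew matrix [a], the factor [j] is both skew and orthogonal, hence
    squares to -1; [w *m J^T] then becomes the congruence of [K] by [H]. *)
Lemma tamed_frame j : j = invmx K *m a -> a *m K = K *m a ->
  tamed (H *m H) (H *m a *m H) (H *m j *m C).
Proof.
move=> jE aK.
have Kj : K *m j = a by rewrite jE mulKVmx.
have jK : j *m K = a by rewrite jE -mulmxA aK mulKmx.
have jT : j^T = - j.
  rewrite {1}jE trmx_mul aT mulNmx trmx_inv KT; congr (- _).
  by rewrite -jK mulmxK.
have jj : j *m j = - 1%:M.
  have jjK : K *m (j *m j) *m K = a *m a by rewrite mulmxA Kj -mulmxA jK.
  apply: (can_inj (mulKmx Ku)); apply: (can_inj (mulmxK Ku)).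
  by rewrite jjK mulmxN mulNmx mulmx1 KK aT mulmxN opprK.
have aj : a *m j = - K by rewrite -Kj -mulmxA jj mulmxN mulmx1.
clear jE.
have E : H *m j *m C *m H = H *m j by rewrite -mulmxA CH mulmx1.
have wJT : H *m a *m H *m (H *m j *m C)^T = H *m K *m H.
  rewrite !trmx_mul CT HT jT !mulmxA -(mulmxA _ H C) HC mulmx1.
  by rewrite mulmxN mulNmx -(mulmxA H a j) aj mulmxN mulNmx opprK.
split.
- by rewrite !mulmxA E -(mulmxA H j j) jj mulmxN mulNmx mulmx1 HC.
- rewrite !trmx_mul CT HT jT !mulmxA E -(mulmxA _ H C) HC mulmx1.
  by rewrite mulmxN mulNmx -(mulmxA H j j) jj mulmxN mulNmx opprK mulmx1.
- by rewrite wJT !trmx_mul HT KT mulmxA.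
- by rewrite wJT; have := posdef_congr Hu K0; rewrite HT.
Qed.

(** If [j] is the expression of a tamed [J] in the frame, [- (a *m j)] is symmetric, positive
    definite and squares to [a *m a^T]. By uniqueness of roots it is [K], which recovers [j] from
    [a]. *)
Lemma tamed_frame_uniq J : K = sqrtmx (a *m a^T) ->
  tamed (H *m H) (H *m a *m H) J -> J = H *m (invmx K *m a) *m C.
Proof.
move=> KE [JJ Jg wJT wJ0].
have [j jE] : exists j, j = C *m J *m H by exists (C *m J *m H).
have JE : J = H *m j *m C.
  by rewrite jE !mulmxA HC mul1mx -mulmxA HC mulmx1.
have jj : j *m j = - 1%:M.
  rewrite jE !mulmxA -(mulmxA _ H C) HC mulmx1 -(mulmxA C) JJ.
  by rewrite mulmxN mulNmx mulmx1 CH.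
have jjT : j *m j^T = 1%:M.
  have -> : j *m j^T = C *m (J *m (H *m H) *m J^T) *m C.
    by rewrite jE !trmx_mul CT HT !mulmxA.
  by rewrite Jg !mulmxA CH mul1mx HC.
have jT : j^T = - j.
  by rewrite -[j^T]mulmx1 -[1%:M]opprK -jj mulmxN mulmxA (mulmx1C jjT) mul1mx.
clear jE.
have [k kd] : exists k, k = C *m (H *m a *m H *m J^T) *m C.
  by exists (C *m (H *m a *m H *m J^T) *m C).
have kE : k = - (a *m j).
  rewrite kd JE !trmx_mul CT HT jT mulNmx !mulmxN !mulNmx !mulmxA CH mul1mx.
  by rewrite -(mulmxA _ H C) HC mulmx1 -(mulmxA _ H C) HC mulmx1.
have kT : k^T = k.
  by rewrite kd trmx_mul (trmx_mul C) wJT CT mulmxA.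
have k0 : posdef k.
  have Cu : C \in unitmx by have [] := mulmx1_unit CH.
  by rewrite kd; have := posdef_congr Cu wJ0; rewrite CT.
have ja : j *m a = a *m j.
  by apply: oppr_inj; rewrite -kE -kT kE linearN /= trmx_mul aT jT mulNmx mulmxN opprK.
have kk : k *m k = a *m a^T.
  rewrite kE mulNmx mulmxN opprK aT mulmxN -mulmxA (mulmxA j) ja.
  by rewrite -(mulmxA a j j) jj mulmxN mulmx1 mulmxN.
have Kk : K = k by rewrite KE; exact: sqrtmx_uniq.
rewrite {1}JE; congr (_ *m _ *m _).
apply: (can_inj (mulKmx Ku)); rewrite mulKVmx// Kk kE mulNmx -mulmxA jj.
by rewrite mulmxN mulmx1 opprK.
Qed.

End OrthonormalFrame.

Section PolarProps.
Variables g w : 'M[R]_m.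
Hypotheses (gT : g^T = g) (g0 : posdef g) (ws : skew w) (wu : w \in unitmx).

Lemma polar_frame : exists H C a K : 'M[R]_m,
  [/\ H^T = H, H \in unitmx, C^T = C, C *m H = 1%:M & H *m C = 1%:M] /\
  [/\ a^T = - a, K^T = K, posdef K, K *m K = a *m a^T & a *m K = K *m a] /\
  [/\ K = sqrtmx (a *m a^T), g = H *m H, w = H *m a *m H
    & polar g w = H *m (invmx K *m a) *m C].
Proof.
have [HT /posdef_unit Hu HH] := sqrtmxP gT g0.
move: HT Hu HH; rewrite /polar; move: (sqrtmx g) => H HT Hu HH.
have CT : (invmx H)^T = invmx H by rewrite trmx_inv HT.
have CH : invmx H *m H = 1%:M by exact: mulVmx.
have HC : H *m invmx H = 1%:M by exact: mulmxV.
have Cu : invmx H \in unitmx by rewrite unitmx_inv.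
exists H, (invmx H); move: (invmx H) CT CH HC Cu => C CT CH HC Cu.
have aT : (C *m w *m C)^T = - (C *m w *m C).
  by rewrite !trmx_mul CT ws mulNmx mulmxN mulmxA.
have wE : w = H *m (C *m w *m C) *m H.
  by rewrite !mulmxA HC mul1mx -mulmxA CH mulmx1.
have au : C *m w *m C \in unitmx by rewrite !unitmx_mul wu Cu.
exists (C *m w *m C), (sqrtmx ((C *m w *m C) *m (C *m w *m C)^T)).
move: (C *m w *m C) aT wE au => a aT wE au.
have ST : (a *m a^T)^T = a *m a^T by rewrite trmx_mul trmxK.
have S0 : posdef (a *m a^T).
  by have := posdef_congr au (@posdef1 R m); rewrite mulmx1.
have [KT K0 KK] := sqrtmxP ST S0.
split=> //; split; last by split.
split=> //; apply: sqrtmx_comm => //.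
by rewrite aT !mulmxN mulNmx mulmxA.
Qed.

Lemma polar_tamed : tamed g w (polar g w).
Proof.
have [H [C [a [K [[HT Hu CT CH HC] [[aT KT K0 KK aK] [_ gE wE ->]]]]]]] := polar_frame.
by rewrite gE wE; apply: tamed_frame KT K0 KK _ _ _.
Qed.

Lemma tamed_uniq J : tamed g w J -> J = polar g w.
Proof.
have [H [C [a [K [[HT Hu CT CH HC] [[aT KT K0 KK aK] [KE gE wE ->]]]]]]] := polar_frame.
by rewrite gE wE; apply: tamed_frame_uniq.
Qed.

End PolarProps.

(** The right-hand side is tamed by the transported pair, so uniqueness applies. The square root of
    [g] on its own does not transform in this way. *)
Lemma polar_congr (g w A : 'M[R]_m) : g^T = g -> posdef g -> skew w ->
  w \in unitmx -> A \in unitmx ->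
  polar (A *m g *m A^T) (A *m w *m A^T) = A *m polar g w *m invmx A.
Proof.
move=> gT g0 ws wu Au; apply/esym/tamed_uniq.
- by rewrite !trmx_mul trmxK gT mulmxA.
- exact: posdef_congr.
- exact: skew_congr.
- by rewrite !unitmx_mul wu Au unitmx_tr.
have [JJ Jg wJT wJ0] := polar_tamed gT g0 ws wu.
move: (polar g w) JJ Jg wJT wJ0 => J JJ Jg wJT wJ0.
have E : A *m w *m A^T *m (A *m J *m invmx A)^T = A *m (w *m J^T) *m A^T.
  rewrite !trmx_mul trmx_inv !mulmxA mulmxK ?unitmx_tr//.
split.
- rewrite !mulmxA mulmxKV// -(mulmxA A) JJ mulmxN mulmx1 mulNmx mulmxV//.
- rewrite !trmx_mul trmx_inv !mulmxA mulmxKV// mulmxK ?unitmx_tr//.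
  by rewrite -(mulmxA A J) -(mulmxA A) Jg.
- by rewrite E trmx_mul (trmx_mul A) wJT trmxK mulmxA.
- by rewrite E; exact: posdef_congr.
Qed.

Lemma Ck_on_polar n k (U : set 'rV[R]_n) (g w : 'rV[R]_n -> 'M[R]_m) : open U ->
  (forall x, U x -> (g x)^T = g x) -> (forall x, U x -> posdef (g x)) ->
  (forall x, U x -> skew (w x)) -> (forall x, U x -> w x \in unitmx) ->
  Ck_on k U g -> Ck_on k U w -> Ck_on k U (fun x => polar (g x) (w x)).
Proof.
move=> Uo gT g0 ws wu gk wk.
have Hk := Ck_on_sqrtmx Uo gT g0 gk.
have Hu x : U x -> sqrtmx (g x) \in unitmx.
  by move=> Ux; have [_ /posdef_unit] := sqrtmxP (gT x Ux) (g0 x Ux).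
have Ckk := Ck_on_invmx Uo Hu Hk.
have HT x : U x -> (sqrtmx (g x))^T = sqrtmx (g x).
  by move=> Ux; have [] := sqrtmxP (gT x Ux) (g0 x Ux).
pose a x := invmx (sqrtmx (g x)) *m w x *m invmx (sqrtmx (g x)).
have ak : Ck_on k U a by do 2!apply: (Ck_on_mulmx Uo) => //.
have au x : U x -> a x \in unitmx.
  by move=> Ux; rewrite !unitmx_mul unitmx_inv Hu// wu.
have ST x : U x -> (a x *m (a x)^T)^T = a x *m (a x)^T.
  by move=> _; rewrite trmx_mul trmxK.
have S0 x : U x -> posdef (a x *m (a x)^T).
  by move=> Ux; have := posdef_congr (au x Ux) (@posdef1 R m); rewrite mulmx1.
have Sk : Ck_on k U (fun x => a x *m (a x)^T).
  by apply: (Ck_on_mulmx Uo) => //; exact: Ck_on_trmx.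
have Kk := Ck_on_sqrtmx Uo ST S0 Sk.
have Ku x : U x -> sqrtmx (a x *m (a x)^T) \in unitmx.
  by move=> Ux; have [_ /posdef_unit] := sqrtmxP (ST x Ux) (S0 x Ux).
have Kik := Ck_on_invmx Uo Ku Kk.
exact: Ck_on_mulmx Uo (Ck_on_mulmx Uo Hk (Ck_on_mulmx Uo Kik ak)) Ckk.
Qed.

End Polar.

(** * Polar factors of fields *)

Section PolarField.
Variables (R : realType) (m : nat) (M : manifold R m).
Implicit Types (g w : tensor02 M).

Lemma smooth_polar g w : riemannian_metric g -> smooth_tensor02 w ->
  (forall p, skew (w p : 'M[R]_m)) -> (forall p, (w p : 'M[R]_m) \in unitmx) ->
  smooth_tensor11 (fun p => polar (g p) (w p)).
Proof.
move=> gr sw ws wu c Ac k; have Uo := @chart_cod_open _ _ _ c.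
have cs := atlas_smooth_chart Ac.
apply: (Ck_on_eq Uo (f := fun x => polar (tensor02_in c g x) (tensor02_in c w x))).
  move=> x cx /=; rewrite /tensor02_in.
  have Bu := of_chart_unit cs (chart_invP cx).
  rewrite polar_congr//; [|exact: metric_sym|exact: metric_posdef].
  have := of_to_chart cs (chart_invP cx).
  move: (to_chart c _) (of_chart c _) Bu => A B Bu BA.
  by rewrite -[A in RHS](mulKmx Bu) BA mulmx1.
have [sg _ _] := gr.
apply: (Ck_on_polar Uo).
- by move=> x _; exact: tensor02_in_sym.
- by move=> x cx; exact: tensor02_in_posdef.
- by move=> x _; exact: skew_congr.
- move=> x cx; have := of_chart_unit cs (chart_invP cx); rewrite /tensor02_in.
  move: (of_chart c _) (w _) (wu (chart_inv c x)) => B y yu Bu.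
  by rewrite !unitmx_mul yu Bu unitmx_tr.
- exact: smooth_tensor02P.
- exact: smooth_tensor02P.
Qed.

Lemma polar_field g w : riemannian_metric g -> smooth_tensor02 w ->
  (forall p, skew (w p : 'M[R]_m)) -> (forall p, (w p : 'M[R]_m) \in unitmx) ->
  exists2 J : tensor11 M, smooth_tensor11 J & forall p, J p *m J p = - 1%:M.
Proof.
move=> gr sw ws wu; exists (fun p => polar (g p) (w p)); first exact: smooth_polar.
move=> p.
have [JJ _ _ _] :=
  polar_tamed (metric_sym p gr) (metric_posdef p gr) (ws p) (wu p).
exact: JJ.
Qed.

End PolarField.

(** * Tensor fields on the cylinder *)

Section CylinderCharts.
Variables (R : realType) (m : nat).

Lemma derive_linear_comp (U V W : normedModType R) (L : {linear V -> W})
    (f : U -> V) x v : continuous L -> differentiable f x ->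
  'D_v (L \o f) x = L ('D_v f x).
Proof.
move=> Lc df; have dL y : differentiable L y by exact: linear_differentiable.
rewrite (deriveE _ (differentiable_comp df (dL _))) (diff_comp df (dL _)) /=.
by rewrite (diff_lin _ Lc) (deriveE _ df).
Qed.

Lemma derive_comp_linear (U V W : normedModType R) (L : {linear U -> V})
    (f : V -> W) x v : continuous L -> differentiable f (L x) ->
  'D_v (f \o L) x = 'D_(L v) f (L x).
Proof.
move=> Lc df; have dL y : differentiable L y by exact: linear_differentiable.
rewrite (deriveE _ (differentiable_comp (dL x) df)) (diff_comp (dL x) df) /=.
by rewrite (diff_lin _ Lc) (deriveE _ df).
Qed.

(** The shape of every transition map of the cylinder. Its block diagonal Jacobian leaves the line
    coordinate of tensors unchanged. *)
Definition lift_map (h : 'rV[R]_m -> 'rV[R]_m) (x : 'rV[R]_(m + 1)) : 'rV[R]_(m + 1) :=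
  row_mx (h (lsubmx x)) (rsubmx x).

Lemma jacobian_lift_map h x : differentiable h (lsubmx x) ->
  'J (lift_map h) x = block_mx ('J h (lsubmx x)) 0 0 1%:M.
Proof.
move=> dh.
have HE : lift_map h = (inl_mx (m := m) \o (h \o @lsubmx R 1 m 1))
                       + (inr_mx m \o @rsubmx R 1 m 1).
  by apply/funext => y; rewrite /lift_map fctE /= -row_mx_inE.
have dl : differentiable (@lsubmx R 1 m 1) x := differentiable_lsubmx _.
have dr : differentiable (@rsubmx R 1 m 1) x := differentiable_rsubmx _.
have dhl : differentiable (h \o @lsubmx R 1 m 1) x := differentiable_comp dl dh.
have d1 : differentiable (inl_mx (m := m) \o (h \o @lsubmx R 1 m 1)) x.
  by apply: differentiable_comp => //; exact/linear_differentiable/continuous_inl_mx.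
have d2 : differentiable (inr_mx m \o @rsubmx R 1 m 1) x.
  by apply: differentiable_comp => //; exact/linear_differentiable/continuous_inr_mx.
have dH : differentiable (lift_map h) x by rewrite HE; exact: differentiableD.
apply: eq_row_mul => v; rewrite -(deriveEjacobian _ dH) HE.
rewrite (deriveD (diff_derivable d1) (diff_derivable d2)).
rewrite (derive_linear_comp _ (@continuous_inl_mx R m) dhl).
rewrite (derive_linear_comp _ (@continuous_inr_mx R m) dr).
rewrite (derive_comp_linear _ (@continuous_lsubmx _ _ _ _) dh).
have -> : 'D_v (@rsubmx R 1 m 1) x = rsubmx v.
  rewrite (deriveE _ dr) (diff_lin _ (@continuous_rsubmx _ _ _ _))//.
rewrite -row_mx_inE (deriveEjacobian _ dh) -[v in RHS]hsubmxK.
by rewrite mul_row_block !mulmx0 addr0 add0r mulmx1.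
Qed.

Variable M : manifold R m.
Let W := cylinder M.

Lemma cyl_chart_atlas c : atlas M c -> atlas W (cyl_chart c).
Proof. by move=> Ac; exists c. Qed.

Lemma cyl_transition (c c' : chart R M m) :
  cyl_chart c' \o chart_inv (cyl_chart c) = lift_map (c' \o chart_inv c).
Proof.
by apply/funext => x; rewrite /lift_map /= [rsubmx x in RHS]mx11_scalar.
Qed.

Lemma cyl_jacobian (c c' : chart R M m) (p : M) t :
  differentiable (c' \o chart_inv c) (c p) ->
  'J (cyl_chart c' \o chart_inv (cyl_chart c)) (cyl_chart c (p, t)) =
  block_mx ('J (c' \o chart_inv c) (c p)) 0 0 1%:M.
Proof.
have E : lsubmx (cyl_chart c (p, t)) = c p by rewrite /= row_mxKl.
move=> d; rewrite cyl_transition jacobian_lift_map ?E//.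
Qed.

Lemma to_chart_cyl c (p : M) t : atlas M c -> chart_dom c p ->
  to_chart (M := W) (cyl_chart c) (p, t) = block_mx (to_chart c p) 0 0 1%:M.
Proof.
move=> Ac cp; apply: (@cyl_jacobian (chart_at p) c p t).
apply: compatible_differentiable => //; last exact: chart_at_dom.
by apply: atlas_compatible => //; exact: chart_at_atlas.
Qed.

Lemma of_chart_cyl c (p : M) t : atlas M c -> chart_dom c p ->
  of_chart (M := W) (cyl_chart c) (p, t) = block_mx (of_chart c p) 0 0 1%:M.
Proof.
move=> Ac cp; apply: (@cyl_jacobian c (chart_at p) p t).
apply: compatible_differentiable => //; last exact: chart_at_dom.
by apply: atlas_compatible => //; exact: chart_at_atlas.
Qed.

Lemma Ck_on_cyl (V : normedModType R) k c (f : 'rV[R]_m -> V) :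
  Ck_on k (chart_cod c) f ->
  Ck_on k (chart_cod (cyl_chart (T := M) c)) (fun x => f (lsubmx x)).
Proof.
move=> fk; exact: (Ck_on_compr (L := @lsubmx R 1 m 1) (@chart_cod_open _ _ _ c)
  (@continuous_lsubmx _ _ _ _) fk).
Qed.

Lemma Ck_on_slice (V : normedModType R) k c (f : 'rV[R]_(m + 1) -> V) :
  Ck_on k (chart_cod (cyl_chart (T := M) c)) f ->
  Ck_on k (chart_cod c) (fun x => f (row_mx x 0)).
Proof.
move=> fk.
have := Ck_on_compr (L := inl_mx (m := m)) (@chart_cod_open _ _ _ (cyl_chart c))
  (@continuous_inl_mx R m) fk.
apply: Ck_on_subset => x cx.
by rewrite /preimage /= /inl_mx row_mxKl.
Qed.

(** Block diagonal coordinate changes act on the four blocks as on a (1,1)-tensor, a 1-form, a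
    vector field and a function of the base. *)
Lemma smooth_cyl11 (a : tensor11 M) (b : form1 M) (v : vfield M) (d : M -> R) :
  smooth_tensor11 a -> smooth_form1 b -> smooth_vfield v -> smooth_fun d ->
  smooth_tensor11 (M := W)
    (fun p => block_mx (a p.1) (b p.1) (v p.1) (d p.1)%:M).
Proof.
move=> sa sb sv sd _ [c Ac <-] k.
have Uo := @chart_cod_open _ _ _ (cyl_chart c).
apply: (Ck_on_eq Uo (f := fun x => block_mx (tensor11_in c a (lsubmx x))
  (form1_in c b (lsubmx x)) (vec_in c v (lsubmx x))
  ((d \o chart_inv c) (lsubmx x))%:M)).
  move=> x cx; have cp := chart_invP (c := c) cx.
  rewrite /comp [chart_inv (cyl_chart c) x]/=.
  rewrite (of_chart_cyl _ Ac cp) (to_chart_cyl _ Ac cp).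
  rewrite /tensor11_in /form1_in /vec_in [(_, _).1]/=.
  move: (to_chart c _) (of_chart c _) (a _) (b _) (v _) (d _).
  move=> A B a' b' v' d'.
  by rewrite !mulmx_block !(mul0mx, mulmx0, mul1mx, mulmx1, addr0, add0r).
apply: (Ck_on_block Uo).
- exact: Ck_on_cyl (smooth_tensor11P k sa Ac).
- exact: Ck_on_cyl (smooth_form1P k sb Ac).
- exact: Ck_on_cyl (smooth_vfieldP k sv Ac).
- have dk : Ck_on k (chart_cod (cyl_chart c)) (fun x => (d \o chart_inv c) (lsubmx x)).
    exact: Ck_on_cyl (sd c Ac k).
  apply: (Ck_on_eq Uo (f := fun x =>
    (d \o chart_inv c) (lsubmx x) *: (1%:M : 'M[R]_1))).
    by move=> x _; rewrite scale_scalar_mx mulr1.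
  exact: Ck_on_scalel.
Qed.

Lemma smooth_cyl02 (g : tensor02 M) (b : form1 M) (d : M -> R) :
  smooth_tensor02 g -> smooth_form1 b -> smooth_fun d ->
  smooth_tensor02 (M := W)
    (fun p => block_mx (g p.1) (b p.1) (- (b p.1)^T) (d p.1)%:M).
Proof.
move=> sg sb sd _ [c Ac <-] k.
have Uo := @chart_cod_open _ _ _ (cyl_chart c).
apply: (Ck_on_eq Uo (f := fun x => block_mx (tensor02_in c g (lsubmx x))
  (form1_in c b (lsubmx x)) (- (form1_in c b (lsubmx x))^T)
  ((d \o chart_inv c) (lsubmx x))%:M)).
  move=> x cx; have cp := chart_invP (c := c) cx.
  rewrite /comp [chart_inv (cyl_chart c) x]/= (of_chart_cyl _ Ac cp).
  rewrite /tensor02_in /form1_in [(_, _).1]/=.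
  move: (of_chart c _) (g _) (b _) (d _) => B g' b' d'.
  rewrite tr_block_mx !trmx0 trmx1 !mulmx_block.
  by rewrite !(mul0mx, mulmx0, mul1mx, mulmx1, addr0, add0r) mulNmx trmx_mul.
have bk := Ck_on_cyl (smooth_form1P k sb Ac).
apply: (Ck_on_block Uo).
- exact: Ck_on_cyl (smooth_tensor02P k sg Ac).
- exact: bk.
- by apply: (Ck_onN Uo); exact: (Ck_on_trmx Uo bk).
- have dk : Ck_on k (chart_cod (cyl_chart c)) (fun x => (d \o chart_inv c) (lsubmx x)).
    exact: Ck_on_cyl (sd c Ac k).
  apply: (Ck_on_eq Uo (f := fun x =>
    (d \o chart_inv c) (lsubmx x) *: (1%:M : 'M[R]_1))).
    by move=> x _; rewrite scale_scalar_mx mulr1.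
  exact: Ck_on_scalel.
Qed.

Lemma smooth_form1_0 : smooth_form1 (fun _ : M => 0).
Proof.
move=> c Ac k; have Uo := @chart_cod_open _ _ _ c.
apply: (Ck_on_eq Uo) (Ck_on_cst k (chart_cod c) 0) => x _ /=.
by rewrite mulmx0.
Qed.

Definition cyl_metric (g : tensor02 M) : tensor02 W :=
  fun p => block_mx (g p.1) 0 0 1%:M.

Lemma cyl_metric_riemannian g : riemannian_metric g ->
  riemannian_metric (cyl_metric g).
Proof.
move=> gr; have [sg _ _] := gr; split.
- have := smooth_cyl02 sg smooth_form1_0 (@smooth_fun_cst _ _ M 1).
  have -> // : (fun p : W => block_mx (g p.1) 0 (- 0^T) 1%:M) = cyl_metric g.
  by apply/funext => p; rewrite trmx0 oppr0.
- move=> p u v; have gT := metric_sym p.1 gr; rewrite /ev02 /cyl_metric.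
  move: (g p.1) gT => G GT; set H := block_mx _ _ _ _.
  have HT : H^T = H by rewrite /H tr_block_mx !trmx0 trmx1 GT.
  have -> : u *m H *m v^T = (v *m H *m u^T)^T.
    by rewrite !trmx_mul trmxK HT mulmxA.
  by rewrite mxE.
- move=> p u u0; have g0 := metric_posdef p.1 gr; rewrite /ev02 /cyl_metric.
  have [l [r uE]] : exists l r, u = row_mx l r.
    by exists (lsubmx u), (rsubmx u); rewrite hsubmxK.
  move: u0; rewrite uE row_mx_eq0 negb_and mul_row_block !mulmx0 addr0 add0r mulmx1.
  rewrite tr_row_mx mul_row_col mxE; have [->|l0 _] := eqVneq l 0.
    rewrite !mul0mx mxE add0r => r0.
    by have := @posdef1 R _ _ r0; rewrite mulmx1.
  by rewrite ltr_pwDl ?sqnorm_row_ge0//; exact: g0.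
Qed.

End CylinderCharts.

(** * Almost contact structures *)

Section ContactAlgebra.
Variables (R : realType) (m : nat).
Implicit Types (th g : 'M[R]_m) (xi : 'rV[R]_m) (eta : 'cV[R]_m).

Section Kernel.
Variables (th : 'M[R]_m) (xi : 'rV[R]_m) (eta : 'cV[R]_m).
Hypotheses (xe : xi *m eta = 1%:M) (tt : th *m th = - 1%:M + eta *m xi).

(** [th] commutes with its own square, hence with [eta *m xi], so [xi *m th] is a multiple of [xi].
    As the square of [th] annihilates [xi], the factor has square zero. *)
Lemma contact_xi_th : xi *m th = 0.
Proof.
have xtt : xi *m th *m th = 0.
  by rewrite -mulmxA tt mulmxDr mulmxN mulmx1 mulmxA xe mul1mx addNr.
have c : th *m (eta *m xi) = eta *m xi *m th.
  have : th *m (th *m th) = th *m th *m th by rewrite mulmxA.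
  by rewrite tt mulmxDr mulmxDl mulmxN mulNmx mulmx1 mul1mx => /addrI.
have e : xi *m th = xi *m th *m eta *m xi.
  by rewrite -(mulmxA _ eta) -mulmxA c !mulmxA xe mul1mx.
have l : (xi *m th *m eta) *m (xi *m th *m eta) = 0.
  by rewrite !mulmxA -e xtt mul0mx.
have l0 : xi *m th *m eta = 0.
  move: (xi *m th *m eta) l => x; rewrite [x]mx11_scalar -scalar_mxM.
  by move=> /matrixP/(_ 0 0)/eqP; rewrite !mxE mulr1n mulf_eq0 orbb => /eqP ->;
     apply/matrixP => i j; rewrite !mxE mul0rn.
by rewrite e l0 mul0mx.
Qed.

Lemma contact_th_eta : th *m eta = 0.
Proof.
have c : th *m (eta *m xi) = eta *m xi *m th.
  have : th *m (th *m th) = th *m th *m th by rewrite mulmxA.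
  by rewrite tt mulmxDr mulmxDl mulmxN mulNmx mulmx1 mul1mx => /addrI.
have : th *m (eta *m xi) *m eta = 0.
  by rewrite c -(mulmxA eta) contact_xi_th mulmx0 mul0mx.
by rewrite -!mulmxA xe mulmx1.
Qed.

Lemma contact_cubic : th *m th *m th = - th.
Proof. by rewrite tt mulmxDl mulNmx mul1mx -mulmxA contact_xi_th mulmx0 addr0. Qed.

(** The nonzero kernel vector [xi] bounds the rank from above. From below, minus the identity is the
    square of [th] minus a matrix of rank at most one. *)
Lemma contact_rank : \rank th = m.-1.
Proof.
have xi0 : xi != 0.
  apply/negP => /eqP x0; move: xe; rewrite x0 mul0mx => /matrixP/(_ 0 0)/eqP.
  by rewrite !mxE eq_sym oner_eq0.
have lt : (\rank th < m)%N.
  rewrite ltn_neqAle rank_leq_row andbT; apply/negP => fr.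
  have thu : th \in unitmx by rewrite -row_free_unit.
  by move: xi0; rewrite -(mulmxK thu xi) contact_xi_th mul0mx eqxx.
have le : (m <= \rank th + 1)%N.
  rewrite -[X in (X <= _)%N](mxrank1 R) -mxrank_opp.
  have -> : - 1%:M = th *m th - eta *m xi by rewrite tt addrK.
  apply: leq_trans (mxrank_add _ _) _; rewrite mxrank_opp leq_add//.
    exact: mxrankM_maxl.
  exact: leq_trans (mxrankM_maxl _ _) (rank_leq_col _).
have m0 : (0 < m)%N := leq_ltn_trans (leq0n _) lt.
apply/eqP; rewrite eqn_leq; apply/andP; split; first by rewrite -ltnS (prednK m0).
by rewrite -subn1 leq_subLR addnC.
Qed.

(** Compatibility evaluated at [xi] identifies [eta] as the metric dual of [xi]. Multiplied by [th]
    on the left, it turns [th *m th] into -1, the correction vanishing with [th *m eta]. *)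
Lemma contact_skew g : th *m g *m th^T = g - eta *m eta^T ->
  th *m g = - (g *m th^T).
Proof.
move=> tgt.
have xg : xi *m g = eta^T.
  apply/eqP; rewrite -subr_eq0; apply/eqP.
  have : xi *m (th *m g *m th^T) = 0 by rewrite !mulmxA contact_xi_th !mul0mx.
  by rewrite tgt mulmxBr mulmxA xe mul1mx.
have : th *m (th *m g *m th^T) = th *m g.
  by rewrite tgt mulmxBr mulmxA contact_th_eta mul0mx subr0.
move=> <-; rewrite !mulmxA tt mulmxDl mulNmx mul1mx mulmxDl mulNmx.
by rewrite -(mulmxA eta) xg -mulmxA -trmx_mul contact_th_eta trmx0 mulmx0 addr0.
Qed.

End Kernel.

(* A complex structure on the cylinder maps the last axis to [(c, d)]; [1 + d^2]
   is then the value of [b] on [- c]. *)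
Lemma contact_of_complex (a : 'M[R]_m) (b : 'cV[R]_m) (c : 'rV[R]_m) (d : R) :
  block_mx a b c d%:M *m block_mx a b c d%:M = - (1%:M : 'M[R]_(m + 1)) ->
  let xi := - (1 + d ^+ 2)^-1 *: c in
  let th := a - (d / (1 + d ^+ 2)) *: (b *m c) in
  xi *m b = 1%:M /\ th *m th = - 1%:M + b *m xi.
Proof.
rewrite mulmx_block (scalar_mx_block m 1) opp_block_mx => /eq_block_mx[aa ab ca cc].
have s0 : 1 + d ^+ 2 != 0 by rewrite gt_eqF// ltr_pwDl ?sqr_ge0.
rewrite oppr0 in ab; rewrite oppr0 in ca.
have aa' : a *m a = - 1%:M - b *m c by apply/eqP; rewrite eq_sym subr_eq aa.
have ab' : a *m b = - d *: b.
  by apply/eqP; rewrite scaleNr -addr_eq0 -mul_mx_scalar ab.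
have ca' : c *m a = - d *: c.
  by apply/eqP; rewrite scaleNr -addr_eq0 -mul_scalar_mx ca.
have cb : c *m b = (- (1 + d ^+ 2))%:M.
  have -> : c *m b = - 1%:M - d%:M *m d%:M by apply/eqP; rewrite eq_sym subr_eq cc.
  by rewrite -scalar_mxM -expr2 opprD raddfD /= !raddfN.
move=> xi th; split.
  rewrite /xi -scalemxAl cb scale_scalar_mx; congr (_%:M).
  by rewrite mulrNN mulVf.
rewrite /th /xi mulmxBl !mulmxBr aa' -!scalemxAr -!scalemxAl.
rewrite mulmxA ab' -(mulmxA b c a) ca' -(mulmxA b c (b *m c)) (mulmxA c b c) cb.
rewrite mul_scalar_mx -!scalemxAl -!scalemxAr.
move: (b *m c) (1%:M : 'M[R]_m) => e one; apply/matrixP => i j; rewrite !mxE.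
by field.
Qed.

End ContactAlgebra.

(** * Operations on forms and compatible metrics *)

Section FormOperations.
Variables (R : realType) (m : nat) (M : manifold R m).
Implicit Types (g : tensor02 M) (th : tensor11 M) (eta : form1 M) (X : vfield M).

Lemma smooth_form1_vfield eta X : smooth_form1 eta -> smooth_vfield X ->
  smooth_tensor11 (fun p => eta p *m X p).
Proof.
move=> se sX c Ac k; have Uo := @chart_cod_open _ _ _ c.
apply: (Ck_on_eq Uo) (Ck_on_mulmx Uo (smooth_form1P k se Ac)
  (smooth_vfieldP k sX Ac)) => x cx.
by rewrite /form1_in /vec_in /= !mulmxA.
Qed.

Lemma smooth_tensor11Z (f : M -> R) th : smooth_fun f -> smooth_tensor11 th ->
  smooth_tensor11 (fun p => f p *: th p).
Proof.
move=> sf st c Ac k; have Uo := @chart_cod_open _ _ _ c.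
apply: (Ck_on_eq Uo) (Ck_on_scale Uo (sf c Ac k) (smooth_tensor11P k st Ac)) => x cx.
by rewrite /tensor11_in /= -scalemxAr -scalemxAl.
Qed.

Lemma smooth_tensor02D g g' : smooth_tensor02 g -> smooth_tensor02 g' ->
  smooth_tensor02 (fun p => g p + g' p).
Proof.
move=> sg sg' c Ac k; have Uo := @chart_cod_open _ _ _ c.
apply: (Ck_on_eq Uo) (Ck_on_add Uo (smooth_tensor02P k sg Ac)
  (smooth_tensor02P k sg' Ac)) => x cx.
by rewrite /tensor02_in /= mulmxDr mulmxDl.
Qed.

Lemma smooth_tensor02_lower th g : smooth_tensor11 th -> smooth_tensor02 g ->
  smooth_tensor02 (fun p => th p *m g p).
Proof.
move=> st sg c Ac k; have Uo := @chart_cod_open _ _ _ c.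
apply: (Ck_on_eq Uo) (Ck_on_mulmx Uo (smooth_tensor11P k st Ac)
  (smooth_tensor02P k sg Ac)) => x cx.
rewrite /tensor02_in /tensor11_in /=.
have := to_of_chart (atlas_smooth_chart Ac) (chart_invP cx).
move: (to_chart c _) (of_chart c _) => A B AB.
by rewrite !mulmxA -(mulmxA _ A B) AB mulmx1.
Qed.

Lemma smooth_tensor02_pull th g : smooth_tensor11 th -> smooth_tensor02 g ->
  smooth_tensor02 (fun p => th p *m g p *m (th p)^T).
Proof.
move=> st sg c Ac k; have Uo := @chart_cod_open _ _ _ c.
have tk := smooth_tensor11P k st Ac.
apply: (Ck_on_eq Uo) (Ck_on_mulmx Uo (Ck_on_mulmx Uo tk
  (smooth_tensor02P k sg Ac)) (Ck_on_trmx Uo tk)) => x cx.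
rewrite /tensor02_in /tensor11_in /=.
have := to_of_chart (atlas_smooth_chart Ac) (chart_invP cx).
move: (to_chart c _) (of_chart c _) (th _) (g _) => A B t G AB.
have BA : B^T *m A^T = 1%:M by rewrite -trmx_mul AB trmx1.
rewrite !trmx_mul !mulmxA -(mulmxA _ A B) AB mulmx1.
by rewrite -(mulmxA _ B^T A^T) BA mulmx1.
Qed.

Lemma smooth_form1_sqr eta : smooth_form1 eta ->
  smooth_tensor02 (fun p => eta p *m (eta p)^T).
Proof.
move=> se c Ac k; have Uo := @chart_cod_open _ _ _ c.
have ek := smooth_form1P k se Ac.
apply: (Ck_on_eq Uo) (Ck_on_mulmx Uo ek (Ck_on_trmx Uo ek)) => x cx.
rewrite /form1_in /=; move: (of_chart c _) (eta _) => B e.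
by rewrite !trmx_mul !mulmxA.
Qed.

Lemma smooth_funM (f f' : M -> R) : smooth_fun f -> smooth_fun f' ->
  smooth_fun (fun p => f p * f' p).
Proof.
by move=> sf sf' c Ac k; exact: Ck_onM (@chart_cod_open _ _ _ c) (sf c Ac k) (sf' c Ac k).
Qed.

Lemma smooth_funV (f : M -> R) : smooth_fun f -> (forall p, f p != 0) ->
  smooth_fun (fun p => (f p)^-1).
Proof.
move=> sf f0 c Ac k; apply: (Ck_onV (@chart_cod_open _ _ _ c)) (sf c Ac k) => x _.
exact: f0.
Qed.

Lemma metric_skew_matrix g th p :
  (forall u v, ev02 g p (ev11 th p u) v = - ev02 g p u (ev11 th p v)) ->
  th p *m g p = - (g p *m (th p)^T).
Proof.
move=> thg; apply: bilinear_form_inj => u v; rewrite mulmxN mulNmx.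
have := thg u v; rewrite /ev02 /ev11 => E.
rewrite !mulmxA; apply/matrixP => i j; rewrite !ord1 E [RHS]mxE trmx_mul.
by rewrite !mulmxA.
Qed.

Lemma metric_skew_ev g th p : th p *m g p = - (g p *m (th p)^T) ->
  forall u v, ev02 g p (ev11 th p u) v = - ev02 g p u (ev11 th p v).
Proof.
move=> E u v; rewrite /ev02 /ev11 -(mulmxA u) E mulmxN mulNmx mxE.
by rewrite trmx_mul !mulmxA.
Qed.

Lemma mul_entry11 (A B : 'M[R]_1) : (A *m B) 0 0 = A 0 0 * B 0 0.
Proof. by rewrite mxE big_ord1. Qed.

Lemma mul_entry_scale n (A : 'M[R]_1) (v : 'rV[R]_n) : A *m v = A 0 0 *: v.
Proof. by rewrite {1}[A]mx11_scalar mul_scalar_mx. Qed.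

(** The metric is the sum of the pull-backs of [g] by [P] and [th] and of the square of [eta].
    Composition with [th] exchanges the two pull-backs and kills [eta], whence compatibility; where
    [eta] vanishes [P] is the identity, whence positivity. *)
Lemma almost_contact_exists th X eta g : smooth_tensor11 th -> smooth_vfield X ->
  smooth_form1 eta -> riemannian_metric g ->
  (forall p, X p *m eta p = 1%:M) ->
  (forall p, th p *m th p = - 1%:M + eta p *m X p) ->
  has_almost_contact_metric M.
Proof.
move=> st sX se gr xe tt; have [sg _ _] := gr.
pose P p := - (th p *m th p).
have sP : smooth_tensor11 P by exact/smooth_tensor11N/smooth_tensor11M.
pose g' : tensor02 M := fun p =>
  (P p *m g p *m (P p)^T + th p *m g p *m (th p)^T) + eta p *m (eta p)^T.
have Pe p : P p *m eta p = 0.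
  by rewrite /P mulNmx -mulmxA (contact_th_eta (xe p) (tt p)) mulmx0 oppr0.
have tP p : th p *m P p = th p.
  by rewrite /P mulmxN mulmxA (contact_cubic (xe p) (tt p)) opprK.
have quad p (u : 'rV[R]_m) : (u *m g' p *m u^T) 0 0 =
    ((u *m P p) *m g p *m (u *m P p)^T) 0 0
    + ((u *m th p) *m g p *m (u *m th p)^T) 0 0 + ((u *m eta p) 0 0) ^+ 2.
  rewrite /g' !mulmxDr !mulmxDl mxE [X in X + _]mxE; congr (_ + _ + _).
  - by rewrite !trmx_mul !mulmxA.
  - by rewrite !trmx_mul !mulmxA.
  - rewrite mulmxA -(mulmxA _ _ u^T) -trmx_mul mul_entry11 expr2; congr (_ * _).
    by rewrite mxE.
exists th, X, eta, g'; split; split => //.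
- split.
  + apply: smooth_tensor02D; last exact: smooth_form1_sqr.
    by apply: smooth_tensor02D; exact: smooth_tensor02_pull.
  + move=> p u v; rewrite /ev02.
    have g'T : (g' p)^T = g' p.
      by rewrite /g' !linearD /= !trmx_mul !trmxK (metric_sym p gr) !mulmxA.
    have -> : u *m g' p *m v^T = (v *m g' p *m u^T)^T.
      by rewrite !trmx_mul trmxK g'T mulmxA.
    by rewrite mxE.
  + move=> p u u0; rewrite /ev02 quad.
    have G (v : 'rV[R]_m) : 0 <= (v *m g p *m v^T) 0 0.
      have [->|v0] := eqVneq v 0; first by rewrite !mul0mx mxE.
      by rewrite ltW// metric_posdef.
    have [e0|e0] := eqVneq (u *m eta p) 0.
      have -> : (u *m eta p) 0 0 = 0 by rewrite e0 mxE.
      rewrite expr0n addr0 ltr_pwDl//; apply: (metric_posdef p gr).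
      rewrite /P tt mulmxN mulmxDr mulmxN mulmx1 mulmxA e0 mul0mx addr0 opprK.
      exact: u0.
    apply: ltr_wpDl; first exact: addr_ge0.
    rewrite exprn_even_gt0//=; apply: contra e0 => /eqP e0.
    by apply/eqP/matrixP => i j; rewrite !ord1 e0 mxE.
- by move=> p; rewrite /ev1 xe mxE.
- move=> p v; rewrite /ev11 /ev1 -mulmxA tt mulmxDr mulmxN mulmx1 mulmxA.
  by rewrite mul_entry_scale.
- move=> p u v; rewrite /ev02 /ev11 /ev1.
  have tg : th p *m g' p *m (th p)^T = g' p - eta p *m (eta p)^T.
    have te := contact_th_eta (xe p) (tt p).
    have PE : th p *m th p = - P p by rewrite /P opprK.
    rewrite /g' addrK !mulmxDr !mulmxDl !mulmxA te !mul0mx addr0 tP PE.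
    rewrite -!(mulmxA _ _^T) -!trmx_mul tP PE.
    move: (P p) (th p) (g p) => a b c.
    by rewrite linearN /= mulmxN !mulNmx opprK addrC.
  have -> : u *m th p *m g' p *m (v *m th p)^T =
      u *m (th p *m g' p *m (th p)^T) *m v^T.
    by rewrite trmx_mul !mulmxA.
  rewrite tg mulmxBr mulmxBl mxE; congr (_ + _); rewrite mxE; congr (- _).
  have -> : u *m (eta p *m (eta p)^T) *m v^T = (u *m eta p) *m (v *m eta p)^T.
    by rewrite trmx_mul !mulmxA.
  by rewrite mul_entry11; congr (_ * _); rewrite mxE.
Qed.

End FormOperations.

(** * Restriction of fields on the cylinder to the slice at height 0 *)

Section Slice.
Variables (R : realType) (m : nat) (M : manifold R m).
Let W := cylinder M.

Lemma Ck_on_reindex k n a b a' b' (U : set 'rV[R]_n) (F : 'rV[R]_n -> 'M[R]_(a, b))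
    (G : 'rV[R]_n -> 'M[R]_(a', b')) (f : 'I_a' -> 'I_a) (h : 'I_b' -> 'I_b) :
  open U -> (forall x i j, U x -> G x i j = F x (f i) (h j)) ->
  Ck_on k U F -> Ck_on k U G.
Proof.
move=> Uo GF Fk; apply: (Ck_on_mx Uo) => i j.
by apply: (Ck_on_eq Uo) (Ck_on_coord (f i) (h j) Uo Fk) => x Ux; rewrite GF.
Qed.

Lemma tensor11_slice (J : tensor11 W) c x : atlas M c -> chart_cod c x ->
  tensor11_in (M := W) (cyl_chart c) J (row_mx x 0) =
  block_mx (of_chart c (chart_inv c x)) 0 0 1%:M *m J (chart_inv c x, 0)
  *m block_mx (to_chart c (chart_inv c x)) 0 0 1%:M.
Proof.
move=> Ac cx; have cp := chart_invP cx.
rewrite /tensor11_in.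
have -> : chart_inv (cyl_chart c) (row_mx x 0) = (chart_inv c x, 0).
  by rewrite /= row_mxKl row_mxKr mxE.
by rewrite (of_chart_cyl _ Ac cp) (to_chart_cyl _ Ac cp).
Qed.

Lemma tensor02_slice (h : tensor02 W) c x : atlas M c -> chart_cod c x ->
  tensor02_in (M := W) (cyl_chart c) h (row_mx x 0) =
  block_mx (of_chart c (chart_inv c x)) 0 0 1%:M *m h (chart_inv c x, 0)
  *m (block_mx (of_chart c (chart_inv c x)) 0 0 1%:M)^T.
Proof.
move=> Ac cx; have cp := chart_invP cx.
rewrite /tensor02_in.
have -> : chart_inv (cyl_chart c) (row_mx x 0) = (chart_inv c x, 0).
  by rewrite /= row_mxKl row_mxKr mxE.
by rewrite (of_chart_cyl _ Ac cp).
Qed.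

Variables (J : tensor11 W) (h : tensor02 W).
Hypotheses (sJ : smooth_tensor11 J) (hr : riemannian_metric h).

Let slice11 c : atlas M c -> forall k, Ck_on k (chart_cod c)
  (fun x => tensor11_in (M := W) (cyl_chart c) J (row_mx x 0)).
Proof.
by move=> Ac k; apply: Ck_on_slice; exact: (smooth_tensor11P k sJ (cyl_chart_atlas Ac)).
Qed.

Lemma smooth_slice_ul : smooth_tensor11 (M := M) (fun p => ulsubmx (J (p, 0))).
Proof.
move=> c Ac k; have Uo := @chart_cod_open _ _ _ c.
apply: (Ck_on_reindex (f := lshift 1) (h := lshift 1) Uo) (slice11 Ac k).
move=> x i j cx; rewrite (tensor11_slice _ Ac cx) /=.
move: (to_chart c _) (of_chart c _) (J _) => A B j'.
rewrite -[in RHS](submxK j') !mulmx_block !(mul0mx, mulmx0, mul1mx, mulmx1, addr0, add0r).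
by rewrite block_mxEul.
Qed.

Lemma smooth_slice_ur : smooth_form1 (M := M) (fun p => ursubmx (J (p, 0))).
Proof.
move=> c Ac k; have Uo := @chart_cod_open _ _ _ c.
apply: (Ck_on_reindex (f := lshift 1) (h := @rshift m 1) Uo) (slice11 Ac k).
move=> x i j cx; rewrite (tensor11_slice _ Ac cx) /=.
move: (to_chart c _) (of_chart c _) (J _) => A B j'.
rewrite -[in RHS](submxK j') !mulmx_block !(mul0mx, mulmx0, mul1mx, mulmx1, addr0, add0r).
by rewrite block_mxEur.
Qed.

Lemma smooth_slice_dl : smooth_vfield (M := M) (fun p => dlsubmx (J (p, 0))).
Proof.
move=> c Ac k; have Uo := @chart_cod_open _ _ _ c.
apply: (Ck_on_reindex (f := @rshift m 1) (h := lshift 1) Uo) (slice11 Ac k).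
move=> x i j cx; rewrite (tensor11_slice _ Ac cx) /=.
move: (to_chart c _) (of_chart c _) (J _) => A B j'.
rewrite -[in RHS](submxK j') !mulmx_block !(mul0mx, mulmx0, mul1mx, mulmx1, addr0, add0r).
by rewrite block_mxEdl.
Qed.

Lemma smooth_slice_dr : smooth_fun (M := M) (fun p => drsubmx (J (p, 0)) 0 0).
Proof.
move=> c Ac k; have Uo := @chart_cod_open _ _ _ c.
apply: (Ck_on_eq Uo) (Ck_on_coord (@rshift m 1 0) (@rshift m 1 0) Uo (slice11 Ac k)).
move=> x cx; rewrite (tensor11_slice _ Ac cx) /=.
move: (to_chart c _) (of_chart c _) (J _) => A B j'.
rewrite -[in LHS](submxK j') !mulmx_block !(mul0mx, mulmx0, mul1mx, mulmx1, addr0, add0r).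
by rewrite block_mxEdr.
Qed.

Lemma slice_metric : riemannian_metric (M := M) (fun p => ulsubmx (h (p, 0))).
Proof.
have [sh _ _] := hr.
split.
- move=> c Ac k; have Uo := @chart_cod_open _ _ _ c.
  have hk := Ck_on_slice (smooth_tensor02P k sh (cyl_chart_atlas Ac)).
  apply: (Ck_on_reindex (f := lshift 1) (h := lshift 1) Uo) hk.
  move=> x i j cx; rewrite (tensor02_slice _ Ac cx) /=.
  move: (of_chart c _) (h _) => B h'.
  rewrite -[in RHS](submxK h') tr_block_mx !trmx0 trmx1 !mulmx_block.
  by rewrite !(mul0mx, mulmx0, mul1mx, mulmx1, addr0, add0r) block_mxEul.
- move=> p u v; rewrite /ev02.
  have hT : (ulsubmx (h (p, 0)))^T = ulsubmx (h (p, 0)).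
    by rewrite trmx_ulsub (metric_sym (M := W) (p, 0) hr).
  have -> : u *m ulsubmx (h (p, 0)) *m v^T = (v *m ulsubmx (h (p, 0)) *m u^T)^T.
    by rewrite !trmx_mul trmxK hT mulmxA.
  by rewrite mxE.
- move=> p u u0; rewrite /ev02.
  have := @metric_posdef _ _ W h (p, 0) hr (row_mx u 0).
  rewrite row_mx_eq0 negb_and u0 /= => /(_ isT).
  rewrite -{1}(submxK (h (p, 0))) mul_row_block !mul0mx !addr0 tr_row_mx mul_row_col.
  by rewrite trmx0 mulmx0 addr0.
Qed.

(** Common last step of (1) => (2) and (4) => (1): the blocks of [J] over the slice are smooth
    fields on the base, and the metric to be averaged is the restriction of the one on the
    cylinder. *)
Lemma almost_contact_of_complex : (forall p, J p *m J p = - 1%:M) ->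
  has_almost_contact_metric M.
Proof.
move=> JJ.
pose d (p : M) := drsubmx (J (p, 0)) 0 0.
pose s p := 1 + d p ^+ 2.
have sd : smooth_fun d by exact: smooth_slice_dr.
have s0 p : s p != 0 by rewrite gt_eqF// ltr_pwDl ?sqr_ge0.
have ss : smooth_fun s.
  apply: smooth_funD; first exact: smooth_fun_cst.
  exact: smooth_funM.
have sV : smooth_fun (fun p => (s p)^-1) by exact: smooth_funV.
have sV' : smooth_fun (fun p => - (s p)^-1).
  have -> : (fun p => - (s p)^-1) = (fun p => -1 * (s p)^-1).
    by apply/funext => p; rewrite mulN1r.
  exact: smooth_funZ.
pose xi : vfield M := fun p => - (s p)^-1 *: dlsubmx (J (p, 0)).
pose th : tensor11 M := fun p => ulsubmx (J (p, 0))
  + - ((d p * (s p)^-1) *: (ursubmx (J (p, 0)) *m dlsubmx (J (p, 0)))).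
have alg p : xi p *m ursubmx (J (p, 0)) = 1%:M /\
    th p *m th p = - 1%:M + ursubmx (J (p, 0)) *m xi p.
  apply: contact_of_complex; rewrite -[X in block_mx _ _ _ X]mx11_scalar submxK.
  exact: JJ.
apply: (@almost_contact_exists _ _ M th xi _ _ _ _ smooth_slice_ur slice_metric).
- apply: smooth_tensor11D; first exact: smooth_slice_ul.
  apply: smooth_tensor11N; apply: smooth_tensor11Z; first exact: smooth_funM.
  by apply: smooth_form1_vfield; [exact: smooth_slice_ur|exact: smooth_slice_dl].
- by apply: smooth_vfieldZ => //; exact: smooth_slice_dl.
- by move=> p; have [] := alg p.
- by move=> p; have [] := alg p.
Qed.

End Slice.

(** * Implications between contact, Hermitian and gauge structures *)

Section Implications.
Variables (R : realType) (m : nat) (M : manifold R m).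

Lemma almost_contact_matrix (th : tensor11 M) xi eta g p :
  almost_contact_metric th xi eta g ->
  [/\ xi p *m eta p = 1%:M, th p *m th p = - 1%:M + eta p *m xi p
    & th p *m g p *m (th p)^T = g p - eta p *m (eta p)^T].
Proof.
move=> [_ [exi tt tg]]; split.
- by rewrite [LHS]mx11_scalar; congr (_%:M); exact: exi.
- apply: eq_row_mul => v; have := tt p v; rewrite /ev11 /ev1 -mulmxA => ->.
  by rewrite mulmxDr mulmxN mulmx1 mulmxA mul_entry_scale.
- apply: bilinear_form_inj => u v; have := tg p u v; rewrite /ev02 /ev11 /ev1 => E.
  rewrite !mulmxA -(mulmxA _ (th p)^T) -trmx_mul.
  apply/matrixP => i j; rewrite !ord1 E mulmxBr mulmxBl [RHS]mxE; congr (_ + _).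
  rewrite [RHS]mxE; congr (- _).
  have -> : u *m (eta p *m (eta p)^T) *m v^T = (u *m eta p) *m (v *m eta p)^T.
    by rewrite trmx_mul !mulmxA.
  by rewrite mul_entry11; congr (_ * _); rewrite [RHS]mxE.
Qed.

Lemma almost_contact_gauge_solution : has_almost_contact_metric M ->
  skew_gauge_solution_of_rank M m.-1.
Proof.
move=> [th [xi [eta [g acm]]]]; have [[st sx se gr] _] := acm.
apply: (skew_cubic_gauge_solution gr st).
- move=> p; have [xe tt tg] := almost_contact_matrix p acm.
  exact: metric_skew_ev (contact_skew xe tt tg).
- by move=> p; have [xe tt _] := almost_contact_matrix p acm; exact: contact_cubic xe tt.
- by move=> p; have [xe tt _] := almost_contact_matrix p acm; exact: contact_rank xe tt.
Qed.

Lemma almost_hermitian_gauge_solution : has_almost_hermitian M ->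
  skew_gauge_solution_of_rank M m.
Proof.
move=> [J [h [sJ hr JJ Jh]]].
have JJE p : J p *m J p = - 1%:M.
  apply: eq_row_mul => v; have := JJ p v; rewrite /ev11 -mulmxA => ->.
  by rewrite mulmxN mulmx1.
apply: (skew_cubic_gauge_solution hr sJ).
(* Invariance of [h] at the pair [J u], [v], together with [J J u = - u], is skewness. *)
- move=> p u v; have := Jh p (ev11 J p u) v; rewrite JJ => <-.
  by rewrite /ev02 mulNmx mulNmx mxE.
- by move=> p; rewrite JJE mulNmx mul1mx.
- move=> p; apply/eqP; rewrite -[_ == _]/(row_free _) row_free_unit.
  have JJ1 : J p *m - J p = 1%:M by rewrite mulmxN JJE opprK.
  exact: (mulmx1_unit JJ1).1.
Qed.

(** At full rank [g(th ., .)] is nondegenerate. [th] itself need not square to -1, but the polar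
    factor of this form does. *)
Lemma gauge_solution_complex : skew_gauge_solution_of_rank M m ->
  exists2 J : tensor11 M, smooth_tensor11 J & forall p, J p *m J p = - 1%:M.
Proof.
move=> [g [D [th [[gr _ _] [st thr thg _]]]]].
have E p := metric_skew_matrix (thg p).
have [sg _ _] := gr.
apply: (polar_field (w := fun p => th p *m g p) gr).
- exact: smooth_tensor02_lower.
- move=> p; rewrite /skew trmx_mul (metric_sym p gr) E opprK.
  by [].
- move=> p; rewrite unitmx_mul (posdef_unit (metric_posdef p gr)) andbT.
  by rewrite -row_free_unit /row_free thr.
Qed.

Lemma almost_contact_cylinder : has_almost_contact_metric M ->
  has_almost_hermitian (cylinder M).
Proof.
move=> [th [xi [eta [g acm]]]]; have [[st sx se gr] _] := acm.
exists (fun p => block_mx (th p.1) (eta p.1) (- xi p.1) 0), (cyl_metric g).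
have s0 : smooth_tensor11 (M := cylinder M)
    (fun p => block_mx (th p.1) (eta p.1) (- xi p.1) 0).
  have := smooth_cyl11 st se (smooth_vfieldN sx) (@smooth_fun_cst _ _ M 0).
  by rewrite raddf0.
have JJ p : block_mx (th p) (eta p) (- xi p) 0
    *m block_mx (th p) (eta p) (- xi p) 0 = - (1%:M : 'M[R]_(m + 1)).
  have [xe tt _] := almost_contact_matrix p acm.
  rewrite mulmx_block !(mulmx0, mul0mx, addr0) mulmxN !mulNmx xe tt addrK.
  rewrite (contact_th_eta xe tt) (contact_xi_th xe tt) oppr0.
  by rewrite (scalar_mx_block m 1) opp_block_mx !oppr0.
have Jh p : block_mx (th p) (eta p) (- xi p) 0 *m block_mx (g p) 0 0 1%:M
    *m (block_mx (th p) (eta p) (- xi p) 0)^T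
    = block_mx (g p) 0 0 1%:M :> 'M[R]_(m + 1).
  have [xe tt tg] := almost_contact_matrix p acm.
  have xt := contact_xi_th xe tt.
  have gT := metric_sym p gr.
  have xg : xi p *m g p = (eta p)^T.
    apply/eqP; rewrite -subr_eq0; apply/eqP.
    have : xi p *m (th p *m g p *m (th p)^T) = 0 by rewrite !mulmxA xt !mul0mx.
    by rewrite tg mulmxBr mulmxA xe mul1mx.
  rewrite tr_block_mx !mulmx_block !(mulmx0, mul0mx, addr0, add0r, mulmx1, trmx0).
  have e1 : th p *m g p *m (th p)^T + eta p *m (eta p)^T = g p by rewrite tg subrK.
  have e2 : th p *m g p *m (- xi p)^T = 0.
    rewrite linearN /= mulmxN -mulmxA -[g p]gT -trmx_mul xg trmxK.
    by rewrite (contact_th_eta xe tt) oppr0.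
  have e3 : - xi p *m g p *m (th p)^T = 0.
    by rewrite !mulNmx xg -trmx_mul (contact_th_eta xe tt) trmx0 oppr0.
  have e4 : - xi p *m g p *m (- xi p)^T = 1%:M.
    by rewrite linearN /= mulmxN !mulNmx opprK xg -trmx_mul xe trmx1.
  by rewrite e1 e2 e3 e4.
split=> //.
- exact: cyl_metric_riemannian.
- by move=> p v; rewrite /ev11 -mulmxA JJ mulmxN mulmx1.
- move=> p u v; rewrite /ev02 /ev11 trmx_mul !mulmxA.
  set J := block_mx (th _) _ _ _.
  have -> : u *m J *m cyl_metric g p *m J^T *m v^T =
      u *m (J *m cyl_metric g p *m J^T) *m v^T by rewrite !mulmxA.
  by rewrite Jh.
Qed.

End Implications.

(** * Oriented kernel of a skew form of corank one *)

Section Extension.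
Variables (R : realType) (m : nat).
Implicit Types (w B : 'M[R]_m) (eta : 'cV[R]_m) (v : 'rV[R]_m).

Definition ext_form w eta : 'M[R]_(m + 1) := block_mx w eta (- eta^T) 0.

Lemma ext_form_skew w eta : skew w -> skew (ext_form w eta).
Proof.
move=> ws; rewrite /skew /ext_form tr_block_mx ws opp_block_mx trmx0 oppr0.
by rewrite linearN /= trmxK opprK.
Qed.

Lemma ext_form_congr w eta B :
  ext_form (B *m w *m B^T) (B *m eta) =
  block_mx B 0 0 1%:M *m ext_form w eta *m (block_mx B 0 0 1%:M)^T.
Proof.
rewrite /ext_form tr_block_mx !trmx0 trmx1 !mulmx_block.
by rewrite !(mulmx0, mul0mx, addr0, add0r, mulmx1, mul1mx) trmx_mul mulNmx.
Qed.

(** Reflection of the line coordinate. It realises the change of sign of [eta] as a congruence of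
    determinant -1, and so compares the orientations induced by a kernel vector and by its
    opposite. *)
Definition last_flip : 'M[R]_(m + 1) := block_mx 1%:M 0 0 (- 1%:M).

Lemma det_last_flip : \det last_flip = -1.
Proof. by rewrite det_lblock det1 mul1r det_mx11 !mxE. Qed.

Lemma ext_formN w eta :
  ext_form w (- eta) = last_flip *m ext_form w eta *m last_flip^T.
Proof.
rewrite /ext_form /last_flip tr_block_mx !trmx0 trmx1 !mulmx_block.
rewrite !(mulmx0, mul0mx, addr0, add0r, mulmx1, mul1mx).
by rewrite !linearN /= trmx1 !(mulmxN, mulNmx, mulmx1, mul1mx, opprK).
Qed.

Lemma kernel_line w v x : (\rank w).+1 = m -> v != 0 -> v *m w = 0 ->
  x *m w = 0 -> exists k, x = k *: v.
Proof.
move=> wr v0 vw xw; apply/sub_rVP.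
have rk : \rank (kermx w) = 1%N by rewrite mxrank_ker -[X in (X - _)%N]wr subSnn.
have vk : (v <= kermx w)%MS by apply/sub_kermxP.
have /eqmxP E : (v == kermx w)%MS.
  by rewrite -(geq_leqif (mxrank_leqif_eq vk)) rk rank_rV v0.
by rewrite E; apply/sub_kermxP.
Qed.

(** Pairing a null vector [(x, t)] with [v] forces [t = 0], as [v] is null for [w] but not for
    [eta]. Then [x] lies on the kernel line, and [eta] forces it to vanish. *)
Lemma ext_form_unit w eta v : skew w -> (\rank w).+1 = m -> v != 0 -> v *m w = 0 ->
  v *m eta != 0 -> ext_form w eta \in unitmx.
Proof.
move=> ws wr v0 vw ve; rewrite -row_free_unit -kermx_eq0.
apply/negPn/negP => /rowV0Pn[y /sub_kermxP].
have [x [t ->]] : exists x t, y = row_mx x t.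
  by exists (lsubmx y), (rsubmx y); rewrite hsubmxK.
rewrite mul_row_block mulmx0 addr0 mulmxN -[0]row_mx0 => /eq_row_mx[xw xe] y0.
have vwT : w *m v^T = 0.
  by apply: trmx_inj; rewrite trmx_mul trmxK ws mulmxN vw oppr0 trmx0.
have t0 : t = 0.
  have := congr1 (fun z => z *m v^T) xw.
  rewrite mulmxBl -mulmxA vwT mulmx0 sub0r mul0mx -mulmxA -trmx_mul => /eqP.
  rewrite oppr_eq0 [v *m eta]mx11_scalar tr_scalar_mx mul_mx_scalar scaler_eq0.
  move=> /orP[/eqP e|/eqP//].
  by move: ve; rewrite [v *m eta]mx11_scalar e raddf0 eqxx.
rewrite t0 mul0mx subr0 in xw; have [k xk] := kernel_line wr v0 vw xw.
move: xe; rewrite xk -scalemxAl => /eqP; rewrite scaler_eq0 (negPf ve) orbF => /eqP k0.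
by move: y0; rewrite t0 xk k0 scale0r row_mx0 eqxx.
Qed.

End Extension.

(** * Smooth local unit kernel vectors *)

Section LocalKernel.
Variables (R : realType) (m : nat).

(** The norm is the square root of a 1 x 1 matrix, so that its smoothness is an instance of
    [Ck_on_sqrtmx]. *)
Lemma normalize (G : 'M[R]_m) (u : 'rV[R]_m) : posdef G -> u != 0 ->
  let v := invmx (sqrtmx (u *m G *m u^T)) *m u in
  (v *m G *m v^T) 0 0 = 1 /\ exists2 k, 0 < k & v = k *: u.
Proof.
move=> G0 u0; pose S := u *m G *m u^T.
have s0 : 0 < S 0 0 by exact: G0.
have ST : S^T = S by apply/matrixP => i j; rewrite !ord1 mxE.
have S0 : posdef S.
  move=> t t0; rewrite [S]mx11_scalar mul_mx_scalar -scalemxAl mxE mulr_gt0//.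
  by have := @posdef1 R _ t t0; rewrite mulmx1.
have [KT K0 KK] := sqrtmxP ST S0.
move=> v; rewrite /v -/S; move: (sqrtmx S) KT K0 KK => K KT K0 KK.
have Ku := posdef_unit K0.
split.
  rewrite trmx_mul trmx_inv KT !mulmxA.
  have -> : invmx K *m u *m G *m u^T *m invmx K = invmx K *m S *m invmx K.
    by rewrite /S !mulmxA.
  by rewrite -KK mulKmx// mulmxV// mxE.
have k0 : 0 < K 0 0.
  have := K0 1%:M; rewrite mul1mx trmx1 mulmx1; apply.
  by apply/negP => /eqP/matrixP/(_ 0 0)/eqP; rewrite !mxE oner_eq0.
exists (K 0 0)^-1; first by rewrite invr_gt0.
by rewrite {1}[K]mx11_scalar invmx_scalar mul_scalar_mx.
Qed.

(** Adding the square of the kernel vector [w0] at [x0] makes the matrix invertible near [x0], and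
    [w0 *m invmx (E x)] is then a smooth kernel vector. As [u] may change sign from point to point,
    it is compared with the normalised vector [nu] up to a sign, which is + at [x0]. *)
Lemma local_kernel (U : set 'rV[R]_m) (G W : 'rV[R]_m -> 'M[R]_m)
    (u : 'rV[R]_m -> 'rV[R]_m) x0 : open U -> U x0 ->
  (forall k, Ck_on k U G) -> (forall k, Ck_on k U W) ->
  (forall x, U x -> (G x)^T = G x) ->
  (forall x, U x -> posdef (G x)) -> (forall x, U x -> skew (W x)) ->
  (forall x, U x -> (\rank (W x)).+1 = m) -> (forall x, U x -> u x *m W x = 0) ->
  (forall x, U x -> (u x *m G x *m (u x)^T) 0 0 = 1) ->
  exists O : set 'rV[R]_m, exists nu : 'rV[R]_m -> 'rV[R]_m,
    [/\ open O, O x0 & O `<=` U] /\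
    [/\ forall k, Ck_on k O nu, forall x, O x -> nu x *m W x = 0 ,
        forall x, O x -> (nu x *m G x *m (nu x)^T) 0 0 = 1,
        forall x, O x -> u x = nu x \/ u x = - nu x & u x0 = nu x0].
Proof.
move=> Uo Ux0 Gk Wk GT G0 Ws Wr uW uG.
have u0 x : U x -> u x != 0.
  move=> Ux; apply/negP => /eqP ux; have := uG x Ux.
  by rewrite ux !mul0mx mxE => /esym/eqP; rewrite oner_eq0.
pose w0 := u x0.
pose E x := W x + w0^T *m w0.
have Ek k : Ck_on k U E by apply: (Ck_on_add Uo) => //; exact: Ck_on_cst.
pose mu x := w0 *m invmx (E x).
have w00 : w0 != 0 by exact: u0.
have w0s : 0 < (w0 *m w0^T) 0 0.
  by have := @posdef1 R _ w0 w00; rewrite mulmx1.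
have Ww0 : W x0 *m w0^T = 0.
  apply: trmx_inj; rewrite trmx_mul trmxK (Ws _ Ux0) mulmxN.
  by rewrite (uW _ Ux0) oppr0 trmx0.
have Eu0 : E x0 \in unitmx.
  rewrite -row_free_unit -kermx_eq0; apply/negPn/negP => /rowV0Pn[y /sub_kermxP yE y0].
  have yw : (y *m w0^T) 0 0 = 0.
    have : (y *m w0^T) *m (w0 *m w0^T) = 0.
      have : y *m E x0 *m w0^T = 0 by rewrite yE mul0mx.
      by rewrite /E mulmxDr mulmxDl -mulmxA Ww0 mulmx0 add0r !mulmxA.
    move=> /matrixP/(_ 0 0)/eqP; rewrite mul_entry11 [X in _ == X]mxE.
    rewrite mulf_eq0 (gt_eqF w0s) orbF.
    by move=> /eqP.
  have yW : y *m W x0 = 0.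
    move: yE; rewrite /E mulmxDr mulmxA mul_entry_scale yw scale0r addr0.
    by [].
  have [k yk] := kernel_line (Wr _ Ux0) w00 (uW _ Ux0) yW.
  move: yw; rewrite yk -scalemxAl mxE => /eqP; rewrite mulf_eq0 (gt_eqF w0s) orbF.
  by move=> /eqP k0; move: y0; rewrite yk k0 scale0r eqxx.
(* An interior is open by construction; continuity of the determinant puts [x0] in it. *)
pose O : set 'rV[R]_m := (U `&` [set x | E x \in unitmx])^°.
have Oo : open O by exact: open_interior.
have OU : O `<=` U by move=> x /interior_subset[].
have OE x : O x -> E x \in unitmx by move=> /interior_subset[].
have Ox0 : O x0.
  apply: filterI; first exact: open_nbhs_nbhs.
  have dc : {for x0, continuous (fun x => \det (E x))}.
    by apply: continuous_det_at; exact: (Ek 0%N x0 Ux0).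
  have n0 : nbhs (\det (E x0)) [set t | t != 0].
    apply: open_nbhs_nbhs; split; first exact: open_neq.
    by rewrite /= -unitfE -unitmxE.
  have h : \forall x \near x0, \det (E x) != 0 := dc _ n0.
  by apply: filterS h => x; rewrite /= -unitfE -unitmxE.
have muE x : O x -> mu x *m E x = w0 by move=> /OE Eu; rewrite /mu mulmxKV.
have mu0 x : O x -> mu x != 0.
  by move=> Ox; apply/negP => /eqP z; move: w00; rewrite -(muE x Ox) z mul0mx eqxx.
have muW x : O x -> mu x *m W x = 0.
  move=> Ox; have Ux := OU x Ox.
  have WuT : W x *m (u x)^T = 0.
    apply: trmx_inj; rewrite trmx_mul trmxK (Ws _ Ux) mulmxN.
    by rewrite (uW _ Ux) oppr0 trmx0.
  (* Otherwise [u x] would be a null vector of the invertible matrix [E x]. *)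
  have uw : (w0 *m (u x)^T) 0 0 != 0.
    apply/negP => /eqP z; have : u x *m E x = 0.
      rewrite /E mulmxDr uW// add0r mulmxA mul_entry_scale.
      have -> : (u x *m w0^T) 0 0 = (w0 *m (u x)^T)^T 0 0 by rewrite trmx_mul trmxK.
      by rewrite mxE z scale0r.
    move=> /(congr1 (fun y => y *m invmx (E x))); rewrite mulmxK ?OE// mul0mx => ux.
    by move: (u0 x Ux); rewrite ux eqxx.
  (* Pairing with [u x] eliminates [W x] and shows that [mu x] has product 1 with [w0]; the rank one
     term of [E x] then accounts for all of [w0], leaving [mu x *m W x = 0]. *)
  have := muE x Ox; rewrite {1}/E mulmxDr mulmxA mul_entry_scale => D.
  have := congr1 (mulmx^~ (u x)^T) D.
  rewrite /= mulmxDl -mulmxA WuT mulmx0 add0r -scalemxAl => /matrixP/(_ 0 0)/eqP.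
  rewrite [X in X == _]mxE.
  rewrite -[X in _ == X]mul1r (inj_eq (mulIf uw)) => /eqP k1.
  by move: D; rewrite k1 scale1r -[X in _ = X]add0r => /addIr.
pose nu x := invmx (sqrtmx (mu x *m G x *m (mu x)^T)) *m mu x.
have nuP x : O x -> (nu x *m G x *m (nu x)^T) 0 0 = 1 /\
    exists2 k, 0 < k & nu x = k *: mu x.
  by move=> Ox; apply: normalize; [exact/G0/OU|exact: mu0].
have nuW x : O x -> nu x *m W x = 0.
  by move=> Ox; have [_ [k _ ->]] := nuP x Ox; rewrite -scalemxAl muW// scaler0.
have nu0 x : O x -> nu x != 0.
  move=> Ox; have [_ [k k0 ->]] := nuP x Ox.
  by rewrite scaler_eq0 (gt_eqF k0) mu0.
have unu x : O x -> exists2 k, u x = k *: nu x & k ^+ 2 = 1.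
  move=> Ox; have Ux := OU x Ox.
  have [k uk] := kernel_line (Wr _ Ux) (nu0 x Ox) (nuW x Ox) (uW x Ux).
  exists k => //; have := uG x Ux; rewrite uk linearZ /= -scalemxAr -!scalemxAl.
  by rewrite scalerA mxE (nuP x Ox).1 mulr1 expr2.
exists O, nu; split => //; split => //.
- move=> k.
  have muk : Ck_on k O mu.
    apply: (Ck_on_mulmx Oo); first exact: Ck_on_cst.
    by apply: (Ck_on_invmx Oo) => //; exact: Ck_on_subset (Ek k).
  have Sk : Ck_on k O (fun x => mu x *m G x *m (mu x)^T).
    apply: (Ck_on_mulmx Oo); last exact: Ck_on_trmx.
    by apply: (Ck_on_mulmx Oo) => //; exact: Ck_on_subset (Gk k).
  have ST x : O x -> (mu x *m G x *m (mu x)^T)^T = mu x *m G x *m (mu x)^T.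
    by move=> _; apply/matrixP => i j; rewrite !ord1 [LHS]mxE.
  have S0 x : O x -> posdef (mu x *m G x *m (mu x)^T).
    move=> Ox t t0; rewrite [mu x *m _ *m _]mx11_scalar mul_mx_scalar -scalemxAl.
    rewrite mxE mulr_gt0//; first by apply: G0; [exact: OU|exact: mu0].
    by have := @posdef1 R _ t t0; rewrite mulmx1.
  apply: (Ck_on_mulmx Oo) => //; apply: (Ck_on_invmx Oo).
    by move=> x Ox; have [_ /posdef_unit] := sqrtmxP (ST x Ox) (S0 x Ox).
  exact: (Ck_on_sqrtmx Oo ST S0 Sk).
- by move=> x Ox; have [] := nuP x Ox.
- move=> x Ox; have [k -> /eqP] := unu x Ox; rewrite sqrf_eq1 => /orP[]/eqP ->.
    by left; rewrite scale1r.
  by right; rewrite scaleN1r.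
have [k uk k2] := unu x0 Ox0; have [_ [l l0 nul]] := nuP x0 Ox0.
(* At [x0], [mu] is a positive multiple of [w0], which rules out the opposite sign. *)
have mux0 : mu x0 = ((w0 *m w0^T) 0 0)^-1 *: w0.
  have w0E : w0 *m E x0 = (w0 *m w0^T) 0 0 *: w0.
    by rewrite /E mulmxDr uW// add0r mulmxA mul_entry_scale.
  rewrite /mu -{1}[w0](scalerK (lt0r_neq0 w0s)) -w0E.
  by rewrite -scalemxAl mulmxK.
move: k2 => /eqP; rewrite sqrf_eq1 => /orP[]/eqP kE; first by rewrite uk kE scale1r.
move: uk; rewrite kE nul mux0 !scalerA -/w0 => /eqP.
rewrite -subr_eq0 -{1}[w0]scale1r -scalerBl scaler_eq0 (negPf w00) orbF.
rewrite mulN1r mulNr opprK gt_eqF// addr_gt0// mulr_gt0// invr_gt0.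
by [].
Qed.

End LocalKernel.

(** * Choice of sign by the orientation *)

Section Orientation.
Variables (R : realType) (m : nat) (M : manifold R m).

(** Two reversals compensate: in a chart that reverses the orientation, the reference form is
    reflected too. *)
Lemma pos_congr_neg n (Om w C F : 'M[R]_n) : \det C < 0 -> \det F < 0 ->
  pos_congr Om w -> pos_congr (F *m Om *m F^T) (C *m w *m C^T).
Proof.
move=> C0 F0 [B B0 ->]; have Fu : F \in unitmx by rewrite unitmxE unitfE lt_eqF.
exists (C *m B *m invmx F).
  rewrite !det_mulmx det_inv -mulrA nmulr_rgt0// pmulr_rlt0// invr_lt0.
  by [].
rewrite !trmx_mul trmx_inv !mulmxA mulmxKV// -!mulmxA mulKVmx ?unitmx_tr// !mulmxA.
Qed.

Lemma det_block_diag1 (B : 'M[R]_m) : \det (block_mx B 0 0 (1%:M : 'M[R]_1)) = \det B.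
Proof. by rewrite det_ublock det1 mulr1. Qed.

Lemma pos_congr_ext (Om : 'M[R]_(m + 1)) B w eta : 0 < \det B ->
  pos_congr Om (ext_form w eta) ->
  pos_congr Om (ext_form (B *m w *m B^T) (B *m eta)).
Proof.
by move=> B0; rewrite ext_form_congr; apply: pos_congr_trans; rewrite det_block_diag1.
Qed.

Lemma of_chart_jacobian c c' (p : M) : smooth_chart c -> smooth_chart c' ->
  chart_dom c p -> chart_dom c' p ->
  of_chart c p = 'J (c' \o chart_inv c) (c p) *m of_chart c' p.
Proof.
move=> cs cs' cp c'p; have := to_of_chart cs' c'p.
rewrite (jacobian_to_of cs cs' cp c'p).
move: (of_chart c p) (of_chart c' p) (to_chart c' p) => C C' B BC.
by rewrite -mulmxA BC mulmx1.
Qed.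

Variables (A : set (chart R M m)) (g w : tensor02 M) (N : nat) (Om : 'M[R]_(m + 1)).
Hypothesis Ac : forall c, A c -> smooth_chart c.
Hypothesis Acov : forall p : M, exists2 c, A c & chart_dom c p.
Hypothesis Adet : forall c c' x, A c -> A c' -> overlap c c' x ->
  0 < \det ('J (c' \o chart_inv c) x).
Hypothesis gr : riemannian_metric g.
Hypothesis sw : smooth_tensor02 w.
Hypothesis ws : forall p, skew (w p : 'M[R]_m).
Hypothesis wr : forall p, (\rank (w p)).+1 = m.
Hypothesis mN : (m + 1)%N = (N + N)%N.
Hypothesis Os : skew Om.
Hypothesis Ou : Om \in unitmx.

Let E c (p : M) (v : 'rV[R]_m) : 'M[R]_(m + 1) :=
  ext_form (of_chart c p *m w p *m (of_chart c p)^T) (of_chart c p *m (g p *m v^T)).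

Lemma ext_metric_unit (G W : 'M[R]_m) (v : 'rV[R]_m) : skew W -> (\rank W).+1 = m ->
  v *m W = 0 -> (v *m G *m v^T) 0 0 = 1 -> ext_form W (G *m v^T) \in unitmx.
Proof.
move=> Ws Wr vW vG; have vg0 : v *m (G *m v^T) != 0.
  apply/negP; rewrite mulmxA => /eqP vg0.
  by move: vG; rewrite vg0 mxE => /esym/eqP; rewrite oner_eq0.
apply: (ext_form_unit Ws Wr _ vW vg0).
by apply/negP => /eqP v0; move: vg0; rewrite v0 mul0mx eqxx.
Qed.

Lemma unit_kernel_exists (G W : 'M[R]_m) : posdef G -> (\rank W).+1 = m ->
  exists v : 'rV[R]_m, v *m W = 0 /\ (v *m G *m v^T) 0 0 = 1.
Proof.
move=> G0 Wr; have : kermx W != 0.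
  by rewrite -mxrank_eq0 mxrank_ker -[X in (X - _)%N]Wr subSnn.
move=> /rowV0Pn[u /sub_kermxP uW u0]; have [v1 [k _ vk]] := normalize G0 u0.
eexists; split; last exact: v1.
by rewrite vk -scalemxAl uW scaler0.
Qed.

Lemma orientation_indep c c' p v : A c -> A c' -> chart_dom c p -> chart_dom c' p ->
  pos_congr Om (E c p v) -> pos_congr Om (E c' p v).
Proof.
move=> Acc Acc' cp c'p; rewrite /E.
rewrite (of_chart_jacobian (Ac Acc') (Ac Acc) c'p cp).
have := Adet Acc' Acc (overlap_at c'p cp).
move: ('J _ _) (of_chart c p) (w p) (g p) => T C W G T0 H.
have := pos_congr_ext T0 H; rewrite !trmx_mul !mulmxA.
by [].
Qed.

(** Of a unit kernel vector and its opposite, one induces the orientation of [Om];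
    [orientation_indep] carries the decision made in one chart to the whole oriented atlas. *)
Lemma oriented_kernel p : exists v : 'rV[R]_m, [/\ v *m w p = 0,
    (v *m g p *m v^T) 0 0 = 1
  & forall c, A c -> chart_dom c p -> pos_congr Om (E c p v)].
Proof.
have [c Acc cp] := Acov p.
have [v [vw vg]] := unit_kernel_exists (metric_posdef p gr) (wr p).
have Cu := of_chart_unit (Ac Acc) cp.
have EuE (u : 'rV[R]_m) : u *m w p = 0 -> (u *m g p *m u^T) 0 0 = 1 ->
    E c p u \in unitmx.
  move=> uw ug; have := ext_metric_unit (ws p) (wr p) uw ug.
  rewrite /E; move: (of_chart c p) Cu (w p) (g p) => C Cu W G Eu.
  rewrite ext_form_congr !unitmx_mul Eu unitmx_tr andbT.
  by rewrite !unitmxE det_block_diag1 -unitmxE Cu.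
have Ess (u : 'rV[R]_m) : skew (E c p u) by apply: ext_form_skew; exact: skew_congr.
have F0 : \det (last_flip R m) < 0 by rewrite det_last_flip ltrN10.
have [Ep|En] := pos_congr_flip mN Os Ou (Ess v) (EuE v vw vg) F0.
  exists v; split; [exact: vw|exact: vg|].
  by move=> c' Acc' c'p; exact: (orientation_indep Acc Acc' cp c'p Ep).
exists (- v); split.
- by rewrite mulNmx vw oppr0.
- by rewrite linearN /= mulmxN !mulNmx opprK.
- move=> c' Acc' c'p; apply: (orientation_indep Acc Acc' cp c'p).
  move: En; rewrite /E -ext_formN; move: (of_chart c p) (w p) (g p) => C W G.
  by rewrite linearN /= !mulmxN.
Qed.

Variable v : vfield M.
Hypothesis vw : forall p, v p *m w p = 0.
Hypothesis vg : forall p, (v p *m g p *m (v p)^T) 0 0 = 1.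
Hypothesis vpos : forall p c, A c -> chart_dom c p -> pos_congr Om (E c p (v p)).

Let K c x := ext_form (tensor02_in c w x) (tensor02_in c g x *m (vec_in c v x)^T).

(** A chart of the atlas of [M] may lie outside [A] and reverse the orientation. The sign of its
    Jacobian determinant with a chart of [A] is constant near [x0]; if it is negative, [Om] is
    replaced by its mirror image. *)
Lemma locally_oriented c x0 : atlas M c -> chart_cod c x0 ->
  exists Om' : 'M[R]_(m + 1), [/\ skew Om', Om' \in unitmx
    & \forall x \near x0, pos_congr Om' (K c x)].
Proof.
move=> Mc cx0; have cp0 := chart_invP cx0.
have [c1 Ac1 c1p] := Acov (chart_inv c x0).
have cs := atlas_smooth_chart Mc; have cs1 := Ac Ac1.
have ov0 : overlap c c1 x0 by [].
pose T x := 'J (c1 \o chart_inv c) x.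
have KE x : overlap c c1 x -> exists2 Y, pos_congr Om Y &
    K c x = block_mx (T x) 0 0 1%:M *m Y *m (block_mx (T x) 0 0 1%:M)^T.
  move=> [cx c1x]; have cp := chart_invP cx; set p := chart_inv c x in cp c1x.
  exists (E c1 p (v p)); first exact: vpos.
  have CE := of_chart_jacobian cs cs1 cp c1x.
  have TC := to_of_chart cs cp.
  rewrite /K /E -ext_form_congr /tensor02_in /vec_in -/p.
  have JT : 'J (c1 \o chart_inv c) (c p) = T x by rewrite /T /p chart_invK.
  move: CE TC; rewrite JT.
  move: (T x) (to_chart c p) (of_chart c p) (of_chart c1 p) (w p) (g p) (v p).
  move=> T' B C C1 W G u CE BC; congr ext_form.
    by rewrite CE !trmx_mul !mulmxA.
  rewrite trmx_mul -!mulmxA (mulmxA C^T) -trmx_mul BC trmx1 mul1mx CE.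
  by rewrite !mulmxA.
have Tc : {for x0, continuous (fun x => \det (T x))}.
  apply: continuous_det_at.
  have := Ck_on_jacobian (k := 0) (@overlap_open _ _ _ c c1)
    ((compatible_sym (cs1 _ Mc)).1 1%N).
  by move=> /(_ x0 ov0).
have Tu : \det (T x0) != 0.
  rewrite /T -(chart_invK cx0) (jacobian_to_of cs cs1 cp0 c1p) -unitfE -unitmxE.
  have := to_chart_unit cs1 c1p; have := of_chart_unit cs cp0.
  move: (of_chart c _) (to_chart c1 _) => C B Cu Bu.
  by rewrite unitmx_mul Cu.
have ov := near_overlap ov0.
have {Tu} [T0|T0] : 0 < \det (T x0) \/ \det (T x0) < 0.
  by move: Tu; rewrite neq_lt => /orP[]; [right|left].
  exists Om; split; [exact: Os|exact: Ou|]; have nb : nbhs (\det (T x0)) [set t | 0 < t].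
    by apply: open_nbhs_nbhs; split; [exact: open_gt|exact: T0].
  have Tn : \forall x \near x0, 0 < \det (T x) := Tc _ nb.
  apply: filterS2 ov Tn => x cx Tx; have [Y Yp ->] := KE x cx.
  by apply: pos_congr_trans Yp; rewrite det_block_diag1.
have F0 : \det (last_flip R m) < 0 by rewrite det_last_flip ltrN10.
exists (last_flip R m *m Om *m (last_flip R m)^T); split.
- exact: skew_congr.
- by rewrite !unitmx_mul unitmx_tr Ou !unitmxE unitfE lt_eqF.
- have nb : nbhs (\det (T x0)) [set t | t < 0].
    by apply: open_nbhs_nbhs; split; [exact: open_lt|exact: T0].
  have Tn : \forall x \near x0, \det (T x) < 0 := Tc _ nb.
  apply: filterS2 ov Tn => x cx Tx; have [Y Yp ->] := KE x cx.
  by apply: pos_congr_neg Yp; rewrite ?det_block_diag1.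
Qed.

(* Near a point [v] is [nu] or [- nu] for a smooth [nu]; [- nu] would induce the
   opposite orientation on the cylinder. *)
Lemma smooth_kernel_field : smooth_vfield v.
Proof.
move=> c Mc k; have Uo := @chart_cod_open _ _ _ c; have cs := atlas_smooth_chart Mc.
change (Ck_on k (chart_cod c) (vec_in c v)).
have [sg _ _] := gr.
pose G := tensor02_in c g; pose W := tensor02_in c w; pose u := vec_in c v.
have Gk l : Ck_on l (chart_cod c) G := smooth_tensor02P l sg Mc.
have Wk l : Ck_on l (chart_cod c) W := smooth_tensor02P l sw Mc.
have GT x : chart_cod c x -> (G x)^T = G x by move=> _; exact: tensor02_in_sym.
have G0 x : chart_cod c x -> posdef (G x) by move=> cx; exact: tensor02_in_posdef.
have Ws x : chart_cod c x -> skew (W x) by move=> cx; apply: skew_congr; exact: ws.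
have uP x : chart_cod c x ->
    [/\ (\rank (W x)).+1 = m, u x *m W x = 0 & (u x *m G x *m (u x)^T) 0 0 = 1].
  move=> cx; have cp := chart_invP cx; rewrite /u /W /G /tensor02_in /vec_in.
  have TC := to_of_chart cs cp; have Cu := of_chart_unit cs cp.
  move: (wr (chart_inv c x)) (vw (chart_inv c x)) (vg (chart_inv c x)).
  move: (to_chart c _) (of_chart c _) (w _) (g _) (v _) TC Cu.
  move=> B C w' g' v' BC Cu rw vw' vg'; split.
  - rewrite mxrankMfree ?row_free_unit ?unitmx_tr ?Cu//.
    have Cf : row_full C by rewrite row_full_unit.
    by rewrite (eqmxMfull w' Cf).
  - by rewrite !mulmxA -(mulmxA v') BC mulmx1 vw' mul0mx.
  - rewrite trmx_mul !mulmxA -(mulmxA v') BC mulmx1.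
    by rewrite -(mulmxA _ C^T) -trmx_mul BC trmx1 mulmx1.
have Wr x : chart_cod c x -> (\rank (W x)).+1 = m by move=> /uP[].
have uW x : chart_cod c x -> u x *m W x = 0 by move=> /uP[].
have uG x : chart_cod c x -> (u x *m G x *m (u x)^T) 0 0 = 1 by move=> /uP[].
apply: Ck_on_local => x0 cx0.
have [V [nu [[Vo Vx0 VU] [nuk nuW nuG unu u0]]]] :=
  local_kernel Uo cx0 Gk Wk GT G0 Ws Wr uW uG.
have [Om' [s' u' pos_u]] := locally_oriented Mc cx0.
pose L x := ext_form (W x) (G x *m (nu x)^T).
have Lc : {for x0, continuous L}.
  have Gc := Gk 0%N x0 cx0; have Wc := Wk 0%N x0 cx0; have nuc := nuk 0%N x0 Vx0.
  have ec : {for x0, continuous (fun x => G x *m (nu x)^T)}.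
    apply: continuous_mulmx_at; first exact: Gc.
    by apply: continuous_trmx_at; exact: nuc.
  apply: continuous_block_at; [exact: Wc|exact: ec| |exact: continuous_cst_at].
  apply: continuous_linmx_at; apply: continuous_trmx_at; exact: ec.
have Lp0 : pos_congr Om' (L x0) by rewrite /L -u0; exact: nbhs_singleton pos_u.
have Lp : \forall x \near x0, skew (L x) -> L x \in unitmx -> pos_congr Om' (L x).
  exact: Lc (near_pos_congr mN s' u' Lp0).
(* On the interior of this set [v] and [nu] both induce the orientation of [Om'], so they cannot
   differ by a sign. *)
pose Q := V `&` [set x | pos_congr Om' (K c x) /\
  (skew (L x) -> L x \in unitmx -> pos_congr Om' (L x))].
exists Q°.
  apply: filterI; first exact: open_nbhs_nbhs.
  by apply: filterS2 pos_u Lp => x.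
have Qo : open Q° by exact: open_interior.
have QV : Q° `<=` V by move=> x /interior_subset[].
apply: (Ck_on_eq Qo) (Ck_on_subset QV (nuk k)) => x Qx.
have [Vx [Kp LpI]] := interior_subset Qx; have cx := VU x Vx.
have Lpx : pos_congr Om' (L x).
  apply: LpI; first by apply: ext_form_skew; exact: Ws.
  by apply: ext_metric_unit; [exact: Ws|exact: Wr|exact: nuW|exact: nuG].
have [//|uE] := unu x Vx.
have F0 : \det (last_flip R m) < 0 by rewrite det_last_flip ltrN10.
case: (pos_congr_noflip mN s' u' F0 Lpx).
rewrite /L -ext_formN -mulmxN; move: Kp; rewrite /K -/(u x) uE.
by rewrite linearN.
Qed.

End Orientation.

Lemma gauge_solution_almost_contact (R : realType) (m N : nat) (M : manifold R m) :
  orientable M -> (0 < m)%N -> (m + 1)%N = (N + N)%N ->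
  skew_gauge_solution_of_rank M m.-1 -> has_almost_contact_metric M.
Proof.
move=> [A [Ac Acov Adet]] m0 mN [g [D [th [[gr _ _] [st thr thg _]]]]].
have [Om Os Ou] := skew_unit_exists R mN.
have [sg _ _] := gr.
pose w : tensor02 M := fun p => th p *m g p.
have sw : smooth_tensor02 w by exact: smooth_tensor02_lower.
have ws p : skew (w p : 'M[R]_m).
  rewrite /skew /w trmx_mul (metric_sym p gr) (metric_skew_matrix (thg p)) opprK.
  by [].
have wr p : (\rank (w p)).+1 = m.
  have gu : row_free (g p : 'M[R]_m).
    by rewrite row_free_unit; exact: posdef_unit (metric_posdef p gr).
  by rewrite /w (mxrankMfree _ gu) thr prednK.
have Acs c : A c -> smooth_chart c by move=> Acc c'; exact: Ac.
(* [v] is chosen point by point; the orientation condition recorded with it is what makes it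
   smooth. *)
have [v vP] := choice (oriented_kernel Acs Acov Adet gr ws wr mN Os Ou).
have vw p : v p *m w p = 0 by have [] := vP p.
have vg p : (v p *m g p *m (v p)^T) 0 0 = 1 by have [] := vP p.
have vpos p c : A c -> chart_dom c p -> pos_congr Om
    (ext_form (of_chart c p *m w p *m (of_chart c p)^T)
              (of_chart c p *m (g p *m (v p)^T))).
  by have [_ _] := vP p; exact.
have sv : smooth_vfield v.
  exact: (smooth_kernel_field Acs Acov gr sw ws wr mN Os Ou vw vg vpos).
pose eta : form1 M := fun p => g p *m (v p)^T.
have se : smooth_form1 eta.
  move=> c Mc k; have Uo := @chart_cod_open _ _ _ c.
  apply: (Ck_on_eq Uo) (Ck_on_mulmx Uo (smooth_tensor02P k sg Mc)
    (Ck_on_trmx Uo (smooth_vfieldP k sv Mc))) => x cx.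
  rewrite /tensor02_in /vec_in /eta /=.
  have := to_of_chart (atlas_smooth_chart Mc) (chart_invP cx).
  move: (to_chart c _) (of_chart c _) (g _) (v _) => B C G u BC.
  by rewrite trmx_mul !mulmxA -(mulmxA _ C^T) -trmx_mul BC trmx1 mulmx1.
have sW := smooth_cyl02 sw se (@smooth_fun_cst _ _ M 0).
have [||J sJ JJ] := polar_field (cyl_metric_riemannian gr) sW.
- by move=> p; rewrite raddf0; exact: ext_form_skew.
- by move=> p; rewrite raddf0; exact: ext_metric_unit.
exact: (almost_contact_of_complex sJ (cyl_metric_riemannian gr) JJ).
Qed.

Theorem corollary3p4 (R : realType) (n : nat) (M : manifold R (2 * n + 1)%N)
    (M_orientable : orientable M) :
  [<-> skew_gauge_solution_of_rank M (2 * n)%N;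
       has_almost_contact_metric M;
       has_almost_hermitian (cylinder M);
       skew_gauge_solution_of_rank (cylinder M) (2 * n + 2)%N].
Proof.
(* The ranks are brought to the forms used in the implications: the predecessor of the dimension of
   [M], and the dimension of the cylinder. *)
have n2 : (2 * n)%N = (2 * n + 1).-1 by rewrite addn1.
have n22 : (2 * n + 2)%N = (2 * n + 1 + 1)%N by rewrite -addnA.
rewrite n22 [in X in skew_gauge_solution_of_rank M X]n2.
tfae.
(* [n.+1] is half the dimension of the cylinder. *)
- apply: (@gauge_solution_almost_contact _ _ n.+1) => //; first by rewrite addn1.
  by rewrite !addn1 mul2n -addnn addSn addnS.
- exact: almost_contact_cylinder.
- exact: almost_hermitian_gauge_solution.
- move=> sol; have [J sJ JJ] := gauge_solution_complex sol.
  have [h [_ [_ [[hr _ _] _]]]] := sol.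
  exact: almost_contact_gauge_solution (almost_contact_of_complex sJ hr JJ).
Qed.
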